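(* Suppose the system $\partial_tU=\mathcal AU+F$ satisfies assumptions (I), (P), (H) of the context, and let $\mathcal G$ be a partition of speeds of $D_H$. Let $m_P\in\mathbb N_0$ be sufficiently large (depending on $a_P,B_P$), $m_H\in\mathbb N$ sufficiently large (depending on $\ell_*,B_H$), and $\rho_0$ sufficiently small (with respect to $m_P,m_H$). For $U:(0,T]\times\mathbb R^d\to\mathbb C^n$ and $F\in C((0,T]\times\mathbb R^d;\mathbb C^n)$ set $$U_{A,\pm}|_{Z_P\setminus Z_I}:=\mathcal E_PQ_P^{(m_P)}M_PU,\quad U_{A,\pm}|_{Z_I}:=U,\quad U_{A,\pm}|_{Z_H\setminus Z_I}:=\mathcal E_H^\pm Q_H^{(m_H)}M_HU,$$ $$F_{A,\pm}|_{Z_P\setminus Z_I}:=\mathcal E_PQ_P^{(m_P)}M_PF,\quad F_{A,\pm}|_{Z_I}:=F,\quad F_{A,\pm}|_{Z_H\setminus Z_I}:=\mathcal E_H^\pm Q_H^{(m_H)}M_HF.$$ (Asymptotics) Given any $u:\mathbb R^d\to\mathbb C^n$, there is a unique solution $U$ of the system with $U(T,\cdot)=u$. If also $\int_0^T|F_{A,-}(\tau,\xi)|\,d\tau<\infty$ for all $\xi\in\mathbb R^d$, then the limits $u_{A,-}(\xi):=\lim_{\tau\searrow0}U_{A,-}(\tau,\xi)$, $\xi\in\mathbb R^d$, exist and are finite, and for all $\xi\in\mathbb R^d$, $t_0\in(0,T]$, $$|u_{A,-}(\xi)|\lesssim|U_{A,-}(t_0,\xi)|+\int_0^{t_0}|F_{A,-}(\tau,\xi)|\,d\tau.$$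 (Scattering) Suppose $\int_0^T|F_{A,+}(\tau,\xi)|\,d\tau<\infty$ for all $\xi\in\mathbb R^d$. Then, given any $u_{A,+}:\mathbb R^d\to\mathbb C^n$, there is a unique solution $U$ of the system with $\lim_{\tau\searrow0}U_{A,+}(\tau,\xi)=u_{A,+}(\xi)$ for all $\xi\in\mathbb R^d$. In addition, for all $\xi\in\mathbb R^d$, $t_0\in(0,T]$, $$|U_{A,+}(t_0,\xi)|\lesssim|u_{A,+}(\xi)|+\int_0^{t_0}|F_{A,+}(\tau,\xi)|\,d\tau.$$
   Context: Conventions. $\mathbb N=\{1,2,\dots\}$, $\mathbb N_0=\mathbb N\cup\{0\}$, $\imath=\sqrt{-1}$, $\langle\eta\rangle=(1+|\eta|^2)^{1/2}$; $\mathbb C^n\otimes\mathbb C^n$ denotes $n\times n$ complex matrices. $A\lesssim B$ means $A\le CB$ with $C$ independent of the times, of $\xi$ and of the solution and data ($C$ may depend on the system, $T$, $\rho_0$ and the orders $m_P,m_H$). Setting. $d,n\in\mathbb N$, $T>0$, $\ell\in(-1,\infty)^d$, $\ell_*=\min_i\ell_i$, $\alpha>0$. $\lambda:[0,T]\to\mathbb R^d\otimes\mathbb R^d$ has the form $\lambda=\lambda^0+\lambda^*(t)$ with $\lambda^0$ constant, $\lambda^*$ smooth on $(0,T]$, $|(t\partial_t)^k\lambda^*|\le C_kt^\alpha$ for every $k\in\mathbb N$. Put $\mathfrak H(t,\xi)=[\sum_{i,j}t^{\ell_i+\ell_j}\lambda_{ij}(t)\xi_i\xi_j]^{1/2}$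 and assume $\mathfrak H^2\ge\lambda_0\sum_it^{2\ell_i}\xi_i^2$ for some $\lambda_0>0$. The system is $\partial_tU=\mathcal AU+F$ on $(0,T]_t\times\mathbb R^d_\xi$, with $F\in C((0,T]\times\mathbb R^d;\mathbb C^n)$ and $\mathcal A:(0,T]\times\mathbb R^d\to\mathbb C^n\otimes\mathbb C^n$; it is an ODE in $t$ for each fixed $\xi$, and solutions are $C^1$ in $t\in(0,T]$ for each $\xi$. Rescaled time and zones. $\langle\langle\xi\rangle\rangle=\max_i\langle\xi_i\rangle^{1/(\ell_i+1)}$, $z=\langle\langle\xi\rangle\rangle t$, $\mathfrak Z=\langle\langle\xi\rangle\rangle^{-1}\mathfrak H$, $\partial_z=\langle\langle\xi\rangle\rangle^{-1}\partial_t$ (so $z\partial_z=t\partial_t$). For small $\rho_0\in(0,1)$, the zones are the subsets of $(0,T]\times\mathbb R^d$: $Z_P=\{z\le\rho_0\}$, $Z_I=\{\rho_0\le z\le\rho_0^{-1}\}$, $Z_H=\{z\ge\rho_0^{-1}\}$. All hypotheses on zones are understood to hold for all sufficiently small $\rho_0$, the objects for smaller $\rho_0$ being restrictions of those for larger $\rho_0$. Symbol classes. For $V\subseteq(0,T]\times\mathbb R^d$, a normed space $X$ and $a\in\mathbb R$, $\mathcal S^a(V;X)$ is the set of continuous $f:V\to X$, smooth in $t$ for each $\xi$, with $|(z\partial_z)^kf|\le C_kz^a$ on $V$ for all $k\in\mathbb N_0$; $\mathcal S^a_*(V;X)$ is defined likewise with bounds $C_kz^a(1+|\log z|)^p$ for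 some $p\in\mathbb N_0$ independent of $k$. Below $X=\mathbb C^n\otimes\mathbb C^n$. (I) $\langle\langle\xi\rangle\rangle^{-1}\mathcal A\in\mathcal S^0(Z_I;X)$. (P) On $Z_P$: $M_P\mathcal AM_P^{-1}+(\partial_tM_P)M_P^{-1}=t^{-1}B_P+\langle\langle\xi\rangle\rangle R_P$, with $M_P$ invertible, $M_P,M_P^{-1}\in\mathcal S^0(Z_P;X)$; $B_P\in\mathcal S^0(Z_P;X)$ independent of $t$ and everywhere in Jordan normal form (eigenvalues on the diagonal, ones on the superdiagonal within blocks); $R_P\in\mathcal S^{a_P}_*(Z_P;X)$ for some $a_P>-1$. (H) On $Z_H$: $M_H\mathcal AM_H^{-1}+(\partial_tM_H)M_H^{-1}=\imath\mathfrak HD_H+t^{-1}B_H+\langle\langle\xi\rangle\rangle R_H$, with $M_H$ invertible, $M_H,M_H^{-1}\in\mathcal S^0(Z_H;X)$; $B_H\in\mathcal S^0(Z_H;X)$ of the form $B_H(t,\xi)=B_{H,\infty}(t,\xi/|\xi|)$; $D_H\in\mathcal S^0(Z_H;X)$ everywhere diagonal and real-valued; $R_H\in\mathcal S^{a_H}(Z_H;X)$ for some $a_H<-1$. Partition of speeds. A partition $\mathcal G$ of $\{1,\dots,n\}$ is a partition of speeds of $D_H$ if there is $d_0>0$ with $|D_{H,ii}-D_{H,jj}|\ge d_0$ on $Z_H$ whenever $i,j$ lie in different elements of $\mathcal G$. A matrix $W$ is $\mathcal G$-diagonal if $W_{ij}=0$ whenever $i,j$ lie in different elements of $\mathcal G$.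 For $\mathcal G$-diagonal $W$ let $W_s=\frac12(W+W^* )$, and let $W_\pm$ be the diagonal matrices whose $(i,i)$ entry, for $i\in\sigma\in\mathcal G$, is the largest ($+$), resp. smallest ($-$), eigenvalue of $[W_{s,jk}]_{j,k\in\sigma}$. Renormalization on $Z_P$. Fix sequences, $m\in\mathbb N$: $D_P^{(m)}\in\mathcal S_*^{m(a_P+1)-1}(Z_P;X)$ everywhere diagonal, $N_P^{(m)}\in\mathcal S_*^{m(a_P+1)}(Z_P;X)$, $R_P^{(m)}\in\mathcal S_*^{m(a_P+1)+a_P}(Z_P;X)$, such that, with $Q_P^{(m)}=I_n+\sum_{k=1}^mN_P^{(k)}$, $$R_P^{(m)}=\sum_{k=1}^m\partial_zN_P^{(k)}+Q_P^{(m)}(z^{-1}B_P+R_P)-\Big(z^{-1}B_P+\sum_{k=1}^mD_P^{(k)}\Big)Q_P^{(m)};$$ also $Q_P^{(0)}=I_n$, $R_P^{(0)}=R_P$. Put $\mathcal E_P=\exp(-(\log z)B_P)$. Renormalization on $Z_H$. Fix sequences, $m\in\mathbb N$: $D_H^{(m)}\in\mathcal S^{-(m-1)(\ell_*+1)-1}(Z_H;X)$ $\mathcal G$-diagonal, with $D_{H,ij}^{(1)}=z^{-1}B_{H,ij}+R_{H,ij}$ if $i,j$ lie in the same element of $\mathcal G$ (and $0$ otherwise), $N_H^{(m)}\in\mathcal S^{-m(\ell_*+1)}(Z_H;X)$, $R_H^{(m)}\in\mathcal S^{-m(\ell_*+1)-1}(Z_H;X)$, such that, with $Q_H^{(m)}=I_n+\sum_{k=1}^mN_H^{(k)}$,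 $$R_H^{(m)}=\sum_{k=1}^m\partial_zN_H^{(k)}+Q_H^{(m)}(\imath\mathfrak ZD_H+z^{-1}B_H+R_H)-\Big(\imath\mathfrak ZD_H+\sum_{k=1}^mD_H^{(k)}\Big)Q_H^{(m)}.$$ Let $B_{\mathcal G}$ be the $\mathcal G$-diagonal part of $B_H$ ($B_{\mathcal G,ij}=B_{H,ij}$ if $i,j$ lie in the same element of $\mathcal G$, and $0$ otherwise), with associated $B_{\mathcal G,\pm}=(B_{\mathcal G})_\pm$, $b^\pm_{H,i}(t,\xi)=\int_{\langle\langle\xi\rangle\rangle^{-1}\rho_0^{-1}}^t\tau^{-1}B_{\mathcal G,\pm,ii}(\tau,\xi)\,d\tau$ and $\mathcal E_H^\pm=\operatorname{diag}(e^{-b^\pm_{H,1}},\dots,e^{-b^\pm_{H,n}})$ on $Z_H$. *)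

(* Defs.v *)
From HB Require Import structures.
From mathcomp Require Import all_boot all_order all_algebra.
From mathcomp Require Import complex.
From mathcomp Require Import all_classical all_reals all_analysis.

Set Implicit Arguments.
Unset Strict Implicit.
Unset Printing Implicit Defensive.

Import Order.TTheory GRing.Theory Num.Theory.
Import numFieldNormedType.Exports.
Local Open Scope classical_set_scope.
Local Open Scope ring_scope.
Local Open Scope complex_scope.

(** * Norms, limits and derivatives of complex matrix-valued functions

    The library puts no topology on [R[i]].  Convergence of complex matrices
    is therefore expressed by real-valued convergence to 0 of the
    Hilbert-Schmidt norm of the difference; on column vectors this norm is the
    Euclidean one. *)

Section Analysis.
Variable R : realType.

Definition mxnorm (m p : nat) (A : 'M[R[i]]_(m, p)) : R :=
  Num.sqrt (\sum_i \sum_j ComplexField.Normc.normc (A i j) ^+ 2).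

Definition mxcvg (T : Type) (m p : nat) (F : set_system T)
    (f : T -> 'M[R[i]]_(m, p)) (l : 'M[R[i]]_(m, p)) : Prop :=
  mxnorm (f s - l) @[s --> F] --> (0 : R).

(* Derivative at [t] of the restriction of [f] to [D]; it is one-sided if [t]
   is an endpoint of the interval [D].  If [t] is isolated in [D], then every
   [l] qualifies: the hypotheses below accordingly use this relation only under
   existential quantifiers. *)
Definition has_deriv_on (m p : nat) (D : set R) (f : R -> 'M[R[i]]_(m, p))
    (t : R) (l : 'M[R[i]]_(m, p)) : Prop :=
  mxcvg (within D t^') (fun s => ((s - t)^-1)%:C *: (f s - f t)) l.

Definition continuous_fiber (m p : nat) (D : set R)
    (f : R -> 'M[R[i]]_(m, p)) : Prop :=
  forall t, D t -> mxcvg (within D (nbhs t)) f (f t).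

(* Exponential series, computed entrywise. *)
Definition mxexp (n : nat) (A : 'M[R[i]]_n) : 'M[R[i]]_n :=
  \matrix_(i, j)
    (limn (series (fun k : nat => complex.Re ((A ^+ k) i j) / (k`!)%:R))
     +i* limn (series (fun k : nat => complex.Im ((A ^+ k) i j) / (k`!)%:R))).

Definition is_jordan (n : nat) (B : 'M[R[i]]_n) : Prop :=
  forall i j : 'I_n,
    (j != i :> nat -> j != i.+1 :> nat -> B i j = 0) /\
    (j = i.+1 :> nat -> B i j = 0 \/ (B i j = 1 /\ B i i = B j j)).

(* For Hermitian [W] of positive size the set of real eigenvalues is finite,
   nonempty and exhausts the spectrum, so [sup] and [inf] are its largest and
   smallest elements. *)
Definition max_eigenvalue (n : nat) (W : 'M[R[i]]_n) : R :=
  sup [set x : R | eigenvalue W x%:C].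
Definition min_eigenvalue (n : nat) (W : 'M[R[i]]_n) : R :=
  inf [set x : R | eigenvalue W x%:C].

End Analysis.

(** * Matrices and partitions of the index set *)

Section Partition.
Variables (R : realType) (n : nat).
Implicit Types (G : {set {set 'I_n}}) (W : 'M[R[i]]_n).

Definition same_block G (i j : 'I_n) : bool := finset.pblock G i == finset.pblock G j.

Definition is_Gdiag G W : Prop :=
  forall i j, ~~ same_block G i j -> W i j = 0.

Definition Gdiag_part G W : 'M[R[i]]_n :=
  \matrix_(i, j) (if same_block G i j then W i j else 0).

Definition herm_part W : 'M[R[i]]_n := 2^-1 *: (W + map_mx conjc W^T).

Definition block_mx_of (s : {set 'I_n}) W : 'M[R[i]]_#|s| :=
  \matrix_(j, k) W (enum_val j) (enum_val k).

(* The (i, i) entry of [W_+] ([plus = true]) or [W_-] ([plus = false]). *)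
Definition extremal_entry (plus : bool) G W (i : 'I_n) : R :=
  let B := block_mx_of (finset.pblock G i) (herm_part W) in
  if plus then max_eigenvalue B else min_eigenvalue B.

End Partition.

(** * Rescaled time, zones, symbol classes *)

Section Setting.
Variables (R : realType) (d : nat).
Implicit Types (xi : 'rV[R]_d) (ell : 'I_d -> R) (V : set (R * 'rV[R]_d)).

Definition eucl_norm xi : R := Num.sqrt (\sum_i xi ord0 i ^+ 2).

Definition japanese (x : R) : R := Num.sqrt (1 + x ^+ 2).

(* [<<xi>>]; all the terms are at least 1 when [-1 < ell i], so that 1 is a
   neutral starting value for the maximum. *)
Definition abracket ell xi : R :=
  \big[Num.max/1]_(i < d) japanese (xi ord0 i) `^ (ell i + 1)^-1.

Definition ell_star ell : R := inf (range ell).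

Definition zvar ell (t : R) xi : R := abracket ell xi * t.

Definition strip (T : R) : set (R * 'rV[R]_d) := [set p | 0 < p.1 <= T].

Definition zoneP (T : R) ell (rho : R) : set (R * 'rV[R]_d) :=
  [set p | strip T p /\ zvar ell p.1 p.2 <= rho].
Definition zoneI (T : R) ell (rho : R) : set (R * 'rV[R]_d) :=
  [set p | strip T p /\ rho <= zvar ell p.1 p.2 <= rho^-1].
Definition zoneH (T : R) ell (rho : R) : set (R * 'rV[R]_d) :=
  [set p | strip T p /\ rho^-1 <= zvar ell p.1 p.2].

Definition hsq ell (lam : R -> 'M[R]_d) (t : R) xi : R :=
  \sum_i \sum_j
    t `^ (ell i + ell j) * lam t i j * xi ord0 i * xi ord0 j.

Definition hfun ell (lam : R -> 'M[R]_d) (t : R) xi : R :=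
  Num.sqrt (hsq ell lam t xi).

Definition zfun ell (lam : R -> 'M[R]_d) (t : R) xi : R :=
  (abracket ell xi)^-1 * hfun ell lam t xi.

Definition continuous_on (m p : nat) V (f : R -> 'rV[R]_d -> 'M[R[i]]_(m, p)) :
    Prop :=
  forall q, V q ->
    mxcvg (within V (nbhs q)) (fun r => f r.1 r.2) (f q.1 q.2).

(* [df] is the partial derivative of [f] in [t] on [V]. *)
Definition is_dt (m p : nat) V (f df : R -> 'rV[R]_d -> 'M[R[i]]_(m, p)) :
    Prop :=
  forall t xi, V (t, xi) ->
    has_deriv_on [set s | V (s, xi)] (f ^~ xi) t (df t xi).

(* [g k] plays the role of [(z d/dz)^k f = (t d/dt)^k f]; [w] is the weight as a
   function of [z]. *)
Definition symbol_class ell (n : nat) V (w : R -> R)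
    (f : R -> 'rV[R]_d -> 'M[R[i]]_n) : Prop :=
  continuous_on V f /\
  exists g : nat -> R -> 'rV[R]_d -> 'M[R[i]]_n,
    [/\ forall t xi, V (t, xi) -> g 0%N t xi = f t xi,
        forall k, is_dt V (g k) (fun t xi => (t^-1)%:C *: g k.+1 t xi)
      & forall k, exists C : R, forall t xi, V (t, xi) ->
          mxnorm (g k t xi) <= C * w (zvar ell t xi)].

Definition symbS ell (n : nat) V (a : R) (f : R -> 'rV[R]_d -> 'M[R[i]]_n) :
    Prop :=
  symbol_class ell V (fun z => z `^ a) f.

Definition symbSlog ell (n : nat) V (a : R) (f : R -> 'rV[R]_d -> 'M[R[i]]_n) :
    Prop :=
  exists p : nat,
    symbol_class ell V (fun z => z `^ a * (1 + `|ln z|) ^+ p) f.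

(** * Standing assumptions *)

Definition speed_assumption (T : R) ell (alpha : R) (lam0 : 'M[R]_d)
    (lams : R -> 'M[R]_d) (c0 : R) : Prop :=
  (exists g : nat -> R -> 'M[R]_d,
    [/\ forall t : R, 0 < t <= T -> g 0%N t = lams t,
        forall k (t : R), 0 < t <= T ->
          has_deriv_on `]0, T] (fun s => map_mx (real_complex R) (g k s)) t
            (map_mx (real_complex R) (t^-1 *: g k.+1 t))
      & forall k, (1 <= k)%N -> exists C : R, forall t : R, 0 < t <= T ->
          mxnorm (map_mx (real_complex R) (g k t)) <= C * t `^ alpha]) /\
  (forall (t : R) xi, 0 < t <= T ->
     c0 * \sum_i t `^ (2 * ell i) * xi ord0 i ^+ 2
       <= hsq ell (fun s => lam0 + lams s) t xi).

Variable n : nat.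
Implicit Types (A M B D X : R -> 'rV[R]_d -> 'M[R[i]]_n).
Implicit Types (Ds Ns Rs : nat -> R -> 'rV[R]_d -> 'M[R[i]]_n).

Definition assumption_I T ell (rhos : R) A : Prop :=
  forall rho : R, 0 < rho <= rhos ->
    symbS ell (zoneI T ell rho) 0
      (fun t xi => ((abracket ell xi)^-1)%:C *: A t xi).

Definition invertible_symbol ell V M : Prop :=
  [/\ forall t xi, V (t, xi) -> M t xi \in unitmx,
      symbS ell V 0 M & symbS ell V 0 (fun t xi => invmx (M t xi))].

(* [M A M^-1 + (d_t M) M^-1 = X] on [V]. *)
Definition conjugates_to V A M X : Prop :=
  exists2 dM, is_dt V M dM &
    forall t xi, V (t, xi) ->
      M t xi *m A t xi *m invmx (M t xi) + dM t xi *m invmx (M t xi) = X t xi.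

Definition assumption_P T ell (rhos : R) A M (BP : 'rV[R]_d -> 'M[R[i]]_n)
    (RP : R -> 'rV[R]_d -> 'M[R[i]]_n) (aP : R) : Prop :=
  let Z := zoneP T ell rhos in
  [/\ invertible_symbol ell Z M,
      symbS ell Z 0 (fun _ xi => BP xi),
      forall xi, is_jordan (BP xi),
      -1 < aP /\ symbSlog ell Z aP RP
    & conjugates_to Z A M
        (fun t xi => (t^-1)%:C *: BP xi + (abracket ell xi)%:C *: RP t xi)].

Definition assumption_H T ell (lam : R -> 'M[R]_d) (rhos : R) A M D B
    (RH : R -> 'rV[R]_d -> 'M[R[i]]_n) (aH : R) : Prop :=
  let Z := zoneH T ell rhos in
  [/\ invertible_symbol ell Z M,
      symbS ell Z 0 B /\
        (exists Binf : R -> 'rV[R]_d -> 'M[R[i]]_n, forall t xi,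
          Z (t, xi) -> xi != 0 ->
          B t xi = Binf t ((eucl_norm xi)^-1 *: xi)),
      symbS ell Z 0 D /\
        (forall t xi, Z (t, xi) ->
          is_diag_mx (D t xi) /\ forall i j, complex.Im (D t xi i j) = 0),
      aH < -1 /\ symbS ell Z aH RH
    & conjugates_to Z A M
        (fun t xi => ('i * (hfun ell lam t xi)%:C) *: D t xi
           + (t^-1)%:C *: B t xi + (abracket ell xi)%:C *: RH t xi)].

Definition partition_of_speeds T ell (rhos : R) D (G : {set {set 'I_n}}) :
    Prop :=
  finset.partition G (finset.setTfor 'I_n) /\
  exists2 d0 : R, 0 < d0 &
    forall t xi, zoneH T ell rhos (t, xi) ->
      forall i j : 'I_n, ~~ same_block G i j ->
        d0 <= ComplexField.Normc.normc (D t xi i i - D t xi j j).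

(** * Renormalization *)

Definition Qmx Ns (m : nat) (t : R) xi : 'M[R[i]]_n :=
  1%:M + \sum_(1 <= k < m.+1) Ns k t xi.

(* [R^(m) = sum_k d_z N^(k) + Q^(m) (P0 + P1) - (P0 + sum_k D^(k)) Q^(m)] on [V],
   where [d_z = <<xi>>^-1 d_t]. *)
Definition renorm_identity ell V (P0 P1 : R -> 'rV[R]_d -> 'M[R[i]]_n)
    Ds Ns Rs : Prop :=
  exists dN : nat -> R -> 'rV[R]_d -> 'M[R[i]]_n,
    (forall k, (1 <= k)%N -> is_dt V (Ns k) (dN k)) /\
    (forall m, (1 <= m)%N -> forall t xi, V (t, xi) ->
       Rs m t xi =
         \sum_(1 <= k < m.+1) ((abracket ell xi)^-1)%:C *: dN k t xi
         + Qmx Ns m t xi *m (P0 t xi + P1 t xi)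
         - (P0 t xi + \sum_(1 <= k < m.+1) Ds k t xi) *m Qmx Ns m t xi).

Definition renormalization_P T ell (rhos : R) (BP : 'rV[R]_d -> 'M[R[i]]_n)
    (RP : R -> 'rV[R]_d -> 'M[R[i]]_n) (aP : R) Ds Ns Rs : Prop :=
  let Z := zoneP T ell rhos in
  [/\ forall m, (1 <= m)%N ->
        [/\ symbSlog ell Z (m%:R * (aP + 1) - 1) (Ds m),
            forall t xi, Z (t, xi) -> is_diag_mx (Ds m t xi),
            symbSlog ell Z (m%:R * (aP + 1)) (Ns m)
          & symbSlog ell Z (m%:R * (aP + 1) + aP) (Rs m)],
      forall t xi, Z (t, xi) -> Rs 0%N t xi = RP t xi
    & renorm_identity ell Z (fun t xi => ((zvar ell t xi)^-1)%:C *: BP xi) RP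
        Ds Ns Rs].

Definition renormalization_H T ell (lam : R -> 'M[R]_d) (rhos : R) D B
    (RH : R -> 'rV[R]_d -> 'M[R[i]]_n) (G : {set {set 'I_n}}) Ds Ns Rs : Prop :=
  let Z := zoneH T ell rhos in
  let l1 := ell_star ell + 1 in
  [/\ forall m, (1 <= m)%N ->
        [/\ symbS ell Z (- ((m%:R - 1) * l1) - 1) (Ds m),
            forall t xi, Z (t, xi) -> is_Gdiag G (Ds m t xi),
            symbS ell Z (- (m%:R * l1)) (Ns m)
          & symbS ell Z (- (m%:R * l1) - 1) (Rs m)],
      forall t xi, Z (t, xi) ->
        Ds 1%N t xi =
          Gdiag_part G (((zvar ell t xi)^-1)%:C *: B t xi + RH t xi)
    & renorm_identity ell Z
        (fun t xi => ('i * (zfun ell lam t xi)%:C) *: D t xi)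
        (fun t xi => ((zvar ell t xi)^-1)%:C *: B t xi + RH t xi)
        Ds Ns Rs].

Definition Emx_P ell (BP : 'rV[R]_d -> 'M[R[i]]_n) (t : R) xi : 'M[R[i]]_n :=
  mxexp (- (ln (zvar ell t xi))%:C *: BP xi).

Definition bexp_H (plus : bool) ell (rho : R) (G : {set {set 'I_n}}) B
    (i : 'I_n) (t : R) xi : R :=
  \int[lebesgue_measure]_(tau in `[(abracket ell xi)^-1 * rho^-1, t])
    (tau^-1 * extremal_entry plus G (Gdiag_part G (B tau xi)) i).

Definition Emx_H (plus : bool) ell (rho : R) (G : {set {set 'I_n}}) B
    (t : R) xi : 'M[R[i]]_n :=
  diag_mx (\row_i (expR (- bexp_H plus ell rho G B i t xi))%:C).

(* The map [U |-> U_A,+] ([plus = true]) or [U |-> U_A,-] ([plus = false]), also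
   applied to [F].  For [0 < rho < 1], the three branches are the restrictions
   to [Z_P \ Z_I], [Z_I] and [Z_H \ Z_I]. *)
Definition asymp (plus : bool) ell (rho : R) (BP : 'rV[R]_d -> 'M[R[i]]_n)
    (NP : nat -> R -> 'rV[R]_d -> 'M[R[i]]_n) (mP : nat)
    (MP : R -> 'rV[R]_d -> 'M[R[i]]_n)
    (G : {set {set 'I_n}}) (BH : R -> 'rV[R]_d -> 'M[R[i]]_n)
    (NH : nat -> R -> 'rV[R]_d -> 'M[R[i]]_n) (mH : nat)
    (MH : R -> 'rV[R]_d -> 'M[R[i]]_n)
    (U : R -> 'rV[R]_d -> 'cV[R[i]]_n) (t : R) xi : 'cV[R[i]]_n :=
  let z := zvar ell t xi in
  if z < rho then
    Emx_P ell BP t xi *m Qmx NP mP t xi *m MP t xi *m U t xi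
  else if z <= rho^-1 then U t xi
  else Emx_H plus ell rho G BH t xi *m Qmx NH mH t xi *m MH t xi *m U t xi.

(** * Solutions *)

Definition is_solution (T : R) A (F U : R -> 'rV[R]_d -> 'cV[R[i]]_n) : Prop :=
  exists dU : R -> 'rV[R]_d -> 'cV[R[i]]_n,
    [/\ is_dt (strip T) U dU,
        forall xi, continuous_fiber `]0, T] (dU ^~ xi)
      & forall (t : R) xi, 0 < t <= T ->
          dU t xi = A t xi *m U t xi + F t xi].

Definition agree_on_strip (T : R) (U U' : R -> 'rV[R]_d -> 'cV[R[i]]_n) : Prop :=
  forall (t : R) xi, 0 < t <= T -> U t xi = U' t xi.

Definition initial_limit (U : R -> 'rV[R]_d -> 'cV[R[i]]_n)
    (u : 'rV[R]_d -> 'cV[R[i]]_n) : Prop :=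
  forall xi, mxcvg 0^'+ (U ^~ xi) (u xi).

Definition norm_integral (F : R -> 'rV[R]_d -> 'cV[R[i]]_n) (t : R) xi : \bar R :=
  (\int[lebesgue_measure]_(tau in `]0%R, t]) (mxnorm (F tau xi))%:E)%E.

End Setting.

(* Main.v *)
Require Import Defs.
From HB Require Import structures.
From mathcomp Require Import all_boot all_order all_algebra.
From mathcomp Require Import complex.
From mathcomp Require Import all_classical all_reals all_analysis.
From mathcomp Require Import ring lra.
From mathcomp Require Import measurable_realfun lebesgue_measure.

(** For a fixed frequency xi the system is a linear ODE on (0, T], and in each of the
    three zones a gauge, that is an invertible matrix function W, makes the equation
    for W U almost trivial.

    In zone P the gauge is E_P Q_P M_P.  Conjugation by M_P gives t^-1 B_P plus a
    remainder, Q_P replaces the remainder by diagonal matrices plus a much smaller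
    remainder, and E_P cancels t^-1 B_P.  Conjugation by E_P is not bounded, but on
    diagonal matrices it costs only an arbitrarily small power of z, because a Jordan
    matrix commutes with its diagonal and its nilpotent part can be rescaled to be
    small ([jordan_conj_growth]); on the last remainder it costs z^(-2 sup |B_P|), for
    which a large m_P pays.  So W U satisfies an equation whose coefficient is
    integrable in t down to 0, uniformly in xi ([gaugeP_rate]).

    In zone H the gauge is E_H Q_H M_H.  The coefficient is then a skew-adjoint
    oscillating term, the term t^-1 times B_G minus its extremal diagonal, and an
    integrable remainder.  The first drops out of d|W U|^2/dt, and the second has a sign
    by the Rayleigh bound, negative for + and positive for -; hence |W U| is controlled
    forward in time for + and backward in time for - ([gaugeH_rate]).  In zone I the
    time interval has length at most a multiple of 1 / <<xi>>, and |A| is at most a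
    multiple of <<xi>>, so that no gauge is needed.

    Energy estimates with Gronwall's inequality in the three zones, glued at the two
    zone boundaries where the gauges are bounded with bounded inverses, bound |U_A| at the
    later of two times by its value at the earlier one for +, and conversely for -, with
    a constant independent of xi ([propagates_all], [adapted_gauges_exist]).  Near t = 0 the derivative of W U is
    integrable, so the limit exists ([gauged_limit]), and letting one of the two times
    tend to 0 gives the two inequalities.

    Existence and uniqueness for data at T is the linear theory on (0, T]
    ([linear_ode_exists], [linear_ode_unique]), once A is known to be continuous in t
    ([coefficient_continuous]).  For data at 0, the forward estimate shows that a
    solution of the homogeneous system with limit 0 vanishes; hence the limit at 0 of
    the gauged fundamental matrix is invertible, and every limit is attained exactly
    once ([scattering_exists], [zero_limit_unique]). *)

Set Implicit Arguments.
Unset Strict Implicit.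
Unset Printing Implicit Defensive.

Import Order.TTheory GRing.Theory Num.Theory.
Import numFieldNormedType.Exports.
Local Open Scope classical_set_scope.
Local Open Scope ring_scope.
Local Open Scope complex_scope.

(** * Euclidean structure on complex matrices *)

Section MxNorm.
Variable R : realType.
Implicit Types (m n p : nat) (c x : R[i]).
Local Notation Re := complex.Re.
Local Notation Im := complex.Im.
Local Notation normc := ComplexField.Normc.normc.

(** The real part of the Hermitian inner product: the energy method uses only the
    derivative 2 rdot Y' Y of |Y|^2. *)
Definition rdot m p (A B : 'M[R[i]]_(m, p)) : R :=
  \sum_i \sum_j (Re (A i j) * Re (B i j) + Im (A i j) * Im (B i j)).

Lemma complexReD x y : Re (x + y) = Re x + Re y. Proof. by case: x y => ? ? []. Qed.
Lemma complexImD x y : Im (x + y) = Im x + Im y. Proof. by case: x y => ? ? []. Qed.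
Lemma complexReN x : Re (- x) = - Re x. Proof. by case: x. Qed.
Lemma complexImN x : Im (- x) = - Im x. Proof. by case: x. Qed.
Lemma complexReM x y : Re (x * y) = Re x * Re y - Im x * Im y.
Proof. by case: x y => ? ? []. Qed.
Lemma complexImM x y : Im (x * y) = Re x * Im y + Im x * Re y.
Proof. by case: x y => ? ? []. Qed.
Lemma complexRe_sum I (r : seq I) (P : pred I) (f : I -> R[i]) :
  Re (\sum_(i <- r | P i) f i) = \sum_(i <- r | P i) Re (f i).
Proof. exact: (big_morph _ complexReD). Qed.
Lemma complexIm_sum I (r : seq I) (P : pred I) (f : I -> R[i]) :
  Im (\sum_(i <- r | P i) f i) = \sum_(i <- r | P i) Im (f i).
Proof. exact: (big_morph _ complexImD). Qed.

Lemma sqr_normc_ReIm x : normc x ^+ 2 = Re x ^+ 2 + Im x ^+ 2.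
Proof.
by case: x => a b /=; rewrite sqr_sqrtr // addr_ge0 // sqr_ge0.
Qed.

Lemma normc_ge0 x : 0 <= normc x.
Proof. by case: x => a b; rewrite sqrtr_ge0. Qed.

Lemma normc_realC (r : R) : normc r%:C = `|r|.
Proof. by rewrite /= expr0n /= addr0 sqrtr_sqr. Qed.

Lemma Re_le_normc x : `|Re x| <= normc x.
Proof.
by rewrite -sqrtr_sqr; case: x => a b /=; rewrite ler_wsqrtr // lerDl sqr_ge0.
Qed.

Lemma Im_le_normc x : `|Im x| <= normc x.
Proof.
by rewrite -sqrtr_sqr; case: x => a b /=; rewrite ler_wsqrtr // lerDr sqr_ge0.
Qed.

Lemma rdotxx m p (A : 'M[R[i]]_(m, p)) : rdot A A = mxnorm A ^+ 2.
Proof.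
rewrite /mxnorm sqr_sqrtr; last by do 2 (apply: sumr_ge0 => ? _); exact: sqr_ge0.
by apply: eq_bigr => i _; apply: eq_bigr => j _; rewrite sqr_normc_ReIm !expr2.
Qed.

Lemma mxnorm_ge0 m p (A : 'M[R[i]]_(m, p)) : 0 <= mxnorm A.
Proof. exact: sqrtr_ge0. Qed.

Lemma rdotC m p (A B : 'M[R[i]]_(m, p)) : rdot A B = rdot B A.
Proof.
apply: eq_bigr => i _; apply: eq_bigr => j _.
by rewrite mulrC [X in _ + X]mulrC.
Qed.

Lemma rdotDl m p (A B D : 'M[R[i]]_(m, p)) : rdot (A + B) D = rdot A D + rdot B D.
Proof.
rewrite -big_split /=; apply: eq_bigr => i _; rewrite -big_split /=.
by apply: eq_bigr => j _; rewrite !mxE complexReD complexImD; ring.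
Qed.

Lemma rdotDr m p (A B D : 'M[R[i]]_(m, p)) : rdot A (B + D) = rdot A B + rdot A D.
Proof. by rewrite !(rdotC A) rdotDl. Qed.

Lemma rdotZl m p (r : R) (A B : 'M[R[i]]_(m, p)) : rdot (r%:C *: A) B = r * rdot A B.
Proof.
rewrite mulr_sumr; apply: eq_bigr => i _; rewrite mulr_sumr.
by apply: eq_bigr => j _; rewrite !mxE complexReM complexImM /=; ring.
Qed.

Lemma rdotZr m p (r : R) (A B : 'M[R[i]]_(m, p)) : rdot A (r%:C *: B) = r * rdot A B.
Proof. by rewrite rdotC rdotZl rdotC. Qed.

Lemma scaleN1C m p (A : 'M[R[i]]_(m, p)) : - A = (-1)%:C *: A.
Proof. by rewrite rmorphN1 scaleN1r. Qed.

Lemma rdotNl m p (A B : 'M[R[i]]_(m, p)) : rdot (- A) B = - rdot A B.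
Proof. by rewrite scaleN1C rdotZl mulN1r. Qed.

Lemma rdotNr m p (A B : 'M[R[i]]_(m, p)) : rdot A (- B) = - rdot A B.
Proof. by rewrite rdotC rdotNl rdotC. Qed.

Lemma mxnorm0_eq0 m p (A : 'M[R[i]]_(m, p)) : mxnorm A = 0 -> A = 0.
Proof.
move=> A0; have := rdotxx A; rewrite A0 expr0n /= => /eqP.
have ge0 (x : R[i]) : 0 <= Re x * Re x + Im x * Im x.
  by rewrite addr_ge0 // -expr2 sqr_ge0.
rewrite psumr_eq0 => [/allP A0'|i _]; last exact: sumr_ge0.
apply/matrixP => i j; rewrite mxE.
have := A0' i (mem_index_enum _); rewrite psumr_eq0 //= => /allP /(_ j (mem_index_enum _)).
rewrite /= -!expr2 paddr_eq0 ?sqr_ge0 // !sqrf_eq0 => /andP[/eqP a /eqP b].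
by apply/eqP; rewrite eq_complex a b !eqxx.
Qed.

Lemma mxnorm0 m p : mxnorm (0 : 'M[R[i]]_(m, p)) = 0.
Proof.
apply/eqP; rewrite -sqrf_eq0 -rdotxx; apply/eqP.
by apply: big1 => i _; apply: big1 => j _; rewrite mxE /= mulr0 addr0.
Qed.

(** Cauchy-Schwarz, from the nonnegativity of the square norm of |B| A - |A| B. *)
Lemma rdot_le m p (A B : 'M[R[i]]_(m, p)) : rdot A B <= mxnorm A * mxnorm B.
Proof.
have [A0|A0] := eqVneq (mxnorm A) 0.
  rewrite A0 mul0r (mxnorm0_eq0 A0).
  by rewrite -(scale0r 0) rdotZl mul0r.
have A_gt0 : 0 < mxnorm A by rewrite lt_def A0 mxnorm_ge0.
have [B0|B0] := eqVneq (mxnorm B) 0.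
  rewrite B0 mulr0 (mxnorm0_eq0 B0).
  by rewrite -(scale0r 0) rdotZr mul0r.
have B_gt0 : 0 < mxnorm B by rewrite lt_def B0 mxnorm_ge0.
set a := mxnorm A in A_gt0 *; set b := mxnorm B in B_gt0 *.
have : 0 <= rdot (b%:C *: A - a%:C *: B) (b%:C *: A - a%:C *: B).
  by rewrite rdotxx sqr_ge0.
rewrite !(rdotDl, rdotDr, rdotNl, rdotNr, rdotZl, rdotZr) !rdotxx (rdotC B A) -/a -/b.
set r := rdot A B => h.
have : 0 <= (2 * (a * b)) * (a * b - r) by lra.
by rewrite pmulr_rge0 ?subr_ge0 // !mulr_gt0.
Qed.

Lemma mxnormN m p (A : 'M[R[i]]_(m, p)) : mxnorm (- A) = mxnorm A.
Proof.
apply/eqP; rewrite -(@eqrXn2 _ 2) ?mxnorm_ge0 // -!rdotxx rdotNl rdotNr.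
by rewrite opprK.
Qed.

Lemma ler_mxnormD m p (A B : 'M[R[i]]_(m, p)) : mxnorm (A + B) <= mxnorm A + mxnorm B.
Proof.
rewrite -(@ler_pXn2r _ 2) ?nnegrE ?addr_ge0 ?mxnorm_ge0 //.
rewrite -rdotxx rdotDl !rdotDr (rdotC B A) !rdotxx.
have := rdot_le A B; lra.
Qed.

Lemma ler_mxnormB m p (A B : 'M[R[i]]_(m, p)) : mxnorm (A - B) <= mxnorm A + mxnorm B.
Proof. by rewrite -(mxnormN B) ler_mxnormD. Qed.

Lemma mxnormB m p (A B : 'M[R[i]]_(m, p)) : mxnorm (A - B) = mxnorm (B - A).
Proof. by rewrite -mxnormN opprB. Qed.

Lemma ler_dist_mxnorm m p (A B : 'M[R[i]]_(m, p)) :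
  `|mxnorm A - mxnorm B| <= mxnorm (A - B).
Proof.
have h1 := ler_mxnormD (A - B) B; have h2 := ler_mxnormD (B - A) A.
rewrite !subrK in h1 h2; rewrite (mxnormB B) in h2.
by rewrite ler_norml; apply/andP; split; lra.
Qed.

Lemma mxnormZ m p c (A : 'M[R[i]]_(m, p)) : mxnorm (c *: A) = normc c * mxnorm A.
Proof.
apply/eqP; rewrite -(@eqrXn2 _ 2) ?mulr_ge0 ?normc_ge0 ?mxnorm_ge0 //.
rewrite exprMn -!rdotxx sqr_normc_ReIm mulr_sumr; apply/eqP; apply: eq_bigr => i _.
by rewrite mulr_sumr; apply: eq_bigr => j _; rewrite !mxE complexReM complexImM /=; ring.
Qed.

Lemma mxnormZr m p (r : R) (A : 'M[R[i]]_(m, p)) : mxnorm (r%:C *: A) = `|r| * mxnorm A.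
Proof. by rewrite mxnormZ normc_realC. Qed.

Lemma normc_le_mxnorm m p (A : 'M[R[i]]_(m, p)) i j : normc (A i j) <= mxnorm A.
Proof.
rewrite -(@ler_pXn2r _ 2) ?nnegrE ?normc_ge0 ?mxnorm_ge0 //.
rewrite -rdotxx sqr_normc_ReIm !expr2.
have ge0 (x : R[i]) : 0 <= Re x * Re x + Im x * Im x.
  by rewrite addr_ge0 // -expr2 sqr_ge0.
rewrite /rdot (bigD1 i) //= (bigD1 j) //= -addrA lerDl addr_ge0 //.
  exact: sumr_ge0.
by apply: sumr_ge0 => ? _; exact: sumr_ge0.
Qed.

Lemma mxnorm_le_sum m p (A : 'M[R[i]]_(m, p)) :
  mxnorm A <= \sum_i \sum_j (`|Re (A i j)| + `|Im (A i j)|).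
Proof.
have sum_sqr (I : finType) (f : I -> R) : (forall i, 0 <= f i) ->
    \sum_i f i ^+ 2 <= (\sum_i f i) ^+ 2.
  move=> f0; rewrite expr2 mulr_suml; apply: ler_sum => i _.
  by rewrite expr2 ler_wpM2l // (bigD1 i) //= lerDl sumr_ge0.
rewrite -(@ler_pXn2r _ 2) ?nnegrE ?mxnorm_ge0 //; last first.
  by do 2 (apply: sumr_ge0 => ? _); rewrite addr_ge0.
rewrite -rdotxx; apply: le_trans (sum_sqr _ _ _); last first.
  by move=> i; apply: sumr_ge0 => ? _; rewrite addr_ge0.
apply: ler_sum => i _; apply: le_trans (sum_sqr _ _ _); last first.
  by move=> j; rewrite addr_ge0.
apply: ler_sum => j _; rewrite sqrrD !real_normK ?num_real // -!expr2.
by have := mulr_ge0 (normr_ge0 (Re (A i j))) (normr_ge0 (Im (A i j))); lra.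
Qed.

Lemma mxnormM m n p (A : 'M[R[i]]_(m, n)) (B : 'M[R[i]]_(n, p)) :
  mxnorm (A *m B) <= mxnorm A * mxnorm B.
Proof.
rewrite -(@ler_pXn2r _ 2) ?nnegrE ?mulr_ge0 ?mxnorm_ge0 //.
rewrite exprMn -!rdotxx.
have rdotE q r (X : 'M[R[i]]_(q, r)) : rdot X X = \sum_i \sum_j normc (X i j) ^+ 2.
  by apply: eq_bigr => i _; apply: eq_bigr => j _; rewrite sqr_normc_ReIm !expr2.
rewrite [X in _ <= X * _]rdotE mulr_suml rdotE; apply: ler_sum => i _.
rewrite rdotE exchange_big /= mulr_sumr; apply: ler_sum => j _.
(* Cauchy-Schwarz for the two real vectors of absolute values *)
pose x : 'M[R[i]]_(n, 1) := \matrix_(k, l) (normc (A i k))%:C.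
pose y : 'M[R[i]]_(n, 1) := \matrix_(k, l) (normc (B k j))%:C.
have sx : mxnorm x ^+ 2 = \sum_k normc (A i k) ^+ 2.
  by rewrite -rdotxx; apply: eq_bigr => k _; rewrite big_ord1 !mxE /= mulr0 addr0 expr2.
have sy : mxnorm y ^+ 2 = \sum_k normc (B k j) ^+ 2.
  by rewrite -rdotxx; apply: eq_bigr => k _; rewrite big_ord1 !mxE /= mulr0 addr0 expr2.
rewrite -sx -sy -exprMn ler_pXn2r ?nnegrE ?normc_ge0 ?mulr_ge0 ?mxnorm_ge0 //.
apply: le_trans (rdot_le x y); rewrite mxE.
apply: (@le_trans _ _ (\sum_k normc (A i k * B k j))).
  elim/big_rec2: _ => [|k u v _ h]; first by rewrite ComplexField.Normc.normc0.
  by rewrite (le_trans (le_normcD _ _)) // lerD2l.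
apply: ler_sum => k _.
by rewrite big_ord1 !mxE /= mulr0 addr0 ComplexField.Normc.normcM.
Qed.

End MxNorm.

(** * Convergence of complex matrices *)

Section MxConvergence.
Variable R : realType.
Implicit Types (m n p : nat).
Local Notation Re := complex.Re.
Local Notation Im := complex.Im.
Local Notation normc := ComplexField.Normc.normc.

Section Filters.
Variables (T : Type) (F : set_system T).
Context {FF : Filter F}.

Lemma mxcvg_squeeze m p (f : T -> 'M[R[i]]_(m, p)) l (h : T -> R) :
  (\forall s \near F, mxnorm (f s - l) <= h s) -> h s @[s --> F] --> 0 ->
  mxcvg F f l.
Proof.
move=> fh h0; apply: (squeeze_cvgr (f := cst 0) (h := h)) => //; last exact: cvg_cst.
by apply: filterS fh => s ->; rewrite mxnorm_ge0.
Qed.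

Lemma mxcvg_near m p (f g : T -> 'M[R[i]]_(m, p)) l :
  (\forall s \near F, f s = g s) -> mxcvg F f l -> mxcvg F g l.
Proof.
move=> fg fl; apply: mxcvg_squeeze fl.
by apply: filterS fg => s ->.
Qed.

Lemma mxcvg_cst m p (l : 'M[R[i]]_(m, p)) : mxcvg F (fun=> l) l.
Proof.
apply: (mxcvg_squeeze (h := cst 0)); last exact: cvg_cst.
by apply: nearW => s; rewrite subrr mxnorm0.
Qed.

Lemma mxcvgD m p (f g : T -> 'M[R[i]]_(m, p)) l k :
  mxcvg F f l -> mxcvg F g k -> mxcvg F (fun s => f s + g s) (l + k).
Proof.
move=> fl gk.
apply: (mxcvg_squeeze (h := fun s => mxnorm (f s - l) + mxnorm (g s - k))).
  by apply: nearW => s; rewrite opprD addrACA ler_mxnormD.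
by rewrite -[0]addr0; exact: cvgD.
Qed.

Lemma mxcvg_norm m p (f : T -> 'M[R[i]]_(m, p)) l :
  mxcvg F f l -> mxnorm (f s) @[s --> F] --> mxnorm l.
Proof.
move=> fl; apply/cvgrPdist_le => e e0.
have /cvgrPdist_le /(_ e e0) := fl; apply: filterS => s.
rewrite sub0r normrN ger0_norm ?mxnorm_ge0 // distrC.
exact/le_trans/ler_dist_mxnorm.
Qed.

Lemma mxcvgM m n p (f : T -> 'M[R[i]]_(m, n)) (g : T -> 'M[R[i]]_(n, p)) l k :
  mxcvg F f l -> mxcvg F g k -> mxcvg F (fun s => f s *m g s) (l *m k).
Proof.
move=> fl gk.
apply: (mxcvg_squeeze
  (h := fun s => mxnorm (f s - l) * mxnorm (g s) + mxnorm l * mxnorm (g s - k))).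
  apply: nearW => s.
  have -> : f s *m g s - l *m k = (f s - l) *m g s + l *m (g s - k).
    by rewrite mulmxBl mulmxBr addrA subrK.
  by rewrite (le_trans (ler_mxnormD _ _)) // lerD // mxnormM.
have -> : 0 = 0 * mxnorm k + mxnorm l * 0 :> R by rewrite mul0r mulr0 addr0.
apply: cvgD; apply: cvgM => //; first exact: mxcvg_norm.
exact: cvg_cst.
Qed.

Lemma mxcvgZ m p (r : T -> R) (f : T -> 'M[R[i]]_(m, p)) (a : R) l :
  r s @[s --> F] --> a -> mxcvg F f l ->
  mxcvg F (fun s => (r s)%:C *: f s) (a%:C *: l).
Proof.
move=> ra fl; under eq_fun do rewrite -mul_scalar_mx; rewrite -mul_scalar_mx.
apply: mxcvgM fl.
apply: (mxcvg_squeeze (h := fun s => `|r s - a| * mxnorm (1%:M : 'M[R[i]]_m))).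
  apply: nearW => s; rewrite -raddfB /= -rmorphB -[X in X%:M]mulr1 -scale_scalar_mx.
  by rewrite mxnormZr.
rewrite -(mul0r (mxnorm (1%:M : 'M[R[i]]_m))); apply: cvgM; last exact: cvg_cst.
by rewrite -(normr0 R) -(subrr a); apply: cvg_norm; apply: cvgB => //; exact: cvg_cst.
Qed.

Lemma mxcvgZc m p c (f : T -> 'M[R[i]]_(m, p)) l :
  mxcvg F f l -> mxcvg F (fun s => c *: f s) (c *: l).
Proof.
move=> fl; under eq_fun do rewrite -mul_scalar_mx; rewrite -mul_scalar_mx.
by apply: mxcvgM fl; exact: mxcvg_cst.
Qed.

Lemma mxcvgN m p (f : T -> 'M[R[i]]_(m, p)) l :
  mxcvg F f l -> mxcvg F (fun s => - f s) (- l).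
Proof.
move=> fl; rewrite -(scaleN1r l).
by rewrite (_ : (fun s => - f s) = fun s => -1 *: f s) ?funeqE;
  [exact: mxcvgZc|move=> s; rewrite scaleN1r].
Qed.

Lemma mxcvgB m p (f g : T -> 'M[R[i]]_(m, p)) l k :
  mxcvg F f l -> mxcvg F g k -> mxcvg F (fun s => f s - g s) (l - k).
Proof. by move=> fl gk; apply: mxcvgD => //; exact: mxcvgN. Qed.

Lemma mxcvg_sum m p I (r : seq I) (P : pred I) (f : I -> T -> 'M[R[i]]_(m, p)) l :
  (forall i, P i -> mxcvg F (f i) (l i)) ->
  mxcvg F (fun s => \sum_(i <- r | P i) f i s) (\sum_(i <- r | P i) l i).
Proof.
move=> fl; elim: r => [|a r ih].
  by rewrite big_nil; under eq_fun do rewrite big_nil; exact: mxcvg_cst.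
rewrite big_cons; under eq_fun do rewrite big_cons.
by case: ifPn => // Pa; apply: mxcvgD => //; exact: fl.
Qed.

Lemma mxcvg_Re m p (f : T -> 'M[R[i]]_(m, p)) l i j :
  mxcvg F f l -> Re (f s i j) @[s --> F] --> Re (l i j).
Proof.
move=> fl; apply/cvgrPdist_le => e e0.
have /cvgrPdist_le /(_ e e0) := fl; apply: filterS => s.
rewrite sub0r normrN ger0_norm ?mxnorm_ge0 // distrC; apply: le_trans.
apply: le_trans (normc_le_mxnorm _ i j); rewrite !mxE.
by rewrite (le_trans _ (Re_le_normc _)) // complexReD complexReN.
Qed.

Lemma mxcvg_Im m p (f : T -> 'M[R[i]]_(m, p)) l i j :
  mxcvg F f l -> Im (f s i j) @[s --> F] --> Im (l i j).
Proof.
move=> fl; apply/cvgrPdist_le => e e0.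
have /cvgrPdist_le /(_ e e0) := fl; apply: filterS => s.
rewrite sub0r normrN ger0_norm ?mxnorm_ge0 // distrC; apply: le_trans.
apply: le_trans (normc_le_mxnorm _ i j); rewrite !mxE.
by rewrite (le_trans _ (Im_le_normc _)) // complexImD complexImN.
Qed.

Lemma cvgr_sum I (r : seq I) (f : I -> T -> R) (l : I -> R) :
  (forall i, f i s @[s --> F] --> l i) ->
  \sum_(i <- r) f i s @[s --> F] --> \sum_(i <- r) l i.
Proof.
move=> fl; elim: r => [|a r ih].
  by rewrite big_nil; under eq_fun do rewrite big_nil; exact: cvg_cst.
by rewrite big_cons; under eq_fun do rewrite big_cons; exact: cvgD.
Qed.

(** Gives access to real analysis, through the real and imaginary parts of the entries. *)
Lemma mxcvg_entries m p (f : T -> 'M[R[i]]_(m, p)) (l : 'M[R[i]]_(m, p)) :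
  (forall i j, Re (f s i j) @[s --> F] --> Re (l i j)) ->
  (forall i j, Im (f s i j) @[s --> F] --> Im (l i j)) -> mxcvg F f l.
Proof.
move=> fr fi.
apply: (mxcvg_squeeze (h := fun s =>
  \sum_i \sum_j (`|Re (f s i j) - Re (l i j)| + `|Im (f s i j) - Im (l i j)|))).
  apply: nearW => s; apply: le_trans (mxnorm_le_sum _) _.
  apply: ler_sum => i _; apply: ler_sum => j _.
  by rewrite !mxE complexReD complexImD complexReN complexImN.
rewrite [X in _ --> X](_ : 0 = \sum_(i < m) \sum_(j < p) 0); last first.
  by rewrite big1 // => i _; rewrite big1.
apply: (cvgr_sum (f := fun i s => \sum_j (`|Re (f s i j) - Re (l i j)| +
  `|Im (f s i j) - Im (l i j)|)) (l := fun=> \sum_(j < p) 0)) => i.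
apply: (cvgr_sum (f := fun j s => `|Re (f s i j) - Re (l i j)| +
  `|Im (f s i j) - Im (l i j)|) (l := fun=> 0)) => j.
rewrite -[X in _ --> X]addr0.
apply: cvgD; rewrite -(normr0 R).
  by rewrite -(subrr (Re (l i j))); apply: cvg_norm; apply: cvgB => //; exact: cvg_cst.
by rewrite -(subrr (Im (l i j))); apply: cvg_norm; apply: cvgB => //; exact: cvg_cst.
Qed.

End Filters.

Lemma mxcvg_unique (T : Type) (F : set_system T) {FF : ProperFilter F} m p
    (f : T -> 'M[R[i]]_(m, p)) l k : mxcvg F f l -> mxcvg F f k -> l = k.
Proof.
move=> fl fk; apply/eqP; rewrite -subr_eq0; apply/eqP/mxnorm0_eq0.
have h : mxcvg F (fun s => f s - f s) (l - k) by exact: mxcvgB.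
have {h} : mxnorm (f s - f s) @[s --> F] --> mxnorm (l - k) by exact: mxcvg_norm.
under eq_fun do rewrite subrr mxnorm0.
move=> h; have h0 : (0 : R) @[_ --> F] --> (0 : R) by exact: cvg_cst.
exact: (cvg_unique _ h h0).
Qed.

Lemma mxcvg_sub (T : Type) (F G : set_system T) m p
    (f : T -> 'M[R[i]]_(m, p)) l : F `=>` G -> mxcvg G f l -> mxcvg F f l.
Proof. by move=> FG; apply: cvg_trans; exact: cvg_app. Qed.

End MxConvergence.

(** * Derivatives of complex matrix functions *)

Section MxDerivative.
Variable R : realType.
Implicit Types (m n p : nat) (D : set R) (t : R).
Local Notation Re := complex.Re.
Local Notation Im := complex.Im.
Local Notation normc := ComplexField.Normc.normc.

Lemma within_dnbhs_sub D t : within D t^' `=>` within D (nbhs t).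
Proof. by move=> P /nbhs_dnbhs. Qed.

Lemma has_deriv_on_cvg D m p (f : R -> 'M[R[i]]_(m, p)) t l :
  has_deriv_on D f t l -> mxcvg (within D (nbhs t)) f (f t).
Proof.
move=> fl.
have h : mxcvg (within D t^') f (f t).
  have h0 : mxcvg (within D t^') (fun s => (s - t)%:C *: (((s - t)^-1)%:C *: (f s - f t)) + f t)
    (0%:C *: l + f t).
    apply: mxcvgD; last exact: mxcvg_cst.
    apply: mxcvgZ => //; rewrite -(subrr t); apply: cvgB; last exact: cvg_cst.
    by move=> P /= tP; apply: cvg_within; exact: nbhs_dnbhs.
  rewrite scale0r add0r in h0; apply: mxcvg_near h0.
  near=> s.
  have st : s != t by near: s; apply: cvg_within; exact: withinT.
  by rewrite scalerA -rmorphM /= divff ?subr_eq0 // rmorph1 scale1r subrK.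
apply/cvgrPdist_le => e e0; have /cvgrPdist_le /(_ e e0) hd := h.
have {}hd : nbhs t (fun s => s != t -> D s -> `|0 - mxnorm (f s - f t)| <= e) by [].
apply: filterS hd => s hs Ds.
have [->|st] := eqVneq s t; first by rewrite subrr mxnorm0 subr0 normr0 ltW.
exact: hs.
Unshelve. all: by end_near. Qed.

Lemma has_deriv_on_near D m p (f g : R -> 'M[R[i]]_(m, p)) t l :
  (\forall s \near within D (nbhs t), f s = g s) -> f t = g t ->
  has_deriv_on D f t l -> has_deriv_on D g t l.
Proof.
move=> fg fgt; apply: mxcvg_near.
have : \forall s \near within D t^', f s = g s by exact: within_dnbhs_sub.
by apply: filterS => s ->; rewrite fgt.
Qed.

Lemma has_deriv_on_sub D E m p (f : R -> 'M[R[i]]_(m, p)) t l :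
  (\forall s \near t, E s -> D s) ->
  has_deriv_on D f t l -> has_deriv_on E f t l.
Proof.
move=> ED; apply: mxcvg_sub => P; rewrite /within /= => DP.
have ED' : \forall s \near t^', E s -> D s by exact: nbhs_dnbhs.
by near=> s => Es; apply: (near DP s) => //; apply: (near ED' s).
Unshelve. all: by end_near. Qed.

Section Rules.
Variables (D : set R) (t : R).

Lemma has_deriv_on_cst m p (A : 'M[R[i]]_(m, p)) : has_deriv_on D (fun=> A) t 0.
Proof.
have h0 : mxcvg (within D t^') (fun=> 0 : 'M[R[i]]_(m, p)) 0 by exact: mxcvg_cst.
by apply: mxcvg_near h0; apply: nearW => s; rewrite subrr scaler0.
Qed.

Lemma has_deriv_onD m p (f g : R -> 'M[R[i]]_(m, p)) l k :
  has_deriv_on D f t l -> has_deriv_on D g t k ->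
  has_deriv_on D (fun s => f s + g s) t (l + k).
Proof.
move=> fl gk.
apply: mxcvg_near (mxcvgD fl gk); apply: nearW => s.
by rewrite -scalerDr opprD addrACA.
Qed.

Lemma has_deriv_onZ m p c (f : R -> 'M[R[i]]_(m, p)) l :
  has_deriv_on D f t l -> has_deriv_on D (fun s => c *: f s) t (c *: l).
Proof.
move=> fl; apply: mxcvg_near (mxcvgZc c fl); apply: nearW => s.
by rewrite -scalerBr !scalerA mulrC.
Qed.

Lemma has_deriv_onN m p (f : R -> 'M[R[i]]_(m, p)) l :
  has_deriv_on D f t l -> has_deriv_on D (fun s => - f s) t (- l).
Proof.
move=> fl; rewrite -(scaleN1r l).
by rewrite (_ : (fun s => - f s) = fun s => -1 *: f s) ?funeqE;
  [exact: has_deriv_onZ|move=> s; rewrite scaleN1r].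
Qed.

Lemma has_deriv_onB m p (f g : R -> 'M[R[i]]_(m, p)) l k :
  has_deriv_on D f t l -> has_deriv_on D g t k ->
  has_deriv_on D (fun s => f s - g s) t (l - k).
Proof. by move=> fl gk; apply: has_deriv_onD => //; exact: has_deriv_onN. Qed.

Lemma has_deriv_on_sum m p I (r : seq I) (P : pred I)
    (f : I -> R -> 'M[R[i]]_(m, p)) l :
  (forall i, P i -> has_deriv_on D (f i) t (l i)) ->
  has_deriv_on D (fun s => \sum_(i <- r | P i) f i s) t (\sum_(i <- r | P i) l i).
Proof.
move=> fl; elim: r => [|a r ih].
  by rewrite big_nil; under eq_fun do rewrite big_nil; exact: has_deriv_on_cst.
rewrite big_cons; under eq_fun do rewrite big_cons.
by case: ifPn => // Pa; apply: has_deriv_onD => //; exact: fl.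
Qed.

Lemma has_deriv_onM m n p (f : R -> 'M[R[i]]_(m, n)) (g : R -> 'M[R[i]]_(n, p)) l k :
  has_deriv_on D f t l -> has_deriv_on D g t k ->
  has_deriv_on D (fun s => f s *m g s) t (l *m g t + f t *m k).
Proof.
move=> fl gk.
have gt : mxcvg (within D t^') g (g t).
  exact: mxcvg_sub (@within_dnbhs_sub D t) (has_deriv_on_cvg gk).
apply: mxcvg_near (mxcvgD (mxcvgM fl gt) (mxcvgM (mxcvg_cst (f t)) gk)).
apply: nearW => s.
by rewrite -scalemxAl -scalemxAr -scalerDr mulmxBl mulmxBr addrA subrK.
Qed.

(** The difference quotient in s = t + h, as for matrix functions, instead of in h. *)
Lemma is_derive_cvg (f : R -> R) (l : R) :
  is_derive t 1 f l <-> (s - t)^-1 * (f s - f t) @[s --> t^'] --> l.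
Proof.
pose q (h : R) := h^-1 *: (f (h *: 1 + t) - f t).
have qE : (q h @[h --> 0^'] --> l) <-> ((s - t)^-1 * (f s - f t) @[s --> t^'] --> l).
  split=> /cvgrPdist_le ql; apply/cvgrPdist_le => e /ql {}ql.
    have {}ql : \forall h \near (0 : R), h != 0 -> `|l - q h| <= e by [].
    suff h : \forall s \near t, s != t -> `|l - (s - t)^-1 * (f s - f t)| <= e by [].
    rewrite (near_shift 0 t) subr0.
    apply: filterS ql => h /= hq; rewrite addrK => ht.
    have -> : f (h + t) = f (h *: 1 + t) by rewrite /GRing.scale /= mulr1.
    by apply: hq; apply: contra_neq ht => ->; rewrite add0r.
  have {}ql : \forall s \near t, s != t -> `|l - (s - t)^-1 * (f s - f t)| <= e by [].
  suff h : \forall h \near (0 : R), h != 0 -> `|l - q h| <= e by [].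
  move: ql; rewrite (near_shift 0 t) subr0.
  apply: filterS => h /= hq h0.
  have := hq; rewrite addrK /q {2}/GRing.scale /= mulr1; apply.
  by rewrite -subr_eq0 addrK.
split=> [dfl|fl].
  apply/qE; have <- := @derive_val _ _ _ _ _ _ _ dfl.
  exact: (@ex_derive _ _ _ _ _ _ _ dfl).
have ql : q h @[h --> 0^'] --> l by apply/qE.
by split; [apply/cvg_ex; exists l|apply/cvg_lim].
Qed.

Lemma has_deriv_on_Re m p (f : R -> 'M[R[i]]_(m, p)) l i j : nbhs t D ->
  has_deriv_on D f t l -> is_derive t 1 (fun s => Re (f s i j)) (Re (l i j)).
Proof.
move=> tD /(has_deriv_on_sub (E := setT)) fl.
have {}fl : has_deriv_on setT f t l by apply: fl; apply: filterS tD.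
apply/is_derive_cvg.
have {}fl : mxcvg t^' (fun s => ((s - t)^-1)%:C *: (f s - f t)) l.
  apply: mxcvg_sub fl => P tP.
  by apply: (@filterS _ t^' _ (fun s => setT s -> P s)) tP => s; exact.
have : Re ((((s - t)^-1)%:C *: (f s - f t)) i j) @[s --> t^'] --> Re (l i j).
  exact: mxcvg_Re.
apply: cvg_trans; apply: near_eq_cvg.
by apply: nearW => s; rewrite !mxE complexReM /= mul0r subr0 complexReD complexReN.
Qed.

Lemma has_deriv_on_Im m p (f : R -> 'M[R[i]]_(m, p)) l i j : nbhs t D ->
  has_deriv_on D f t l -> is_derive t 1 (fun s => Im (f s i j)) (Im (l i j)).
Proof.
move=> tD /(has_deriv_on_sub (E := setT)) fl.
have {}fl : has_deriv_on setT f t l by apply: fl; apply: filterS tD.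
apply/is_derive_cvg.
have {}fl : mxcvg t^' (fun s => ((s - t)^-1)%:C *: (f s - f t)) l.
  apply: mxcvg_sub fl => P tP.
  by apply: (@filterS _ t^' _ (fun s => setT s -> P s)) tP => s; exact.
have : Im ((((s - t)^-1)%:C *: (f s - f t)) i j) @[s --> t^'] --> Im (l i j).
  exact: mxcvg_Im.
apply: cvg_trans; apply: near_eq_cvg.
by apply: nearW => s; rewrite !mxE complexImM /= mul0r addr0 complexImD complexImN.
Qed.

Lemma has_deriv_on_entries m p (f : R -> 'M[R[i]]_(m, p)) (l : 'M[R[i]]_(m, p)) :
  (forall i j, is_derive t 1 (fun s => Re (f s i j)) (Re (l i j))) ->
  (forall i j, is_derive t 1 (fun s => Im (f s i j)) (Im (l i j))) ->
  has_deriv_on D f t l.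
Proof.
move=> fr fi; apply: mxcvg_entries => i j.
  apply: cvg_within_filter; have /is_derive_cvg := fr i j.
  apply: cvg_trans; apply: near_eq_cvg.
  by apply: nearW => s; rewrite !mxE complexReM /= mul0r subr0 complexReD complexReN.
apply: cvg_within_filter; have /is_derive_cvg := fi i j.
apply: cvg_trans; apply: near_eq_cvg.
by apply: nearW => s; rewrite !mxE complexImM /= mul0r addr0 complexImD complexImN.
Qed.

Lemma has_deriv_on_unique m p (f : R -> 'M[R[i]]_(m, p)) l k :
  ProperFilter (within D t^') ->
  has_deriv_on D f t l -> has_deriv_on D f t k -> l = k.
Proof. by move=> PF; exact: mxcvg_unique. Qed.

End Rules.

End MxDerivative.

(** * Gronwall inequalities *)

Section Gronwall.
Variable R : realType.
Implicit Types (a b c t : R) (D E : set R).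

Section RealRules.
Variables (t l k : R) (f g : R -> R).
Hypotheses (fl : is_derive t 1 f l) (gk : is_derive t 1 g k).

Lemma is_derive_add : is_derive t 1 (fun s => f s + g s) (l + k).
Proof. exact: is_deriveD. Qed.

Lemma is_derive_sub : is_derive t 1 (fun s => f s - g s) (l - k).
Proof. exact: is_deriveB. Qed.

Lemma is_derive_opp : is_derive t 1 (fun s => - f s) (- l).
Proof. exact: is_deriveN. Qed.

Lemma is_derive_mul : is_derive t 1 (fun s => f s * g s) (f t * k + l * g t).
Proof. have h := is_deriveM fl gk; apply: (is_derive_eq h).
by rewrite /GRing.scale /= [g t * _]mulrC. Qed.

Lemma is_derive_scale c : is_derive t 1 (fun s => c * f s) (c * l).
Proof. exact: is_deriveZ. Qed.

Lemma is_derive_comp (h : R -> R) (d : R) : is_derive (f t) 1 h d -> is_derive t 1 (fun s => h (f s)) (d * l).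
Proof. by move=> hd; exact: (@is_derive1_comp R h f t d l). Qed.

End RealRules.

Lemma is_derive_const c t : is_derive t 1 (fun=> c) 0.
Proof. exact: (@is_derive_cst R R R c t 1). Qed.

Definition continuous_real D (f : R -> R) : Prop :=
  forall t, D t -> f s @[s --> within D (nbhs t)] --> f t.

Lemma continuous_real_within D f : continuous_real D f <-> {within D, continuous f}.
Proof. by split => [h|/subspace_continuousP]; first exact/subspace_continuousP. Qed.

Lemma continuous_real_sub D E f : E `<=` D -> continuous_real D f -> continuous_real E f.
Proof.
move=> ED fD t Et; apply: cvg_trans (fD t (ED _ Et)); apply: cvg_app.
exact: within_subset.
Qed.

Lemma continuous_realD D f g :
  continuous_real D f -> continuous_real D g -> continuous_real D (fun s => f s + g s).
Proof. by move=> cf cg t Dt; apply: cvgD; [exact: cf|exact: cg]. Qed.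

Lemma continuous_realN D f : continuous_real D f -> continuous_real D (fun s => - f s).
Proof. by move=> cf t Dt; apply: cvgN; exact: cf. Qed.

Lemma continuous_realM D f g :
  continuous_real D f -> continuous_real D g -> continuous_real D (fun s => f s * g s).
Proof. by move=> cf cg t Dt; apply: cvgM; [exact: cf|exact: cg]. Qed.

Lemma continuous_real_cst D c : continuous_real D (fun=> c).
Proof. by move=> t Dt; exact: cvg_cst. Qed.

Lemma continuous_real_comp D f g : continuous_real D f -> continuous g ->
  continuous_real D (fun s => g (f s)).
Proof. by move=> cf cg t Dt; apply: continuous_cvg; [exact: cg|exact: cf]. Qed.

Lemma nondecreasing_of_deriv (f df : R -> R) a b : a <= b ->
  continuous_real `[a, b] f ->
  (forall t, a < t < b -> is_derive t 1 f (df t)) ->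
  (forall t, a < t < b -> 0 <= df t) -> f a <= f b.
Proof.
rewrite le_eqVlt => /predU1P[->//|ab] /continuous_real_within cf fd df0.
rewrite -subr_ge0; have fd' t : t \in `]a, b[ -> is_derive t 1 f (df t) by rewrite in_itv /=; exact: fd.
have [t tab ->] := MVT ab fd' cf.
by rewrite mulr_ge0 ?subr_ge0 ?(ltW ab) // df0 //; rewrite in_itv /= in tab.
Qed.

(** Multiplying by the integrating factor exp (-(K - K a)) <= 1 turns the
    differential inequality into monotonicity. *)
Lemma gronwall_forward (phi dphi K kappa G g : R -> R) a b c : a <= b ->
  continuous_real `[a, b] phi -> continuous_real `[a, b] K -> continuous_real `[a, b] G ->
  (forall t, a < t < b -> is_derive t 1 phi (dphi t)) ->
  (forall t, a < t < b -> is_derive t 1 K (kappa t)) ->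
  (forall t, a < t < b -> is_derive t 1 G (g t)) ->
  (forall t, a < t < b -> 0 <= kappa t) ->
  (forall t, a < t < b -> 0 <= g t) ->
  (forall t, a < t < b -> dphi t <= kappa t * phi t + g t) ->
  0 <= phi b -> K b - K a <= c ->
  phi b <= expR c * (phi a + (G b - G a)).
Proof.
move=> ab cphi cK cG dp dK dG k0 g0 ineq p0 Kc.
have Kmono t : a <= t <= b -> K a <= K t.
  move=> /andP[at_ tb]; apply: (@nondecreasing_of_deriv _ kappa) => //.
  - by apply: continuous_real_sub cK => s /=; rewrite !in_itv /= => /andP[-> /le_trans ->].
  - by move=> s /andP[as_ st]; apply: dK; rewrite as_ (lt_le_trans st).
  - by move=> s /andP[as_ st]; apply: k0; rewrite as_ (lt_le_trans st).
pose psi t := (G t - G a) - expR (- (K t - K a)) * phi t.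
have : psi a <= psi b.
  apply: (@nondecreasing_of_deriv _ (fun t =>
    g t - 0 - (expR (- (K t - K a)) * dphi t + expR (- (K t - K a)) * (- (kappa t - 0)) * phi t))) => //.
  - apply: continuous_realD; first by apply: continuous_realD => //; exact: continuous_real_cst.
    apply: continuous_realN; apply: continuous_realM => //.
    apply: (@continuous_real_comp _ _ expR); last exact: continuous_expR.
    by apply: continuous_realN; apply: continuous_realD => //; exact: continuous_real_cst.
  - move=> t tab; apply: is_derive_sub.
      by apply: is_derive_sub; exact: dG.
    apply: is_derive_mul; last exact: dp.
    apply: (is_derive_comp _ (h := expR)).
    by apply: is_derive_opp; apply: is_derive_sub; exact: dK.
  - move=> t tab; rewrite !subr0.
    have e1 : expR (- (K t - K a)) <= 1.
      rewrite -[leRHS]expR0 ler_expR oppr_le0 subr_ge0.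
      by apply: Kmono; case/andP: tab => /ltW -> /ltW ->.
    have e0 := expR_ge0 (- (K t - K a)).
    have h1 := ler_wpM2l e0 (ineq _ tab).
    have h2 := ler_wpM2r (g0 _ tab) e1.
    lra.
rewrite /psi !subrr oppr0 expR0 mul1r sub0r => h.
have {h} h : expR (- (K b - K a)) * phi b <= phi a + (G b - G a) by lra.
rewrite -[leLHS]mul1r -(expRxMexpNx_1 c) -mulrA ler_wpM2l ?expR_ge0 //.
apply: le_trans h; rewrite ler_wpM2r // ler_expR lerN2 //.
Qed.

(** The same integrating factor, normalized at b instead of a. *)
Lemma gronwall_backward (phi dphi K kappa G g : R -> R) a b c : a <= b ->
  continuous_real `[a, b] phi -> continuous_real `[a, b] K -> continuous_real `[a, b] G ->
  (forall t, a < t < b -> is_derive t 1 phi (dphi t)) ->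
  (forall t, a < t < b -> is_derive t 1 K (kappa t)) ->
  (forall t, a < t < b -> is_derive t 1 G (g t)) ->
  (forall t, a < t < b -> 0 <= kappa t) ->
  (forall t, a < t < b -> 0 <= g t) ->
  (forall t, a < t < b -> - dphi t <= kappa t * phi t + g t) ->
  0 <= phi a -> K b - K a <= c ->
  phi a <= expR c * (phi b + (G b - G a)).
Proof.
move=> ab cphi cK cG dp dK dG k0 g0 ineq p0 Kc.
have Kmono t : a <= t <= b -> K t <= K b.
  move=> /andP[at_ tb]; apply: (@nondecreasing_of_deriv _ kappa) => //.
  - by apply: continuous_real_sub cK => s /=; rewrite !in_itv /= => /andP[/(le_trans at_) -> ->].
  - by move=> s /andP[as_ st]; apply: dK; rewrite st (le_lt_trans at_).
  - by move=> s /andP[as_ st]; apply: k0; rewrite st (le_lt_trans at_).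
pose psi t := (G t - G b) + expR (K t - K b) * phi t.
have : psi a <= psi b.
  apply: (@nondecreasing_of_deriv _ (fun t =>
    g t - 0 + (expR (K t - K b) * dphi t + expR (K t - K b) * (kappa t - 0) * phi t))) => //.
  - apply: continuous_realD; first by apply: continuous_realD => //; exact: continuous_real_cst.
    apply: continuous_realM => //.
    apply: (@continuous_real_comp _ _ expR); last exact: continuous_expR.
    by apply: continuous_realD => //; exact: continuous_real_cst.
  - move=> t tab; apply: is_derive_add.
      by apply: is_derive_sub; exact: dG.
    apply: is_derive_mul; last exact: dp.
    by apply: (is_derive_comp _ (h := expR)); apply: is_derive_sub; exact: dK.
  - move=> t tab; rewrite !subr0.
    have e1 : expR (K t - K b) <= 1.
      rewrite -[leRHS]expR0 ler_expR subr_le0.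
      by apply: Kmono; case/andP: tab => /ltW -> /ltW ->.
    have e0 := expR_ge0 (K t - K b).
    have h1 := ler_wpM2l e0 (ineq _ tab).
    have h2 := ler_wpM2r (g0 _ tab) e1.
    lra.
rewrite /psi !subrr expR0 mul1r add0r => h.
have {h} h : expR (K a - K b) * phi a <= phi b + (G b - G a) by lra.
rewrite -[leLHS]mul1r -(expRxMexpNx_1 c) -mulrA ler_wpM2l ?expR_ge0 //.
apply: le_trans h; rewrite ler_wpM2r // ler_expR; lra.
Qed.

End Gronwall.

(** * Energy estimates *)

Section Energy.
Variable R : realType.
Implicit Types (a b c t : R) (D E : set R) (m p : nat).
Local Notation mu := (@lebesgue_measure R).

Lemma mxcvg_rdot (T : Type) (F : set_system T) {FF : Filter F} m p
    (f g : T -> 'M[R[i]]_(m, p)) l k :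
  mxcvg F f l -> mxcvg F g k -> rdot (f s) (g s) @[s --> F] --> rdot l k.
Proof.
move=> fl gk.
have abs (A B : 'M[R[i]]_(m, p)) : `|rdot A B| <= mxnorm A * mxnorm B.
  by rewrite ler_norml rdot_le andbT lerNl -rdotNl -(mxnormN A) rdot_le.
pose h s := mxnorm (f s - l) * mxnorm (g s) + mxnorm l * mxnorm (g s - k).
have h0 : h s @[s --> F] --> 0 * mxnorm k + mxnorm l * 0.
  by apply: cvgD; apply: cvgM => //; [exact: mxcvg_norm|exact: cvg_cst].
rewrite mul0r mulr0 addr0 in h0.
apply/cvgrPdist_le => e e0; have /cvgrPdist_le /(_ e e0) := h0.
apply: filterS => s; rewrite sub0r normrN => /(le_trans (ler_norm _)); apply: le_trans.
rewrite distrC.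
have -> : rdot (f s) (g s) - rdot l k = rdot (f s - l) (g s) + rdot l (g s - k).
  by rewrite rdotDl rdotDr rdotNl rdotNr; ring.
by rewrite (le_trans (ler_normD _ _)) // lerD.
Qed.

Lemma is_derive_sqr_mxnorm m p (Y : R -> 'M[R[i]]_(m, p)) t l :
  has_deriv_on setT Y t l -> is_derive t 1 (fun s => mxnorm (Y s) ^+ 2) (2 * rdot l (Y t)).
Proof.
move=> dY; apply/is_derive_cvg.
have cvgT (f : R -> 'M[R[i]]_(m, p)) k : mxcvg (within setT t^') f k -> mxcvg t^' f k.
  apply: mxcvg_sub => P tP.
  by apply: (@filterS _ t^' _ (fun s => setT s -> P s)) tP => s; exact.
have cY : mxcvg t^' Y (Y t).
  by apply: cvgT; exact: mxcvg_sub (@within_dnbhs_sub _ setT t) (has_deriv_on_cvg dY).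
have sY : mxcvg t^' (fun s => Y s + Y t) (Y t + Y t).
  by apply: mxcvgD => //; exact: mxcvg_cst.
have : rdot (((s - t)^-1)%:C *: (Y s - Y t)) (Y s + Y t) @[s --> t^'] --> rdot l (Y t + Y t).
  by apply: mxcvg_rdot => //; exact: cvgT.
rewrite rdotDr -mulr2n -[rdot l (Y t) *+ 2]mulr_natl.
move=> h; apply: cvg_trans h; apply: near_eq_cvg; apply: nearW => s.
rewrite rdotZl -!rdotxx; congr (_ * _).
by rewrite rdotDl rdotNl !rdotDr (rdotC (Y t) (Y s)); ring.
Qed.

Lemma continuous_fiber_sub D E m p (Y : R -> 'M[R[i]]_(m, p)) : E `<=` D ->
  continuous_fiber D Y -> continuous_fiber E Y.
Proof.
move=> ED cY t Et; apply: mxcvg_sub (cY t (ED _ Et)).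
exact: within_subset.
Qed.

Lemma continuous_fiber_mxnorm D m p (Y : R -> 'M[R[i]]_(m, p)) :
  continuous_fiber D Y -> continuous_real D (fun s => mxnorm (Y s)).
Proof. by move=> cY t Dt; apply: mxcvg_norm; exact: cY. Qed.

(** The smooth function sqrt (|Y|^2 + e) stands in for |Y|, which fails to be
    differentiable where Y vanishes. *)
Section RegularizedNorm.
Variables (m p : nat) (Y dY : R -> 'M[R[i]]_(m, p)) (a b e : R).
Hypotheses (e0 : 0 < e) (cY : continuous_fiber `[a, b] Y).
Hypothesis dYt : forall t, a < t < b -> has_deriv_on setT Y t (dY t).

Definition regnorm t := Num.sqrt (mxnorm (Y t) ^+ 2 + e ^+ 2).

Lemma regnorm_gt0 t : 0 < regnorm t.
Proof. by rewrite sqrtr_gt0 ltr_wpDl ?sqr_ge0 // exprn_gt0. Qed.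

Lemma regnorm_ge t : mxnorm (Y t) <= regnorm t.
Proof.
rewrite -[leLHS]ger0_norm ?mxnorm_ge0 // -sqrtr_sqr ler_wsqrtr //.
by rewrite lerDl sqr_ge0.
Qed.

Lemma regnorm_le t : regnorm t <= mxnorm (Y t) + e.
Proof.
have n0 := mxnorm_ge0 (Y t).
rewrite -[leRHS]ger0_norm ?addr_ge0 ?(ltW e0) // -sqrtr_sqr ler_wsqrtr // sqrrD.
by have := mulr_ge0 n0 (ltW e0); lra.
Qed.

Lemma continuous_regnorm : continuous_real `[a, b] regnorm.
Proof.
apply: (@continuous_real_comp _ _ _ (@Num.sqrt R)); last exact: sqrt_continuous.
apply: continuous_realD; last exact: continuous_real_cst.
apply: (@continuous_real_comp _ _ (fun s => mxnorm (Y s)) (fun x => x ^+ 2)).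
  exact: continuous_fiber_mxnorm.
exact: exprn_continuous.
Qed.

Lemma is_derive_regnorm t : a < t < b ->
  is_derive t 1 regnorm (rdot (dY t) (Y t) / regnorm t).
Proof.
move=> tab; have h : is_derive t 1 (fun s => mxnorm (Y s) ^+ 2 + e ^+ 2) (2 * rdot (dY t) (Y t) + 0).
  by apply: is_derive_add; exact: is_derive_sqr_mxnorm (dYt tab).
have pos : 0 < mxnorm (Y t) ^+ 2 + e ^+ 2 by rewrite ltr_wpDl ?sqr_ge0 // exprn_gt0.
have := is_derive_comp h (is_derive1_sqrt pos).
move=> /is_derive_eq; apply; rewrite addr0 -/(regnorm t).
by have := lt0r_neq0 (regnorm_gt0 t) => r0; field.
Qed.

Lemma regnorm_ineq t (x k g : R) : 0 <= k -> 0 <= g ->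
  x <= k * mxnorm (Y t) ^+ 2 + g * mxnorm (Y t) ->
  x / regnorm t <= k * regnorm t + g.
Proof.
move=> k0 g0 h; rewrite ler_pdivrMr ?regnorm_gt0 // (le_trans h) //.
rewrite mulrDl -mulrA -expr2 lerD // ?ler_wpM2l ?regnorm_ge //.
by rewrite ler_pXn2r ?nnegrE ?mxnorm_ge0 ?(ltW (regnorm_gt0 _)) ?regnorm_ge.
Qed.

End RegularizedNorm.

Section EnergyGronwall.
Variables (m p : nat) (Y dY : R -> 'M[R[i]]_(m, p)) (K kappa G g : R -> R) (a b c : R).
Hypotheses (ab : a <= b) (cY : continuous_fiber `[a, b] Y).
Hypotheses (cK : continuous_real `[a, b] K) (cG : continuous_real `[a, b] G).
Hypothesis dYt : forall t, a < t < b -> has_deriv_on setT Y t (dY t).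
Hypothesis dK : forall t, a < t < b -> is_derive t 1 K (kappa t).
Hypothesis dG : forall t, a < t < b -> is_derive t 1 G (g t).
Hypothesis k0 : forall t, a < t < b -> 0 <= kappa t.
Hypothesis g0 : forall t, a < t < b -> 0 <= g t.
Hypothesis Kc : K b - K a <= c.

Let letting_e (x y : R) : (forall e, 0 < e -> x <= expR c * (y + e)) -> x <= expR c * y.
Proof.
move=> h; apply/ler_addgt0Pr => e e0.
have := h (e / expR c) (divr_gt0 e0 (expR_gt0 _)).
by rewrite mulrDr mulrCA mulfV ?mulr1 // gt_eqF ?expR_gt0.
Qed.

(** Only an upper bound of the quadratic form rdot Y' Y enters, so that skew-adjoint
    parts of the coefficient, however large, cost nothing. *)
Lemma energy_forward :
  (forall t, a < t < b -> rdot (dY t) (Y t) <= kappa t * mxnorm (Y t) ^+ 2 + g t * mxnorm (Y t)) ->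
  mxnorm (Y b) <= expR c * (mxnorm (Y a) + (G b - G a)).
Proof.
move=> ineq; apply: letting_e => e e0; apply: le_trans (regnorm_ge Y e b) _.
have -> : mxnorm (Y a) + (G b - G a) + e = mxnorm (Y a) + e + (G b - G a) by ring.
apply: (@le_trans _ _ (expR c * (regnorm Y e a + (G b - G a)))); last first.
  by rewrite ler_wpM2l ?expR_ge0 // lerD2r regnorm_le.
apply: (@gronwall_forward _ _ (fun t => rdot (dY t) (Y t) / regnorm Y e t) K kappa G g) => //.
- exact: continuous_regnorm.
- by move=> t tab; apply: (is_derive_regnorm e0 dYt).
- by move=> t tab; apply: regnorm_ineq; auto.
- exact/ltW/regnorm_gt0.
Qed.

(** Here only a lower bound of the quadratic form enters. *)
Lemma energy_backward :
  (forall t, a < t < b -> - rdot (dY t) (Y t) <= kappa t * mxnorm (Y t) ^+ 2 + g t * mxnorm (Y t)) ->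
  mxnorm (Y a) <= expR c * (mxnorm (Y b) + (G b - G a)).
Proof.
move=> ineq; apply: letting_e => e e0; apply: le_trans (regnorm_ge Y e a) _.
have -> : mxnorm (Y b) + (G b - G a) + e = mxnorm (Y b) + e + (G b - G a) by ring.
apply: (@le_trans _ _ (expR c * (regnorm Y e b + (G b - G a)))); last first.
  by rewrite ler_wpM2l ?expR_ge0 // lerD2r regnorm_le.
apply: (@gronwall_backward _ _ (fun t => rdot (dY t) (Y t) / regnorm Y e t) K kappa G g) => //.
- exact: continuous_regnorm.
- by move=> t tab; apply: (is_derive_regnorm e0 dYt).
- by move=> t tab; rewrite -mulNr; apply: regnorm_ineq; auto.
- exact/ltW/regnorm_gt0.
Qed.

End EnergyGronwall.

End Energy.

(** * Primitives and Picard iteration *)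

Section Primitive.
Variable R : realType.
Implicit Types (a b t : R) (g : R -> R).
Local Notation mu := (@lebesgue_measure R).

Lemma primitive_start g a : \int[mu]_(x in `[a, a]) g x = 0.
Proof. by rewrite set_itv1 Rintegral_set1. Qed.

Lemma integrable_continuous_real g a b : continuous_real `[a, b] g ->
  mu.-integrable `[a, b] (EFin \o g).
Proof.
move=> /continuous_real_within cg.
by apply: continuous_compact_integrable => //; exact: segment_compact.
Qed.

Lemma primitive_continuous g a b : a <= b -> continuous_real `[a, b] g ->
  continuous_real `[a, b] (fun s => \int[mu]_(x in `[a, s]) g x).
Proof.
move=> ab cg; apply/continuous_real_within.
exact: parameterized_integral_continuous (integrable_continuous_real cg).
Qed.

Lemma within_interior D t (g : R -> R) : nbhs t D ->
  g s @[s --> within D (nbhs t)] --> g t -> {for t, continuous g}.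
Proof.
move=> tD gt P Pt; have := gt P Pt; rewrite /= => h.
have {}h : nbhs t (fun s => D s -> P (g s)) by [].
suff : nbhs t (fun s => P (g s)) by [].
apply: (@filterS _ (nbhs t) _ (D `&` [set s | D s -> P (g s)])).
  by move=> s [Ds]; apply.
exact: filterI.
Qed.

Lemma primitive_deriv g a b : continuous_real `[a, b] g ->
  forall t, a < t < b -> is_derive t 1 (fun s => \int[mu]_(x in `[a, s]) g x) (g t).
Proof.
move=> cg t /andP[at_ tb].
have tab : nbhs t `[a, b]%classic.
  have tin : t \in `]a, b[ by rewrite in_itv /= at_.
  by apply: filterS (near_in_itvoo tin) => s; exact: subset_itv_oo_cc.
have cgt : {for t, continuous g}.
  by apply: within_interior tab (cg _ _); rewrite /= in_itv /= !ltW.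
have [dG G'] := continuous_FTC1_closed tb (integrable_continuous_real cg) at_ cgt.
by split; [exact: dG|rewrite -derive1E].
Qed.

End Primitive.

Section Picard.
Variable R : realType.
Local Notation Re := complex.Re.
Local Notation Im := complex.Im.
Local Notation mu := (@lebesgue_measure R).

Definition mx_primitive m p (f : R -> 'M[R[i]]_(m, p)) (s : R) : 'M[R[i]]_(m, p) :=
  \matrix_(i, j) ((\int[mu]_(x in `[0, s]) Re (f x i j))
                  +i* (\int[mu]_(x in `[0, s]) Im (f x i j))).

Lemma continuous_fiber_Re D m p (f : R -> 'M[R[i]]_(m, p)) i j :
  continuous_fiber D f -> continuous_real D (fun s => Re (f s i j)).
Proof. by move=> cf t Dt; apply: mxcvg_Re; exact: cf. Qed.

Lemma continuous_fiber_Im D m p (f : R -> 'M[R[i]]_(m, p)) i j :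
  continuous_fiber D f -> continuous_real D (fun s => Im (f s i j)).
Proof. by move=> cf t Dt; apply: mxcvg_Im; exact: cf. Qed.

Lemma mx_primitive0 m p (f : R -> 'M[R[i]]_(m, p)) : mx_primitive f 0 = 0.
Proof. by apply/matrixP => i j; rewrite !mxE !primitive_start. Qed.

Lemma nbhs_within_itv (a t b : R) (D : set R) : a <= t -> t < b ->
  D = `[a, +oo[%classic -> within D (nbhs t) `=>` within `[a, b]%classic (nbhs t).
Proof.
move=> at_ tb -> P /= h.
have {}h : nbhs t (fun s => `[a, b]%classic s -> P s) by [].
suff : nbhs t (fun s => `[a, +oo[%classic s -> P s) by [].
apply: (@filterS _ (nbhs t) _ ([set s | `[a, b]%classic s -> P s] `&` [set s | s < b])).
  move=> s [hs sb]; rewrite /= in_itv /= andbT => as_.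
  by apply: hs; rewrite /= in_itv /= as_ ltW.
by apply: filterI => //; exact: lt_nbhsl.
Qed.

Lemma continuous_mx_primitive m p (f : R -> 'M[R[i]]_(m, p)) :
  continuous_fiber `[0, +oo[ f -> continuous_fiber `[0, +oo[ (mx_primitive f).
Proof.
move=> cf t t0; have {}t0 : 0 <= t by rewrite /= in_itv /= andbT in t0.
have tt : t < t + 1 by rewrite ltrDl.
have sub : `[0, t + 1]%classic `<=` `[0, +oo[%classic by apply: subset_itvl.
apply: mxcvg_sub (nbhs_within_itv t0 tt erefl) _.
have t1 : 0 <= t + 1 by rewrite addr_ge0.
have tin : `[0, t + 1]%classic t by rewrite /= in_itv /= t0 ltW.
have {}cf := continuous_fiber_sub sub cf.
apply: mxcvg_entries => i j.
  have e : (fun s => Re (mx_primitive f s i j)) = fun s => \int[mu]_(x in `[0, s]) Re (f x i j).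
    by apply/funext => s; rewrite mxE.
  have := primitive_continuous t1 (@continuous_fiber_Re _ _ _ _ i j cf).
  by rewrite -e => /(_ t tin).
have e : (fun s => Im (mx_primitive f s i j)) = fun s => \int[mu]_(x in `[0, s]) Im (f x i j).
  by apply/funext => s; rewrite mxE.
have := primitive_continuous t1 (@continuous_fiber_Im _ _ _ _ i j cf).
by rewrite -e => /(_ t tin).
Qed.

Lemma mx_primitive_deriv m p (f : R -> 'M[R[i]]_(m, p)) :
  continuous_fiber `[0, +oo[ f -> forall t, 0 < t ->
  has_deriv_on setT (mx_primitive f) t (f t).
Proof.
move=> cf t t0.
have tt : 0 < t < t + 1 by rewrite t0 ltrDl ltr01.
have sub : `[0, t + 1]%classic `<=` `[0, +oo[%classic by apply: subset_itvl.
have {}cf := continuous_fiber_sub sub cf.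
apply: has_deriv_on_entries => i j.
  under eq_fun do rewrite mxE /=.
  exact: (primitive_deriv (@continuous_fiber_Re _ _ _ _ i j cf) tt).
under eq_fun do rewrite mxE /=.
exact: (primitive_deriv (@continuous_fiber_Im _ _ _ _ i j cf) tt).
Qed.

(** A mean value inequality: the energy estimate for Y - Y a with kappa = 0. *)
Lemma mxnorm_increment m p (Y dY : R -> 'M[R[i]]_(m, p)) (h h' : R -> R) a b : a <= b ->
  continuous_fiber `[a, b] Y -> continuous_real `[a, b] h ->
  (forall t, a < t < b -> has_deriv_on setT Y t (dY t)) ->
  (forall t, a < t < b -> is_derive t 1 h (h' t)) ->
  (forall t, a < t < b -> mxnorm (dY t) <= h' t) ->
  mxnorm (Y b - Y a) <= h b - h a.
Proof.
move=> ab cY ch dYt dh le_h'.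
suff : mxnorm (Y b - Y a) <= expR 0 * (mxnorm (Y a - Y a) + (h b - h a)).
  by rewrite expR0 mul1r subrr mxnorm0 add0r.
apply: (@energy_forward R m p (fun s => Y s - Y a) dY (fun=> 0) (fun=> 0) h h' a b 0).
- exact: ab.
- move=> t Dt; apply: mxcvgB; first exact: cY.
  exact: mxcvg_cst.
- exact: continuous_real_cst.
- exact: ch.
- move=> t tab; rewrite -[dY t]subr0; apply: has_deriv_onB; first exact: dYt.
  exact: has_deriv_on_cst.
- by [].
- by move=> t tab; rewrite (le_trans _ (le_h' _ tab)) ?mxnorm_ge0.
- by rewrite subrr.
- move=> t tab; rewrite mul0r add0r (le_trans (rdot_le _ _)) //.
  by rewrite ler_wpM2r ?mxnorm_ge0 // le_h'.
Qed.

(** The sequences x k - 2 C 2^-k and x k + 2 C 2^-k are monotone and enclose the limit. *)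
Lemma geometric_cvg (x : nat -> R) (C : R) :
  (forall k, `|x k.+1 - x k| <= C * 2^-1 ^+ k) ->
  forall k, `|x k - limn x| <= 2 * C * 2^-1 ^+ k.
Proof.
move=> xC; pose lo k := x k - 2 * C * 2^-1 ^+ k; pose hi k := x k + 2 * C * 2^-1 ^+ k.
have C0 : 0 <= C.
  by have := xC 0%N; rewrite expr0 mulr1; exact: le_trans.
have p0 k : 0 <= 2^-1 ^+ k :> R by rewrite exprn_ge0 ?invr_ge0.
have lo_nd : nondecreasing_seq lo.
  apply/nondecreasing_seqP => k; rewrite /lo exprS.
  have := xC k; rewrite ler_norml => /andP[h _]; have := mulr_ge0 C0 (p0 k); lra.
have hi_ni : nonincreasing_seq hi.
  apply/nonincreasing_seqP => k; rewrite /hi exprS.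
  have := xC k; rewrite ler_norml => /andP[_ h]; have := mulr_ge0 C0 (p0 k); lra.
have lohi k : lo k <= hi k.
  by rewrite /lo /hi; have := mulr_ge0 C0 (p0 k); lra.
have lohi2 j k : lo j <= hi k.
  apply: (le_trans (lo_nd _ _ (leq_maxl j k))); apply: (le_trans (lohi _)).
  exact: hi_ni (leq_maxr j k).
have e0 : 2 * C * 2^-1 ^+ k @[k --> \oo] --> (0 : R).
  rewrite -(mulr0 (2 * C)); apply: cvgM; first exact: cvg_cst.
  apply: cvg_expr; rewrite ger0_norm ?invr_ge0 //; lra.
have clo : lo k @[k --> \oo] --> limn lo.
  apply: nondecreasing_is_cvgn => //; exists (hi 0%N) => _ [j _ <-]; exact: lohi2.
have cx : x k @[k --> \oo] --> limn lo.
  have -> : x = (fun k => lo k + 2 * C * 2^-1 ^+ k).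
    by apply/funext => k; rewrite /lo subrK.
  by rewrite -[limn lo]addr0; exact: cvgD.
move=> k; rewrite (cvg_lim _ cx) // ler_norml.
have h1 : lo k <= limn lo by apply: nondecreasing_cvgn_le => //; apply/cvg_ex; exists (limn lo).
have h2 : limn lo <= hi k.
  by apply: limr_le; [apply/cvg_ex; exists (limn lo)|apply: nearW => j; exact: lohi2].
by move: h1 h2; rewrite /lo /hi => h1 h2; apply/andP; split; lra.
Qed.

Section Iteration.
Variables (n p : nat) (A : R -> 'M[R[i]]_n) (F : R -> 'M[R[i]]_(n, p)) (u : 'M[R[i]]_(n, p)).
Hypotheses (cA : continuous_fiber `[0, +oo[ A) (cF : continuous_fiber `[0, +oo[ F).

Fixpoint picard k : R -> 'M[R[i]]_(n, p) :=
  if k is k'.+1 then fun s => u + mx_primitive (fun x => A x *m picard k' x + F x) s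
  else fun=> u.

Lemma continuous_picard_step (V : R -> 'M[R[i]]_(n, p)) :
  continuous_fiber `[0, +oo[ V ->
  continuous_fiber `[0, +oo[ (fun x => A x *m V x + F x).
Proof. by move=> cV t Dt; apply: mxcvgD; [apply: mxcvgM; [exact: cA|exact: cV]|exact: cF]. Qed.

Lemma continuous_picard k : continuous_fiber `[0, +oo[ (picard k).
Proof.
elim: k => [|k ih] t Dt; first exact: mxcvg_cst.
apply: mxcvgD; first exact: mxcvg_cst.
by apply: continuous_mx_primitive => //; exact: continuous_picard_step.
Qed.

Lemma picard_start k : picard k 0 = u.
Proof. by case: k => [//|k] /=; rewrite mx_primitive0 addr0. Qed.

Lemma picard_deriv k s : 0 < s ->
  has_deriv_on setT (picard k.+1) s (A s *m picard k s + F s).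
Proof.
move=> s0; rewrite -[X in has_deriv_on _ _ _ X]add0r; apply: has_deriv_onD.
  exact: has_deriv_on_cst.
by apply: mx_primitive_deriv => //; apply: continuous_picard_step; exact: continuous_picard.
Qed.

Arguments picard : simpl never.

Lemma mxEB m (B D : 'M[R[i]]_(m, p)) i j : (B - D) i j = B i j - D i j.
Proof. by rewrite !mxE. Qed.

Lemma continuous_real_bounded (f : R -> R) (L : R) : 0 <= L ->
  continuous_real `[0, +oo[ f -> exists2 K, 1 <= K & forall s, 0 <= s <= L -> f s <= K.
Proof.
move=> L0 cf; have sub : `[0, L]%classic `<=` `[0, +oo[%classic by apply: subset_itvl.
have /continuous_real_within := continuous_real_sub sub cf.
move=> /(EVT_max L0)[c _ fc]; exists (Num.max 1 (f c)); first by rewrite le_max lexx.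
by move=> s sL; rewrite le_max fc ?orbT // in_itv.
Qed.

(** In the norm sup |.| exp (- 2 K s), where K bounds |A|, a Picard step halves distances. *)
Lemma picard_contracts (L : R) : 0 <= L -> exists C, forall k s, 0 <= s <= L ->
  mxnorm (picard k.+1 s - picard k s) <= C * 2^-1 ^+ k.
Proof.
move=> L0.
have [K K1 AK] := continuous_real_bounded L0 (continuous_fiber_mxnorm cA).
have cD k : continuous_fiber `[0, +oo[ (fun s => picard k.+1 s - picard k s).
  by move=> t Dt; apply: mxcvgB; exact: continuous_picard.
have [M M1 DM] := continuous_real_bounded L0 (continuous_fiber_mxnorm (cD 0%N)).
have K0 : 0 < K by rewrite (lt_le_trans _ K1).
have M0 : 0 <= M by rewrite (le_trans _ M1).
have weighted k s : 0 <= s <= L ->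
    mxnorm (picard k.+1 s - picard k s) <= M * 2^-1 ^+ k * expR (2 * K * s).
  elim: k s => [|k ih] s sL.
    rewrite expr0 mulr1 (le_trans (DM _ sL)) // ler_peMr // -[leLHS]expR0 ler_expR.
    by case/andP: sL => s0 _; rewrite !mulr_ge0 // ltW.
  case/andP: sL => s0 sL.
  pose D x := picard k.+2 x - picard k.+1 x.
  pose h x := M * 2^-1 ^+ k.+1 * expR (2 * K * x).
  pose h' x := K * (M * 2^-1 ^+ k * expR (2 * K * x)).
  suff : mxnorm (D s - D 0) <= h s - h 0.
    rewrite /D !picard_start (subrr u) subr0 => /le_trans; apply.
    by rewrite /h gerBl mulr_ge0 ?expR_ge0 // mulr_ge0 // exprn_ge0 ?invr_ge0.
  apply: (@mxnorm_increment _ _ D (fun x => A x *m (picard k.+1 x - picard k x)) h h' 0 s s0).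
  - apply: continuous_fiber_sub (cD k.+1); exact: subset_itvl.
  - move=> x _; apply: cvgM; first exact: cvg_cst.
    apply: continuous_cvg; first exact: continuous_expR.
    by apply: cvgM; [exact: cvg_cst|exact: cvg_within_filter].
  - move=> x /andP[x0 xs].
    have -> : A x *m (picard k.+1 x - picard k x) =
        (A x *m picard k.+1 x + F x) - (A x *m picard k x + F x).
      by rewrite mulmxBr opprD addrACA subrr addr0.
    by apply: has_deriv_onB; exact: picard_deriv.
  - move=> x _; rewrite /h.
    have d : is_derive x 1 (fun x => 2 * K * x) (2 * K * 1).
      by apply: is_derive_scale; exact: is_derive_id.
    have := is_derive_scale (is_derive_comp d (is_derive_expR _)) (M * 2^-1 ^+ k.+1).
    by move=> /is_derive_eq; apply; rewrite /h' exprS; field.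
  - move=> x /andP[x0 xs]; have xL : 0 <= x <= L by rewrite ltW //= (le_trans (ltW xs)).
    by rewrite (le_trans (mxnormM _ _)) // ler_pM ?mxnorm_ge0 ?AK //; exact: ih.
exists (M * expR (2 * K * L)) => k s sL; apply: le_trans (weighted _ _ sL) _.
rewrite mulrAC ler_wpM2r ?exprn_ge0 ?invr_ge0 // ler_wpM2l // ler_expR.
by case/andP: sL => s0 sL; rewrite ler_wpM2l // mulr_ge0 // ltW.
Qed.

Definition picard_limit (s : R) : 'M[R[i]]_(n, p) :=
  \matrix_(i, j) (limn (fun k => Re (picard k s i j)) +i* limn (fun k => Im (picard k s i j))).

Lemma picard_limit_rate (L : R) : 0 <= L -> exists2 C, 0 <= C & forall k s, 0 <= s <= L ->
  mxnorm (picard k s - picard_limit s) <= C * 2^-1 ^+ k.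
Proof.
move=> L0; have [C hC] := picard_contracts L0.
have C0 : 0 <= C.
  have := hC 0%N 0; rewrite lexx L0 expr0 mulr1 => /(_ isT); apply: le_trans; exact: mxnorm_ge0.
exists (\sum_(i < n) \sum_(j < p) (2 * C + 2 * C)).
  by apply: sumr_ge0 => i _; apply: sumr_ge0 => j _; lra.
move=> k s sL; apply: le_trans (mxnorm_le_sum _) _.
rewrite mulr_suml; apply: ler_sum => i _; rewrite mulr_suml; apply: ler_sum => j _.
rewrite mulrDl !mxE complexReD complexImD complexReN complexImN.
apply: lerD.
- apply: (geometric_cvg (x := fun k => Re (picard k s i j))) => {}k; apply: le_trans (hC _ _ sL).
  apply: le_trans (normc_le_mxnorm _ i j); apply: le_trans (Re_le_normc _).
  by rewrite mxEB complexReD complexReN.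
- apply: (geometric_cvg (x := fun k => Im (picard k s i j))) => {}k; apply: le_trans (hC _ _ sL).
  apply: le_trans (normc_le_mxnorm _ i j); apply: le_trans (Im_le_normc _).
  by rewrite mxEB complexImD complexImN.
Qed.

Lemma half_pow_cvg0 (C : R) : C * 2^-1 ^+ k @[k --> \oo] --> (0 : R).
Proof.
rewrite -(mulr0 C); apply: cvgM; first exact: cvg_cst.
by apply: cvg_expr; rewrite ger0_norm ?invr_ge0 //; lra.
Qed.

Lemma continuous_picard_limit : continuous_fiber `[0, +oo[ picard_limit.
Proof.
move=> t Dt; have t0 : 0 <= t by rewrite /= in_itv /= andbT in Dt.
have [C C0 hC] := picard_limit_rate (addr_ge0 t0 ler01).
apply/cvgrPdist_le => e e0.
have e3 : 0 < e / 3 by rewrite divr_gt0.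
have /cvgrPdist_le /(_ _ e3) [N _ /(_ N (leqnn _))] := half_pow_cvg0 C.
rewrite /= sub0r normrN ger0_norm ?mulr_ge0 ?exprn_ge0 ?invr_ge0 // => CN.
have /cvgrPdist_le /(_ _ e3) := continuous_picard N Dt.
apply: filter_app; near=> s; rewrite !sub0r !normrN !ger0_norm ?mxnorm_ge0 // => hs.
have s0 : 0 <= s.
  have : `[0, +oo[%classic s by near: s; exact: withinT.
  by rewrite /= in_itv /= andbT.
have st : s <= t + 1.
  near: s; apply: cvg_within; apply: (@filterS _ (nbhs t) _ [set s | s < t + 1]).
    by move=> s /= /ltW.
  by apply: lt_nbhsl; rewrite ltrDl.
have -> : picard_limit s - picard_limit t = (picard_limit s - picard N s) +
   ((picard N s - picard N t) + (picard N t - picard_limit t)).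
  by rewrite !addrA !subrK.
have h1 : mxnorm (picard_limit s - picard N s) <= e / 3.
  by rewrite mxnormB; apply: le_trans (hC _ _ _) CN; rewrite s0 st.
have h2 : mxnorm (picard N t - picard_limit t) <= e / 3.
  by apply: le_trans (hC _ _ _) CN; rewrite t0 lerDl ler01.
apply: le_trans (ler_mxnormD _ _) _.
have := ler_mxnormD (picard N s - picard N t) (picard N t - picard_limit t); lra.
Unshelve. all: by end_near. Qed.

(** The iterate k + 1 is close to the limit, and it is the Picard step of the iterate k,
    hence close to the Picard step of the limit. *)
Lemma picard_limit_fixed s : 0 <= s ->
  picard_limit s = u + mx_primitive (fun x => A x *m picard_limit x + F x) s.
Proof.
move=> s0; have [C C0 hC] := picard_limit_rate s0.
have [K K1 AK] := continuous_real_bounded s0 (continuous_fiber_mxnorm cA).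
pose W x := u + mx_primitive (fun x => A x *m picard_limit x + F x) x.
have cW : continuous_fiber `[0, +oo[ W.
  move=> t Dt; apply: mxcvgD; first exact: mxcvg_cst.
  apply: continuous_mx_primitive => //; apply: continuous_picard_step.
  exact: continuous_picard_limit.
have W0 : W 0 = u by rewrite /W mx_primitive0 addr0.
have dW x : 0 < x -> has_deriv_on setT W x (A x *m picard_limit x + F x).
  move=> x0; rewrite -[X in has_deriv_on _ _ _ X]add0r; apply: has_deriv_onD.
    exact: has_deriv_on_cst.
  apply: mx_primitive_deriv => //; apply: continuous_picard_step.
  exact: continuous_picard_limit.
have step k : mxnorm (picard k.+1 s - W s) <= (K * C * s) * 2^-1 ^+ k.
  pose D x := picard k.+1 x - W x.
  pose h x := K * C * 2^-1 ^+ k * x.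
  suff : mxnorm (D s - D 0) <= h s - h 0.
    by rewrite /D W0 picard_start (subrr u) subr0 /h mulr0 subr0 mulrAC.
  apply: (@mxnorm_increment _ _ D (fun x => A x *m (picard k x - picard_limit x)) h
    (fun x => K * C * 2^-1 ^+ k * 1) 0 s s0).
  - apply: (@continuous_fiber_sub _ `[0, +oo[%classic); first exact: subset_itvl.
    by move=> t Dt; apply: mxcvgB; [exact: (@continuous_picard k.+1)|exact: cW].
  - move=> x _; apply: cvgM; first exact: cvg_cst.
    exact: cvg_within_filter.
  - move=> x /andP[x0 xs].
    have -> : A x *m (picard k x - picard_limit x) =
        (A x *m picard k x + F x) - (A x *m picard_limit x + F x).
      by rewrite mulmxBr opprD addrACA subrr addr0.
    by apply: has_deriv_onB; [exact: picard_deriv|exact: dW].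
  - move=> x /andP[x0 xs]; have xL : 0 <= x <= s by rewrite !ltW.
    rewrite (le_trans (mxnormM _ _)) // mulr1 -mulrA ler_pM ?mxnorm_ge0 ?AK //.
    exact: hC.
rewrite -/(W s).
apply/eqP; rewrite -subr_eq0; apply/eqP/mxnorm0_eq0.
apply/eqP; rewrite eq_le mxnorm_ge0 andbT.
have lim0 : (C * 2^-1 + K * C * s) * 2^-1 ^+ k @[k --> \oo] --> (0 : R).
  exact: half_pow_cvg0.
apply: (cvgr_to_ge lim0); apply: nearW => k.
have h1 := step k; have h2 := hC k.+1 s; rewrite s0 lexx in h2.
have tri (X Y Z : 'M[R[i]]_(n, p)) : mxnorm (X - Z) <= mxnorm (Y - X) + mxnorm (Y - Z).
  by rewrite (mxnormB Y X); have := ler_mxnormD (X - Y) (Y - Z); rewrite addrA subrK.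
apply: le_trans (tri _ (picard k.+1 s) _) _.
by rewrite [leRHS]mulrDl lerD // (le_trans (h2 isT)) // exprS mulrA.
Qed.

Lemma linear_ode_halfline : exists V : R -> 'M[R[i]]_(n, p),
  [/\ V 0 = u, continuous_fiber `[0, +oo[ V &
      forall s, 0 < s -> has_deriv_on setT V s (A s *m V s + F s)].
Proof.
pose W x := u + mx_primitive (fun x => A x *m picard_limit x + F x) x.
have cP := continuous_picard_step continuous_picard_limit.
exists W; split.
- by rewrite /W mx_primitive0 addr0.
- move=> t Dt; apply: mxcvgD; first exact: mxcvg_cst.
  exact: continuous_mx_primitive.
- move=> s s0; rewrite /W -picard_limit_fixed ?ltW //.
  rewrite -[X in has_deriv_on _ _ _ X]add0r; apply: has_deriv_onD; first exact: has_deriv_on_cst.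
  exact: mx_primitive_deriv.
Qed.

End Iteration.
End Picard.

(** * The Cauchy problem for linear systems *)

Section LinearODE.
Variable R : realType.
Local Notation Re := complex.Re.
Local Notation Im := complex.Im.

Lemma mulmx_cV_inj_unit n (M : 'M[R[i]]_n) :
  (forall v : 'cV[R[i]]_n, M *m v = 0 -> v = 0) -> M \in unitmx.
Proof.
move=> inj; rewrite -unitmx_tr -row_free_unit -kermx_eq0; apply/eqP/row_matrixP => i.
rewrite row0; apply: trmx_inj; rewrite trmx0; apply: inj.
apply: trmx_inj; rewrite trmx_mul trmxK trmx0; apply/sub_kermxP.
exact: row_sub.
Qed.

(** A bounded coefficient matrix makes the flow Lipschitz in both directions of
    time. *)
Lemma linear_flow_zero n p (A Y : R -> 'M[R[i]]_(n, p)) (B : R -> 'M[R[i]]_n) a b : a <= b ->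
  continuous_fiber `[a, b] B -> continuous_fiber `[a, b] Y ->
  (forall t, a < t < b -> has_deriv_on setT Y t (B t *m Y t)) ->
  Y a = 0 <-> Y b = 0.
Proof.
move=> ab cB cY dY.
have [K K0 BK] : exists2 K, 0 <= K & forall t, a <= t <= b -> mxnorm (B t) <= K.
  have /continuous_real_within /(EVT_max ab)[c _ Bc] := continuous_fiber_mxnorm cB.
  by exists (mxnorm (B c)) => [|t tab]; [exact: mxnorm_ge0|apply: Bc; rewrite in_itv].
have rdotB t : a < t < b ->
    `|rdot (B t *m Y t) (Y t)| <= K * mxnorm (Y t) ^+ 2 + 0 * mxnorm (Y t).
  move=> /andP[/ltW at_ /ltW tb]; rewrite mul0r addr0.
  have h1 := rdot_le (B t *m Y t) (Y t); have h2 := rdot_le (- (B t *m Y t)) (Y t).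
  rewrite rdotNl mxnormN in h2.
  have h3 : mxnorm (B t *m Y t) * mxnorm (Y t) <= K * mxnorm (Y t) ^+ 2.
    rewrite expr2 mulrA ler_wpM2r ?mxnorm_ge0 // (le_trans (mxnormM _ _)) //.
    by rewrite ler_wpM2r ?mxnorm_ge0 // BK // at_.
  by rewrite ler_norml; apply/andP; split; lra.
have cK : continuous_real `[a, b] (fun t => K * t).
  by move=> t _; apply: cvgM; [exact: cvg_cst|exact: cvg_within_filter].
have c0 : continuous_real `[a, b] (fun=> 0 : R) by exact: continuous_real_cst.
have dK t : a < t < b -> is_derive t 1 (fun t => K * t) (K * 1).
  by move=> _; apply: is_derive_scale.
split=> Y0; apply: mxnorm0_eq0; apply/eqP; rewrite eq_le mxnorm_ge0 andbT.
  rewrite (le_trans (@energy_forward R n p Y _ _ _ _ _ a b _ ab cY cK c0 dY dK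
    (fun t _ => is_derive_const _ _) _ _ (lexx _) _)) //.
  - by move=> t _; rewrite mulr1.
  - by move=> t tab; rewrite mulr1 (le_trans (ler_norm _) (rdotB t tab)).
  - by rewrite Y0 mxnorm0 subrr addr0 mulr0.
rewrite (le_trans (@energy_backward R n p Y _ _ _ _ _ a b _ ab cY cK c0 dY dK
  (fun t _ => is_derive_const _ _) _ _ (lexx _) _)) //.
- by move=> t _; rewrite mulr1.
- move=> t tab; rewrite mulr1 (le_trans _ (rdotB t tab)) //.
  by rewrite -normrN ler_norm.
- by rewrite Y0 mxnorm0 subrr addr0 mulr0.
Qed.

(** A value can be prescribed at s1 instead of 0 because the fundamental matrix Phi is
    invertible there: a solution Phi v that vanishes at s1 vanishes at 0, where it is v. *)
Lemma linear_ode_halfline_at n p (A : R -> 'M[R[i]]_n) (F : R -> 'M[R[i]]_(n, p)) u s1 :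
  continuous_fiber `[0, +oo[ A -> continuous_fiber `[0, +oo[ F -> 0 <= s1 ->
  exists2 V : R -> 'M[R[i]]_(n, p), V s1 = u &
      forall s, 0 < s -> has_deriv_on setT V s (A s *m V s + F s).
Proof.
move=> cA cF s10.
have c0 : continuous_fiber `[0, +oo[ (fun=> 0 : 'M[R[i]]_n) by move=> t _; exact: mxcvg_cst.
have [W [W0 cW dW]] := linear_ode_halfline 0 cA cF.
have [Phi [Phi0 cPhi dPhi]] := linear_ode_halfline 1%:M cA c0.
have sub : `[0, s1]%classic `<=` `[0, +oo[%classic by apply: subset_itvl.
have unit1 : Phi s1 \in unitmx.
  apply: mulmx_cV_inj_unit => v Phiv.
  have /= := @linear_flow_zero n 1 (fun=> 0) (fun s => Phi s *m v) A 0 s1 s10.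
  rewrite Phi0 mul1mx => H; apply/H => //.
  - exact: continuous_fiber_sub cA.
  - move=> t Dt; apply: mxcvgM; last exact: mxcvg_cst.
    exact: (continuous_fiber_sub sub cPhi).
  - move=> t /andP[t0 _].
    have -> : A t *m (Phi t *m v) = (A t *m Phi t + 0) *m v + Phi t *m 0.
      by rewrite mulmx0 !addr0 mulmxA.
    by apply: has_deriv_onM; [exact: dPhi|exact: has_deriv_on_cst].
pose v := invmx (Phi s1) *m (u - W s1).
exists (fun s => W s + Phi s *m v); first by rewrite /v mulKVmx // addrC subrK.
move=> s s0.
have -> : A s *m (W s + Phi s *m v) + F s =
    (A s *m W s + F s) + ((A s *m Phi s + 0) *m v + Phi s *m 0).
  by rewrite mulmx0 !addr0 mulmxDr mulmxA addrAC.
by apply: has_deriv_onD; [exact: dW|apply: has_deriv_onM; [exact: dPhi|exact: has_deriv_on_cst]].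
Qed.

Lemma has_deriv_on_comp m p (f : R -> 'M[R[i]]_(m, p)) (theta : R -> R) t d l :
  has_deriv_on setT f (theta t) l -> is_derive t 1 theta d ->
  has_deriv_on setT (fun s => f (theta s)) t (d%:C *: l).
Proof.
move=> fl td; have tT : nbhs (theta t) (setT : set R) by exact: filterT.
apply: has_deriv_on_entries => i j; rewrite mxE.
  rewrite complexReM /= mul0r subr0 mulrC.
  exact: (is_derive_comp td (has_deriv_on_Re i j tT fl)).
rewrite complexImM /= mul0r addr0 mulrC.
exact: (is_derive_comp td (has_deriv_on_Im i j tT fl)).
Qed.

Lemma continuous_fiber_comp (D E : set R) m p (f : R -> 'M[R[i]]_(m, p)) (theta : R -> R) :
  continuous_fiber D f -> (forall s, E s -> D (theta s)) -> continuous_real E theta ->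
  continuous_fiber E (fun s => f (theta s)).
Proof.
move=> cf ED ct t Et.
suff h : theta s @[s --> within E (nbhs t)] --> within D (nbhs (theta t)).
  exact: cvg_comp h (cf _ (ED _ Et)).
move=> P DP; have {}DP : nbhs (theta t) (fun x => D x -> P x) by [].
have := ct t Et _ DP => /= h.
have {}h : nbhs t (fun s => E s -> D (theta s) -> P (theta s)) by [].
suff : nbhs t (fun s => E s -> P (theta s)) by [].
by apply: filterS h => s h Es; apply: h => //; exact: ED.
Qed.

(** Substituting t = 2 T exp (- s) places the half-open interval (0, T] inside the
    half-line on which solutions are already known to exist; starting at 2 T
    rather than at T makes T an interior point. *)
Lemma linear_ode_exists n p (A : R -> 'M[R[i]]_n) (F : R -> 'M[R[i]]_(n, p)) u T : 0 < T ->
  continuous_fiber `]0, T] A -> continuous_fiber `]0, T] F ->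
  exists2 U : R -> 'M[R[i]]_(n, p), U T = u &
    forall t, 0 < t <= T -> has_deriv_on setT U t (A t *m U t + F t).
Proof.
move=> T0 cA cF; pose theta s := 2 * T * expR (- s); pose clamp s := Num.min T (theta s).
have theta0 s : 0 < theta s by rewrite !mulr_gt0 ?expR_gt0.
have ctheta : continuous theta.
  move=> s; apply: cvgM; first exact: cvg_cst.
  by apply: continuous_cvg; [exact: continuous_expR|apply: cvgN; exact: cvg_id].
have cth D : continuous_real D theta.
  by move=> s _; apply: cvg_within_filter; exact: ctheta.
have ccl D : continuous_real D clamp.
  move=> s _; apply: cvg_within_filter.
  by apply: (@continuous_min R R (fun=> T) theta s); [exact: cvg_cst|exact: ctheta].
have clD s : `[0, +oo[%classic s -> `]0, T]%classic (clamp s).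
  by move=> _; rewrite /= in_itv /= lt_min T0 theta0 /= ge_min lexx.
pose A1 s := (- theta s)%:C *: A (clamp s).
pose F1 s := (- theta s)%:C *: F (clamp s).
have cA1 : continuous_fiber `[0, +oo[ A1.
  move=> s Ds; apply: mxcvgZ; first by apply: cvgN; exact: cth.
  exact: (continuous_fiber_comp cA clD (ccl _)).
have cF1 : continuous_fiber `[0, +oo[ F1.
  move=> s Ds; apply: mxcvgZ; first by apply: cvgN; exact: cth.
  exact: (continuous_fiber_comp cF clD (ccl _)).
have s10 : 0 <= ln 2 :> R by rewrite ln_ge0 // ler1n.
have [V V1 dV] := linear_ode_halfline_at u cA1 cF1 s10.
pose sigma t : R := ln (2 * T) - ln t.
have thetaK t : 0 < t -> theta (sigma t) = t.
  move=> t0; rewrite /theta /sigma opprB expRD expRN !lnK ?posrE ?mulr_gt0 //.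
  by rewrite mulrC divfK // gt_eqF // mulr_gt0.
exists (fun t => V (sigma t)).
  by rewrite /sigma lnM ?posrE // addrK.
move=> t /andP[t0 tT].
have st : 0 < sigma t.
  rewrite subr_gt0 ltr_ln ?posrE ?mulr_gt0 // (le_lt_trans tT) //.
  by rewrite ltr_pMl // ltr1n.
have clt : clamp (sigma t) = t by rewrite /clamp thetaK // min_r.
have ds : is_derive t 1 sigma (0 - t^-1).
  by apply: is_derive_sub; exact: is_derive1_ln.
have := has_deriv_on_comp (dV _ st) ds.
rewrite /A1 /F1 clt thetaK // -scalemxAl -scalerDr scalerA -rmorphM /=.
by rewrite sub0r mulrNN mulVf ?gt_eqF // scale1r.
Qed.

Lemma linear_ode_unique n p (A : R -> 'M[R[i]]_n) (Y : R -> 'M[R[i]]_(n, p)) T :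
  continuous_fiber `]0, T] A -> continuous_fiber `]0, T] Y ->
  (forall t, 0 < t < T -> has_deriv_on setT Y t (A t *m Y t)) ->
  forall t1 t2, 0 < t1 <= T -> 0 < t2 <= T -> Y t1 = 0 -> Y t2 = 0.
Proof.
move=> cA cY dY t1 t2.
move=> /andP[t10 t1T] /andP[t20 t2T].
have H a b : 0 < a -> b <= T -> a <= b -> Y a = 0 <-> Y b = 0.
  move=> a0 bT ab.
  have sub : `[a, b]%classic `<=` `]0, T]%classic.
    by move=> x /=; rewrite !in_itv /= => /andP[/(lt_le_trans a0) -> /le_trans ->].
  apply: (@linear_flow_zero n p Y Y A) => //; try exact: (continuous_fiber_sub sub).
  by move=> t /andP[at_ tb]; apply: dY; rewrite (lt_trans a0) //= (lt_le_trans tb).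
have [le|/ltW le] := leP t1 t2; [by move/(H _ _ t10 t2T le)|by move/(H _ _ t20 t1T le)].
Qed.

End LinearODE.

(** * Matrix exponentials and Jordan matrices *)

Section MatrixExponential.
Variable R : realType.
Local Notation Re := complex.Re.
Local Notation Im := complex.Im.
Local Notation normc := ComplexField.Normc.normc.

Variable n : nat.
Implicit Types (B M X D : 'M[R[i]]_n) (s t : R).

(** Lets the real and imaginary parts be treated in one proof. *)
Definition reim (b : bool) (x : R[i]) : R := if b then Re x else Im x.

Lemma reimZ b (r : R) x : reim b (r%:C * x) = r * reim b x.
Proof. by case: b; rewrite /= ?complexReM ?complexImM /= mul0r ?subr0 ?addr0. Qed.

Lemma reim_le b x : `|reim b x| <= normc x.
Proof. by case: b; [exact: Re_le_normc|exact: Im_le_normc]. Qed.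

Lemma reim_sum b I (r : seq I) (P : pred I) (f : I -> R[i]) :
  reim b (\sum_(i <- r | P i) f i) = \sum_(i <- r | P i) reim b (f i).
Proof. by case: b; [exact: complexRe_sum|exact: complexIm_sum]. Qed.

Lemma mxnorm_expr M B k : mxnorm (M *m B ^+ k) <= mxnorm M * mxnorm B ^+ k.
Proof.
elim: k => [|k ih]; first by rewrite !expr0 mulmx1 mulr1.
rewrite exprSr -mulmxE mulmxA (le_trans (mxnormM _ _)) // exprSr mulrA.
by rewrite ler_wpM2r ?mxnorm_ge0.
Qed.

(** Taylor coefficients of an entry of M exp (s B); the left factor M makes the
    family stable under differentiation in s. *)
Definition exp_coef b M B (i j : 'I_n) (k : nat) : R :=
  reim b ((M *m B ^+ k) i j) / k`!%:R.

Lemma pseries_diffs_exp_coef b M B i j :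
  pseries_diffs (exp_coef b M B i j) = exp_coef b (M *m B) B i j.
Proof.
apply/funext => k; rewrite /pseries_diffs /exp_coef exprS -mulmxE mulmxA factS natrM.
by rewrite invfM mulrCA mulVKf // pnatr_eq0.
Qed.

Lemma cvg_exp_coef b M B i j s : cvgn (pseries (exp_coef b M B i j) s).
Proof.
apply: normed_cvg; rewrite /=.
apply: (@series_le_cvg _ _ (fun k => mxnorm M * exp_coeff (mxnorm B * `|s|) k)) => [k|k|k|].
- exact: normr_ge0.
- by rewrite mulr_ge0 ?mxnorm_ge0 // /exp_coeff /= divr_ge0 // exprn_ge0 // mulr_ge0 ?mxnorm_ge0.
- rewrite /exp_coeff /exp_coef /= !normrM normrX normfV normr_nat exprMn.
  rewrite [leRHS](_ : _ = (mxnorm M * mxnorm B ^+ k) * k`!%:R^-1 * `|s| ^+ k); last by ring.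
  rewrite ler_wpM2r ?exprn_ge0 // ler_wpM2r ?invr_ge0 //.
  rewrite (le_trans (reim_le _ _)) // (le_trans (normc_le_mxnorm _ _ _)) //.
  exact: mxnorm_expr.
- by apply: is_cvg_seriesZ; exact: is_cvg_series_exp_coeff.
Qed.

Lemma is_derive_exp_coef b M B i j s :
  is_derive s 1 (fun x => limn (pseries (exp_coef b M B i j) x))
                (limn (pseries (exp_coef b (M *m B) B i j) s)).
Proof.
have := @pseries_snd_diffs R (exp_coef b M B i j) (`|s| + 1) s.
rewrite !pseries_diffs_exp_coef; apply; try exact: cvg_exp_coef.
by rewrite [ltRHS]ger0_norm ?addr_ge0 // ltrDl.
Qed.

Definition mxexp_mul M B s : 'M[R[i]]_n :=
  \matrix_(i, j) (limn (pseries (exp_coef true M B i j) s)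
                  +i* limn (pseries (exp_coef false M B i j) s)).

Lemma mxexp_mul_deriv M B s :
  has_deriv_on setT (mxexp_mul M B) s (mxexp_mul (M *m B) B s).
Proof.
apply: has_deriv_on_entries => i j; rewrite mxE /=.
  rewrite (_ : (fun x => _) = fun x => limn (pseries (exp_coef true M B i j) x)).
    exact: is_derive_exp_coef.
  by apply/funext => x; rewrite mxE.
rewrite (_ : (fun x => _) = fun x => limn (pseries (exp_coef false M B i j) x)).
  exact: is_derive_exp_coef.
by apply/funext => x; rewrite mxE.
Qed.

Lemma mxexp_mul_cvg M B s :
  mxcvg \oo (fun N => \sum_(0 <= k < N) (s ^+ k / k`!%:R)%:C *: (M *m B ^+ k))
    (mxexp_mul M B s).
Proof.
have e b N i j : reim b ((\sum_(0 <= k < N) (s ^+ k / k`!%:R)%:C *: (M *m B ^+ k)) i j) =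
    pseries (exp_coef b M B i j) s N.
  rewrite summxE reim_sum /pseries /series /=; apply: eq_bigr => k _.
  by rewrite mxE reimZ /exp_coef; ring.
apply: mxcvg_entries => i j; rewrite mxE /=.
  rewrite (_ : (fun N => _) = pseries (exp_coef true M B i j) s).
    exact: cvg_exp_coef.
  by apply/funext => N; rewrite -e.
rewrite (_ : (fun N => _) = pseries (exp_coef false M B i j) s).
  exact: cvg_exp_coef.
by apply/funext => N; rewrite -e.
Qed.

Lemma exprZC (s : R) B k : (s%:C *: B) ^+ k = (s ^+ k)%:C *: B ^+ k.
Proof.
elim: k => [|k ih]; first by rewrite !expr0 scale1r.
by rewrite !exprS ih -mulmxE -scalemxAl -scalemxAr scalerA -rmorphM mulmxE.
Qed.

Lemma mxexpE B s : mxexp (s%:C *: B) = mxexp_mul 1%:M B s.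
Proof.
apply/matrixP => i j; rewrite !mxE; congr (limn _ +i* limn _); apply/funext => N;
  rewrite /pseries /series /=; apply: eq_bigr => k _;
  rewrite exprZC mxE /exp_coef mul1mx.
  by have := reimZ true (s ^+ k) ((B ^+ k) i j) => /= ->; ring.
by have := reimZ false (s ^+ k) ((B ^+ k) i j) => /= ->; ring.
Qed.

Lemma mxexp_cvg B s :
  mxcvg \oo (fun N => \sum_(0 <= k < N) (s ^+ k / k`!%:R)%:C *: B ^+ k) (mxexp (s%:C *: B)).
Proof.
rewrite mxexpE; apply: mxcvg_near (mxexp_mul_cvg 1%:M B s); apply: nearW => N.
by apply: eq_bigr => k _; rewrite mul1mx.
Qed.

(* Conversion must not unfold the limits of series. *)
Opaque mxexp mxexp_mul.

(** Both sides are limits of the same partial sums. *)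
Lemma mxexp_mulE M B s : mxexp_mul M B s = M *m mxexp (s%:C *: B).
Proof.
apply: (mxcvg_unique (F := \oo) (mxexp_mul_cvg M B s)).
apply: mxcvg_near (mxcvgM (mxcvg_cst M) (mxexp_cvg B s)); apply: nearW => N.
by rewrite mulmx_sumr; apply: eq_bigr => k _; rewrite -scalemxAr.
Qed.

Lemma mxexp_comm M B s : M *m B = B *m M ->
  M *m mxexp (s%:C *: B) = mxexp (s%:C *: B) *m M.
Proof.
move=> MB; have MBk k : M *m B ^+ k = B ^+ k *m M.
  elim: k => [|k ih]; first by rewrite !expr0 mulmx1 mul1mx.
  by rewrite exprS -mulmxE mulmxA MB -mulmxA ih mulmxA.
rewrite -mxexp_mulE; apply: (mxcvg_unique (F := \oo) (mxexp_mul_cvg M B s)).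
apply: mxcvg_near (mxcvgM (mxexp_cvg B s) (mxcvg_cst M)); apply: nearW => N.
by rewrite mulmx_suml; apply: eq_bigr => k _; rewrite -scalemxAl MBk.
Qed.

Lemma mxexp_deriv B s :
  has_deriv_on setT (fun x => mxexp (x%:C *: B)) s (B *m mxexp (s%:C *: B)).
Proof.
rewrite -mxexp_mulE; under eq_fun do rewrite mxexpE.
by have := mxexp_mul_deriv 1%:M B s; rewrite mul1mx.
Qed.

Lemma mxexp0 : mxexp (0 : 'M[R[i]]_n) = 1%:M.
Proof.
have e0 : (0 : R)%:C *: (0 : 'M[R[i]]_n) = 0 by rewrite scale0r.
have h := mxexp_cvg (0 : 'M[R[i]]_n) 0; rewrite e0 in h.
apply: (mxcvg_unique (F := \oo) h).
have c1 : mxcvg \oo (fun=> 1%:M : 'M[R[i]]_n) 1%:M by exact: mxcvg_cst.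
apply: mxcvg_near c1; near=> N; have N0 : (0 < N)%N by near: N; exact: nbhs_infty_gt.
rewrite big_ltn // big1_seq ?addr0 => [|k /andP[_]].
  by rewrite expr0 fact0 divr1 rmorph1 scale1r expr0.
by rewrite mem_index_iota => /andP[k0 _]; rewrite expr0n gtn_eqF // mul0r rmorph0 scale0r.
Unshelve. all: by end_near. Qed.

Lemma has_deriv_continuous_fiber (D : set R) m p (f df : R -> 'M[R[i]]_(m, p)) :
  (forall s, has_deriv_on setT f s (df s)) -> continuous_fiber D f.
Proof.
move=> fd s Ds; have h : has_deriv_on D f s (df s).
  apply: (has_deriv_on_sub _ (fd s)); apply: (@nearW _ (nbhs s)) => x _; exact: I.
exact: has_deriv_on_cvg h.
Qed.

(** The product is 1 at s = 0 and has derivative 0, since B commutes with its exponential. *)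
Lemma mxexpN B s : mxexp (s%:C *: B) *m mxexp (s%:C *: - B) = 1%:M.
Proof.
pose f x := mxexp (x%:C *: B) *m mxexp (x%:C *: - B).
have df x : has_deriv_on setT f x 0.
  have cancel (E E' : 'M[R[i]]_n) : B *m E = E *m B ->
      B *m E *m E' + E *m (- B *m E') = 0.
    by move=> c; rewrite mulNmx mulmxN c mulmxA subrr.
  rewrite -(cancel _ (mxexp (x%:C *: - B)) (@mxexp_comm B B x erefl)).
  exact: has_deriv_onM (mxexp_deriv B x) (mxexp_deriv (- B) x).
have f0 : f 0 = 1%:M by rewrite /f !scale0r mxexp0 mulmx1.
have cst a b : a <= b -> f b = f a.
  move=> ab; apply/eqP; rewrite -subr_eq0; apply/eqP/mxnorm0_eq0/eqP.
  rewrite eq_le mxnorm_ge0 andbT.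
  apply: (@le_trans _ _ (0 - 0)); last by rewrite subr0.
  apply: (@mxnorm_increment R n n f (fun=> 0) (fun=> 0) (fun=> 0) a b ab).
  - exact: has_deriv_continuous_fiber df.
  - exact: continuous_real_cst.
  - by move=> t _; exact: df.
  - by move=> t _; rewrite mxnorm0.
rewrite -/(f s) -f0; have [s0|/ltW s0] := leP 0 s; first exact: cst.
by rewrite (cst s 0).
Qed.

Lemma mxexp_unit B s : mxexp (s%:C *: B) \in unitmx.
Proof. exact: (mulmx1_unit (mxexpN B s)).1. Qed.

Lemma invmx_mxexp B s : invmx (mxexp (s%:C *: B)) = mxexp (s%:C *: - B).
Proof.
by rewrite -[LHS]mulmx1 -(mxexpN B s) mulKmx //; exact: mxexp_unit.
Qed.

Lemma mxnorm_exp_growth m p (Y dY : R -> 'M[R[i]]_(m, p)) (k s : R) : 0 <= s -> 0 <= k ->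
  (forall x, has_deriv_on setT Y x (dY x)) ->
  (forall x, mxnorm (dY x) <= k * mxnorm (Y x)) ->
  mxnorm (Y s) <= expR (k * s) * mxnorm (Y 0).
Proof.
move=> s0 k0 dYx le_dY.
rewrite -[X in _ <= _ * X]addr0 -[X in _ <= _ * (_ + X)](subrr 0).
apply: (@energy_forward R m p Y dY (fun x => k * x) (fun=> k * 1) (fun=> 0) (fun=> 0) 0 s).
- exact: s0.
- exact: has_deriv_continuous_fiber dYx.
- by move=> x _; apply: cvgM; [exact: cvg_cst|exact: cvg_within_filter].
- exact: continuous_real_cst.
- by move=> x _; exact: dYx.
- by move=> x _; rewrite mulr1.
- by [].
- by rewrite mulr0 subr0.
- move=> x _; rewrite mul0r addr0 mulr1 (le_trans (rdot_le _ _)) //.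
  by rewrite expr2 mulrA ler_wpM2r ?mxnorm_ge0.
Qed.

Lemma mxnorm_mxexp B s : 0 <= s ->
  mxnorm (mxexp (s%:C *: B)) <= expR (mxnorm B * s) * mxnorm (1%:M : 'M[R[i]]_n).
Proof.
move=> s0; have e0 : mxexp ((0 : R)%:C *: B) = 1%:M by rewrite scale0r mxexp0.
rewrite -e0.
apply: (@mxnorm_exp_growth _ _ (fun s => mxexp (s%:C *: B))) => //.
- exact: mxnorm_ge0.
- exact: mxexp_deriv.
- by move=> x; exact: mxnormM.
Qed.

(** ** Jordan matrices *)

Definition diag_of B : 'M[R[i]]_n := \matrix_(i, j) (if i == j then B i j else 0).

Lemma diag_mulE D M : (forall i j, i != j -> D i j = 0) ->
  (forall i j, (D *m M) i j = D i i * M i j) /\ (forall i j, (M *m D) i j = M i j * D j j).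
Proof.
move=> dD; split=> i j; rewrite mxE.
  rewrite (bigD1 i) //= big1 ?addr0 // => k; rewrite eq_sym => ki.
  by rewrite dD ?mul0r.
by rewrite (bigD1 j) //= big1 ?addr0 // => k kj; rewrite dD ?mulr0.
Qed.

Lemma diag_of_offdiag B i j : i != j -> diag_of B i j = 0.
Proof. by move=> ij; rewrite mxE (negbTE ij). Qed.

Lemma is_diag_offdiag D : is_diag_mx D -> forall i j, i != j -> D i j = 0.
Proof. by move=> /is_diag_mxP dD i j; exact: dD. Qed.

(** The entries 1 of the superdiagonal join equal diagonal entries. *)
Lemma jordan_comm_diag B : is_jordan B -> diag_of B *m B = B *m diag_of B.
Proof.
move=> JB; apply/matrixP => i j.
have [-> ->] : (diag_of B *m B) i j = B i i * B i j /\ (B *m diag_of B) i j = B i j * B j j.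
  have [h1 h2] := diag_mulE B (@diag_of_offdiag B).
  by rewrite h1 h2 !mxE !eqxx.
have [h1 h2] := JB i j.
have [->|ij] := eqVneq j i; first by rewrite mulrC.
have [/h2[->|[-> ->]]|ji1] := eqVneq (j : nat) i.+1.
- by rewrite mulr0 mul0r.
- by rewrite mulr1 mul1r.
- by rewrite h1 ?mulr0 ?mul0r.
Qed.

(** Conjugation by diag (e ^ i) multiplies the superdiagonal of a Jordan matrix by
    e and leaves diagonal matrices alone; hence the nilpotent part contributes an
    arbitrarily small exponential rate instead of a polynomial factor. *)
Lemma jordan_conj_growth (e : R) : 0 < e -> exists2 C : R, 0 <= C &
  forall B D s, is_jordan B -> is_diag_mx D -> 0 <= s ->
  mxnorm (mxexp (s%:C *: B) *m D *m mxexp (s%:C *: - B)) <= C * expR (e * s) * mxnorm D.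
Proof.
move=> e0; pose N1 : R := \sum_(i < n) \sum_(j < n) 1.
have N10 : 0 <= N1 by apply: sumr_ge0 => i _; apply: sumr_ge0.
(* N1 counts the entries; conjugation by S makes N at most d in each entry, hence
   smaller than e / 2 in norm, and N acts on both sides of X. *)
pose d := e / (2 * (N1 + 1)).
have d0 : 0 < d by rewrite divr_gt0 // mulr_gt0 // ltr_wpDl.
have dn0 k : (d ^+ k)%:C != 0.
  by rewrite (fmorph_eq0 (real_complex R)) expf_neq0 // gt_eqF.
pose S : 'M[R[i]]_n := \matrix_(i, j) (if i == j then (d ^+ i)%:C else 0).
pose S' : 'M[R[i]]_n := \matrix_(i, j) (if i == j then (d ^+ i)%:C^-1 else 0).
have Soff i j : i != j -> S i j = 0 by move=> ij; rewrite mxE (negbTE ij).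
have S'off i j : i != j -> S' i j = 0 by move=> ij; rewrite mxE (negbTE ij).
have SS' : S *m S' = 1%:M.
  apply/matrixP => i j; rewrite (diag_mulE S' Soff).1 !mxE eqxx.
  by case: eqP => [->|_]; rewrite ?mulr0 // mulfV.
have S'S : S' *m S = 1%:M by exact: mulmx1C.
exists (mxnorm S * mxnorm S'); first by rewrite mulr_ge0 ?mxnorm_ge0.
move=> B D s JB dD s0.
pose E x := mxexp (x%:C *: B); pose E' x := mxexp (x%:C *: - B).
pose X x := E x *m D *m E' x.
pose L := diag_of B; pose N := B - L.
have LB : L *m B = B *m L by exact: jordan_comm_diag.
have LB' : L *m - B = - B *m L by rewrite mulmxN mulNmx LB.
have LD : L *m D = D *m L.
  apply/matrixP => i j; rewrite (diag_mulE D (@diag_of_offdiag B)).1.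
  rewrite (diag_mulE D (@diag_of_offdiag B)).2.
  have [->|ij] := eqVneq i j; first by rewrite mulrC.
  by rewrite (is_diag_offdiag dD ij) mulr0 mul0r.
(* The diagonal part L of B commutes with D and with both exponentials, so that X is
   driven by N alone. *)
have LX x : L *m X x = X x *m L.
  rewrite /X !mulmxA (mxexp_comm x LB) -[_ *m D]mulmxA LD.
  by rewrite -!mulmxA (mxexp_comm x LB').
have dX x : has_deriv_on setT X x (N *m X x - X x *m N).
  have alg (P P' : 'M[R[i]]_n) : L *m (P *m D *m P') = P *m D *m P' *m L ->
      - B *m P' = P' *m - B ->
      N *m (P *m D *m P') - P *m D *m P' *m N =
      (B *m P *m D + P *m 0) *m P' + P *m D *m (- B *m P').
    move=> LP BP; rewrite mulmx0 addr0 BP /N mulmxBl mulmxBr LP opprB addrA subrK.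
    by rewrite !mulmxN !mulmxA.
  rewrite /X alg; [|exact: LX|exact: mxexp_comm].
  apply: has_deriv_onM; last exact: mxexp_deriv.
  by apply: has_deriv_onM; [exact: mxexp_deriv|exact: has_deriv_on_cst].
pose Nd := S' *m N *m S.
have Nd_norm : mxnorm Nd <= d * N1.
  apply: le_trans (mxnorm_le_sum _) _; rewrite mulr_sumr; apply: ler_sum => i _.
  rewrite mulr_sumr; apply: ler_sum => j _; rewrite mulr1.
  rewrite (diag_mulE _ Soff).2 (diag_mulE _ S'off).1 !mxE !eqxx.
  have [<-|ij] := eqVneq i j; first by rewrite subrr mulr0 mul0r normr0 addr0 ltW.
  rewrite subr0; have [h1 h2] := JB i j.
  have [ji|ji] := eqVneq (j : nat) i.+1; last first.
    by rewrite h1 ?mulr0 ?mul0r ?normr0 ?addr0 ?ltW // eq_sym.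
  have [->|[-> _]] := h2 ji; first by rewrite mulr0 mul0r normr0 addr0 ltW.
  have -> : (d ^+ i)%:C^-1 * 1 * (d ^+ j)%:C = d%:C.
    by rewrite ji exprS mulr1 rmorphM mulrCA mulVf // mulr1.
  rewrite /= normr0 addr0.
  by rewrite ger0_norm // ltW.
pose Y x := S' *m X x *m S.
have XY x : X x = S *m Y x *m S'.
  by rewrite /Y !mulmxA SS' mul1mx -mulmxA SS' mulmx1.
have dY x : has_deriv_on setT Y x (Nd *m Y x - Y x *m Nd).
  have alg (P : 'M[R[i]]_n) : Nd *m (S' *m P *m S) - S' *m P *m S *m Nd =
      (0 *m P + S' *m (N *m P - P *m N)) *m S + S' *m P *m 0.
    rewrite mul0mx add0r mulmx0 addr0 mulmxBr mulmxBl /Nd !mulmxA.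
    by rewrite -(mulmxA _ S S') SS' mulmx1 -(mulmxA _ S S') SS' mulmx1.
  rewrite /Y alg.
  by apply: has_deriv_onM; [apply: has_deriv_onM; [exact: has_deriv_on_cst|exact: dX]
    |exact: has_deriv_on_cst].
have Y0 : Y 0 = D.
  rewrite /Y /X /E /E' !scale0r mxexp0 mul1mx mulmx1.
  apply/matrixP => i j; rewrite (diag_mulE _ Soff).2 (diag_mulE _ S'off).1 !mxE !eqxx.
  have [<-|ij] := eqVneq i j; first by rewrite mulrAC mulVf // mul1r.
  by rewrite (is_diag_offdiag dD ij) mulr0 mul0r.
have bound (y : 'M[R[i]]_n) : mxnorm (Nd *m y - y *m Nd) <= e * mxnorm y.
  apply: le_trans (ler_mxnormB _ _) _.
  apply: (@le_trans _ _ (2 * (d * N1) * mxnorm y)).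
    have h1 := mxnormM Nd y; have h2 := mxnormM y Nd.
    have h3 := ler_wpM2r (mxnorm_ge0 y) Nd_norm; lra.
  rewrite ler_wpM2r ?mxnorm_ge0 // /d.
  rewrite (_ : _ * _ = e * (N1 / (N1 + 1))); last by field; rewrite gt_eqF // ltr_wpDl.
  by rewrite ler_piMr ?(ltW e0) // ler_pdivrMr ?ltr_wpDl // mul1r lerDl.
have := mxnorm_exp_growth s0 (ltW e0) dY (fun x => bound (Y x)).
rewrite Y0 -/(E s) -/(E' s) -/(X s) XY; move: (Y s) => y growth.
apply: (@le_trans _ _ (mxnorm S * mxnorm y * mxnorm S')).
  by apply: le_trans (mxnormM _ _) _; rewrite ler_wpM2r ?mxnorm_ge0 // mxnormM.
by rewrite [leLHS]mulrAC -[leRHS]mulrA ler_wpM2l ?mulr_ge0 ?mxnorm_ge0.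
Qed.

End MatrixExponential.

(** * Hermitian parts and extremal eigenvalues of blocks *)

Section Hermitian.
Variable R : realType.
Local Notation Re := complex.Re.
Local Notation Im := complex.Im.
Local Notation normc := ComplexField.Normc.normc.

Definition adjmx m p (A : 'M[R[i]]_(m, p)) : 'M[R[i]]_(p, m) := map_mx conjc A^T.

Lemma adjmxE m p (A : 'M[R[i]]_(m, p)) i j : adjmx A i j = conjc (A j i).
Proof. by rewrite !mxE. Qed.

Lemma adjmxM m n p (A : 'M[R[i]]_(m, n)) (B : 'M[R[i]]_(n, p)) :
  adjmx (A *m B) = adjmx B *m adjmx A.
Proof. by rewrite /adjmx trmx_mul map_mxM. Qed.

Lemma adjmxK m p (A : 'M[R[i]]_(m, p)) : adjmx (adjmx A) = A.
Proof. by apply/matrixP => i j; rewrite !adjmxE conjcK. Qed.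

Lemma rdot_trace m p (A B : 'M[R[i]]_(m, p)) : rdot A B = Re (\tr (adjmx B *m A)).
Proof.
rewrite /mxtrace complexRe_sum /rdot exchange_big /=; apply: eq_bigr => j _.
rewrite mxE complexRe_sum; apply: eq_bigr => i _.
by rewrite adjmxE; case: (A i j) (B i j) => a b [c d] /=; ring.
Qed.

Lemma rdot_adjmx m n p (A : 'M[R[i]]_(n, m)) (X : 'M[R[i]]_(n, p)) (Y : 'M[R[i]]_(m, p)) :
  rdot (adjmx A *m X) Y = rdot X (A *m Y).
Proof. by rewrite !rdot_trace adjmxM mulmxA. Qed.

Lemma mxnorm_adjmx m p (A : 'M[R[i]]_(m, p)) : mxnorm (adjmx A) = mxnorm A.
Proof.
rewrite /mxnorm exchange_big /=; congr Num.sqrt.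
apply: eq_bigr => i _; apply: eq_bigr => j _; rewrite adjmxE.
by case: (A _ _) => a b /=; rewrite sqrrN.
Qed.

Section Spectrum.
Variables (k : nat) (H : 'M[R[i]]_k).
Hypothesis hermH : adjmx H = H.

Definition real_spectrum : set R := [set x : R | eigenvalue H x%:C].

Lemma eigenvalue_rayleigh x : real_spectrum x ->
  exists2 v : 'cV[R[i]]_k, 0 < mxnorm v & rdot (H *m v) v = x * mxnorm v ^+ 2.
Proof.
move=> /eigenvalueP[u uH u0]; exists (adjmx u).
  rewrite lt_def mxnorm_ge0 andbT; apply/eqP => /mxnorm0_eq0 e.
  by move/eqP: u0; apply; rewrite -(adjmxK u) e; apply/matrixP => i j; rewrite adjmxE !mxE conjc0.
have -> : H *m adjmx u = x%:C *: adjmx u.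
  rewrite -{1}hermH -adjmxM uH; apply/matrixP => i j; rewrite !mxE.
  by rewrite rmorphM /= oppr0.
by rewrite rdotZl rdotxx.
Qed.

Lemma real_spectrum_bound x : real_spectrum x -> `|x| <= mxnorm H.
Proof.
move=> /eigenvalue_rayleigh[v v0 hv].
have h1 := rdot_le (H *m v) v; have h2 := rdot_le (- (H *m v)) v.
rewrite rdotNl mxnormN in h2; have h3 := mxnormM H v.
have h4 : mxnorm (H *m v) * mxnorm v <= mxnorm H * mxnorm v ^+ 2.
  by rewrite expr2 mulrA ler_wpM2r // mxnorm_ge0.
have v2 : 0 < mxnorm v ^+ 2 by rewrite exprn_gt0.
rewrite ler_norml -(ler_pM2r v2) -[X in _ && X](ler_pM2r v2) mulNr.
by apply/andP; split; lra.
Qed.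

(** The spectral theorem, with the eigenvalues as members of the set of real numbers over
    which the largest eigenvalue is a supremum. *)
Lemma hermitian_diagonalization :
  exists (P : 'M[R[i]]_k) (sp : 'I_k -> R), [/\ adjmx P *m P = 1%:M,
    P *m H = diag_mx (\row_i (sp i)%:C) *m P & forall i, real_spectrum (sp i)].
Proof.
have hH : H \is hermsymmx.
  by apply/is_hermitianmxP; rewrite expr0 scale1r -[LHS]hermH.
have /orthomx_spectralP HE := hermitian_normalmx hH.
have unitP := spectral_unit H; have uni := spectral_unitarymx H.
have real := hermitian_spectral_diag_real hH.
move: (spectralmx H) (spectral_diag H) HE unitP uni real => P D HE unitP uni real.
have PH : P *m H = diag_mx D *m P by rewrite HE !mulmxA (mulmxV unitP) mul1mx.
exists P, (fun i => Re (D ord0 i)).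
have e : diag_mx (\row_i (Re (D ord0 i))%:C) = diag_mx D.
  congr diag_mx; apply/rowP => i; rewrite mxE; apply: RRe_real.
  exact: (mxOverP real).
split; last 1 first.
- move=> i; apply/eigenvalueP; exists (row i P).
    by rewrite -row_mul PH -e; apply/rowP => j; rewrite mxE mul_diag_mx !mxE.
  apply/eqP => Pi0; have /matrixP /(_ i i) : P *m invmx P = 1%:M by rewrite mulmxV.
  have -> : (P *m invmx P) i i = (row i P *m invmx P) ord0 i by rewrite -row_mul [RHS]mxE.
  by rewrite Pi0 mul0mx !mxE eqxx => /esym /eqP; rewrite oner_eq0.
- by rewrite -(mulVmx unitP) (invmx_unitary uni).
- by rewrite e.
Qed.

Hypothesis k0 : (0 < k)%N.

Lemma real_spectrum_neq0 : real_spectrum !=set0.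
Proof.
have [P [sp [_ _ spH]]] := hermitian_diagonalization.
by exists (sp (Ordinal k0)).
Qed.

Lemma real_spectrum_has_sup : has_sup real_spectrum.
Proof.
split; first exact: real_spectrum_neq0.
by exists (mxnorm H) => x /real_spectrum_bound; apply: le_trans; exact: ler_norm.
Qed.

(** In an orthonormal basis of eigenvectors the quadratic form is a weighted sum of the
    eigenvalues. *)
Lemma rayleigh_le_max p (Y : 'M[R[i]]_(k, p)) :
  rdot (H *m Y) Y <= max_eigenvalue H * mxnorm Y ^+ 2.
Proof.
have [P [sp [PP PH spH]]] := hermitian_diagonalization.
have -> : H *m Y = adjmx P *m (diag_mx (\row_i (sp i)%:C) *m (P *m Y)).
  by rewrite [diag_mx _ *m _]mulmxA -PH !mulmxA PP mul1mx.
have -> : mxnorm Y ^+ 2 = mxnorm (P *m Y) ^+ 2.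
  by rewrite -!rdotxx -rdot_adjmx mulmxA PP mul1mx.
rewrite rdot_adjmx -rdotxx /rdot mulr_sumr; apply: ler_sum => i _.
rewrite mulr_sumr; apply: ler_sum => j _; rewrite mul_diag_mx !mxE complexReM complexImM /=.
set y := \sum_j _; rewrite !mul0r subr0 addr0 -!mulrA -mulrDr ler_wpM2r //.
  by rewrite addr_ge0 // -expr2 sqr_ge0.
by apply: ub_le_sup; [exact: real_spectrum_has_sup.2|exact: spH].
Qed.

Lemma max_eigenvalue_bound : `|max_eigenvalue H| <= mxnorm H.
Proof.
have [x Hx] := real_spectrum_neq0; have := real_spectrum_bound Hx.
rewrite !ler_norml => /andP[h _]; apply/andP; split.
  by rewrite (le_trans h) // ub_le_sup //; exact: real_spectrum_has_sup.2.
apply: ge_sup; first exact: real_spectrum_neq0.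
by move=> y /real_spectrum_bound; apply: le_trans; exact: ler_norm.
Qed.

End Spectrum.

(** Weyl's inequality: on an eigenvector of H the forms of H and H' differ by at most
    |H - H'|, and the form of H' is at most its largest eigenvalue. *)
Lemma max_eigenvalue_lipschitz k (H H' : 'M[R[i]]_k) : (0 < k)%N ->
  adjmx H = H -> adjmx H' = H' -> max_eigenvalue H <= max_eigenvalue H' + mxnorm (H - H').
Proof.
move=> k0 hH hH'; apply: ge_sup; first exact: real_spectrum_neq0.
move=> x /(eigenvalue_rayleigh hH)[v v0 hv].
have v2 : 0 < mxnorm v ^+ 2 by rewrite exprn_gt0.
rewrite -(ler_pM2r v2) -hv.
have -> : H *m v = H' *m v + (H - H') *m v by rewrite -mulmxDl addrC subrK.
rewrite rdotDl mulrDl lerD // ?rayleigh_le_max //.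
rewrite (le_trans (rdot_le _ _)) // expr2 mulrA ler_wpM2r ?mxnorm_ge0 //.
exact: mxnormM.
Qed.

Lemma min_eigenvalueN k (H : 'M[R[i]]_k) : min_eigenvalue H = - max_eigenvalue (- H).
Proof.
rewrite /min_eigenvalue /max_eigenvalue /inf; congr (- sup _); apply/seteqP.
have opp (M : 'M[R[i]]_k) (x : R) : eigenvalue M x%:C -> eigenvalue (- M) (- x)%:C.
  move=> /eigenvalueP[v vM v0]; apply/eigenvalueP; exists v => //.
  by rewrite mulmxN vM rmorphN scaleNr.
split=> [_ [x Hx <-]|x Hx]; first exact: opp.
exists (- x); last exact: opprK.
have := opp _ _ Hx; rewrite (opprK H); exact.
Qed.

Section Blocks.
Variables (n : nat) (G : {set {set 'I_n}}).
Hypothesis partG : finset.partition G (finset.setTfor 'I_n).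
Implicit Types (W : 'M[R[i]]_n) (i j : 'I_n).

Lemma same_block_sym i j : same_block G i j = same_block G j i.
Proof. by rewrite /same_block eq_sym. Qed.

Lemma mem_own_block i : i \in finset.pblock G i.
Proof.
have [/eqP covG _ _] := and3P partG.
by rewrite finset.mem_pblock covG finset.in_setT.
Qed.

Lemma mem_block_same (s : {set 'I_n}) i j : s \in G -> i \in s ->
  (j \in s) = same_block G i j.
Proof.
move=> sG is_; have [_ trivG _] := and3P partG.
have <- := finset.def_pblock trivG sG is_.
rewrite /same_block; apply/idP/eqP => [js|->]; last exact: mem_own_block.
by rewrite (finset.same_pblock trivG js).
Qed.

Lemma sum_by_blocks (g : 'I_n -> R) :
  \sum_i g i = \sum_(s in G) \sum_(k < #|s|) g (enum_val k).
Proof.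
have [/eqP covG trivG _] := and3P partG.
transitivity (\sum_(i in finset.cover G) g i).
  by apply: eq_bigl => i; rewrite covG finset.in_setT.
rewrite finset.big_trivIset //; apply: eq_bigr => s _.
by rewrite [LHS]big_enum_val.
Qed.

Definition block_rows (s : {set 'I_n}) p (Y : 'M[R[i]]_(n, p)) : 'M[R[i]]_(#|s|, p) :=
  \matrix_(k, c) Y (enum_val k) c.

Lemma block_rows_mul s W p (Y : 'M[R[i]]_(n, p)) : is_Gdiag G W -> s \in G ->
  block_rows s (W *m Y) = block_mx_of s W *m block_rows s Y.
Proof.
move=> dW sG; apply/matrixP => k c; rewrite !mxE.
rewrite (bigID (mem s)) /= [X in _ + X]big1 ?addr0; last first.
  move=> j js; rewrite dW ?mul0r // -(mem_block_same j sG) //; exact: enum_valP.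
rewrite big_enum_val; apply: eq_bigr => l _; by rewrite !mxE.
Qed.

Lemma rdot_by_blocks p (X Y : 'M[R[i]]_(n, p)) :
  rdot X Y = \sum_(s in G) rdot (block_rows s X) (block_rows s Y).
Proof.
rewrite /rdot sum_by_blocks; apply: eq_bigr => s _; apply: eq_bigr => k _.
by apply: eq_bigr => c _; rewrite !mxE.
Qed.

Lemma half_complex : 2^-1 = (2^-1 : R)%:C :> R[i].
Proof. by rewrite fmorphV rmorph_nat. Qed.

Lemma adjmx_herm_part W : adjmx (herm_part W) = herm_part W.
Proof.
apply/matrixP => i j; by rewrite adjmxE !mxE half_complex rmorphM rmorphD /= conjcK oppr0 addrC.
Qed.

Lemma mxnorm_herm_part W : mxnorm (herm_part W) <= mxnorm W.
Proof.
rewrite /herm_part half_complex mxnormZr ger0_norm ?invr_ge0 //.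
have := ler_mxnormD W (adjmx W); rewrite mxnorm_adjmx -/(adjmx W); lra.
Qed.

Lemma herm_partB W W' : herm_part (W - W') = herm_part W - herm_part W'.
Proof.
rewrite /herm_part -scalerBr linearB /= map_mxB; congr (_ *: _).
by rewrite opprD addrACA.
Qed.

Lemma rdot_herm_part W p (Y : 'M[R[i]]_(n, p)) :
  rdot (herm_part W *m Y) Y = rdot (W *m Y) Y.
Proof.
rewrite /herm_part half_complex -scalemxAl rdotZl mulmxDl rdotDl -/(adjmx W).
by rewrite rdot_adjmx (rdotC Y); lra.
Qed.

Lemma herm_part_Gdiag W : is_Gdiag G W -> is_Gdiag G (herm_part W).
Proof.
move=> dW i j ij; rewrite !mxE !dW ?conjc0 ?addr0 ?mulr0 //.
by rewrite same_block_sym.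
Qed.

Lemma block_mx_of_herm s W : adjmx (block_mx_of s (herm_part W)) = block_mx_of s (herm_part W).
Proof.
apply/matrixP => i j; rewrite adjmxE ![block_mx_of _ _ _ _]mxE.
by rewrite -adjmxE adjmx_herm_part.
Qed.

Lemma mxnorm_block_mx_of s W : mxnorm (block_mx_of s W) <= mxnorm W.
Proof.
rewrite /mxnorm ler_wsqrtr //.
have le_sub (g : 'I_n -> R) : (forall i, 0 <= g i) -> \sum_(k < #|s|) g (enum_val k) <= \sum_i g i.
  move=> g0; rewrite -[leLHS](big_enum_val g) [leRHS](bigID (mem s)) /= lerDl.
  by apply: sumr_ge0.
apply: (le_trans _ (le_sub (fun i => \sum_j normc (W i j) ^+ 2) _)); last first.
  by move=> i; apply: sumr_ge0 => j _; exact: sqr_ge0.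
apply: ler_sum => k _; under eq_bigr do rewrite mxE.
by apply: (le_sub (fun j => normc (W (enum_val k) j) ^+ 2)) => j; exact: sqr_ge0.
Qed.

Lemma card_block_gt0 i : (0 < #|finset.pblock G i|)%N.
Proof. by apply/card_gt0P; exists i; exact: mem_own_block. Qed.

Lemma extremal_entryN W i :
  extremal_entry false G W i = - extremal_entry true G (- W) i.
Proof.
rewrite /extremal_entry min_eigenvalueN; congr (- max_eigenvalue _).
apply/matrixP => k l; rewrite !mxE rmorphN -mulrN opprD //.
Qed.

Lemma extremal_entry_block b W i j : same_block G i j ->
  extremal_entry b G W i = extremal_entry b G W j.
Proof. by rewrite /extremal_entry => /eqP ->. Qed.

Lemma extremal_entry_bound b W i : `|extremal_entry b G W i| <= mxnorm W.
Proof.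
suff h (W' : 'M[R[i]]_n) : `|extremal_entry true G W' i| <= mxnorm W'.
  by case: b => //; rewrite extremal_entryN normrN (le_trans (h _)) // mxnormN.
apply: le_trans (max_eigenvalue_bound _ _) _; [exact: block_mx_of_herm|exact: card_block_gt0|].
exact: le_trans (mxnorm_block_mx_of _ _) (mxnorm_herm_part _).
Qed.

(** Makes the extremal eigenvalues continuous in time, and thus the exponents b of zone H
    differentiable. *)
Lemma extremal_entry_lipschitz b W W' i :
  `|extremal_entry b G W i - extremal_entry b G W' i| <= mxnorm (W - W').
Proof.
have half (V V' : 'M[R[i]]_n) : extremal_entry true G V i <= extremal_entry true G V' i + mxnorm (V - V').
  rewrite /extremal_entry /=.
  apply: le_trans (max_eigenvalue_lipschitz (card_block_gt0 i) (block_mx_of_herm _ V)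
    (block_mx_of_herm _ V')) _.
  rewrite lerD2l; apply: le_trans (mxnorm_herm_part (V - V')); rewrite herm_partB.
  apply: le_trans (mxnorm_block_mx_of (finset.pblock G i) (herm_part V - herm_part V')).
  by rewrite le_eqVlt; apply/orP; left; apply/eqP; congr mxnorm; apply/matrixP => k l; rewrite !mxE.
have full (V V' : 'M[R[i]]_n) : `|extremal_entry true G V i - extremal_entry true G V' i| <= mxnorm (V - V').
  move: (half V V') (half V' V); rewrite (mxnormB V').
  move: (extremal_entry _ _ V i) (extremal_entry _ _ V' i) (mxnorm _) => x y z h1 h2.
  by rewrite ler_norml; apply/andP; split; lra.
case: b; first exact: full.
rewrite !extremal_entryN -opprD normrN (le_trans (full _ _)) //.
by rewrite -opprD mxnormN.
Qed.

(** The Rayleigh bound in each block.  It is the reason why W_+ controls growth forward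
    in time, and why W_- controls it backward. *)
Lemma rdot_Gdiag_le W p (Y : 'M[R[i]]_(n, p)) : is_Gdiag G W ->
  rdot (W *m Y) Y <= rdot (diag_mx (\row_i (extremal_entry true G W i)%:C) *m Y) Y.
Proof.
move=> dW; rewrite -rdot_herm_part !rdot_by_blocks; apply: ler_sum => s sG.
rewrite block_rows_mul //; last exact: herm_part_Gdiag.
have [_ trivG nset0] := and3P partG.
have s0 : (0 < #|s|)%N.
  by rewrite card_gt0; apply: contraNneq nset0 => <-.
apply: le_trans (rayleigh_le_max (block_mx_of_herm s W) s0 _) _.
rewrite -rdotxx /rdot mulr_sumr; apply: ler_sum => k _.
rewrite mulr_sumr; apply: ler_sum => c _; rewrite mxE [in leRHS]mxE mul_diag_mx !mxE.
rewrite /extremal_entry (finset.def_pblock trivG sG (enum_valP k)).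
by rewrite complexReM complexImM /= !mul0r subr0 addr0 -!mulrA -mulrDr.
Qed.

Lemma rdot_Gdiag_ge W p (Y : 'M[R[i]]_(n, p)) : is_Gdiag G W ->
  rdot (diag_mx (\row_i (extremal_entry false G W i)%:C) *m Y) Y <= rdot (W *m Y) Y.
Proof.
move=> dW; have dNW : is_Gdiag G (- W) by move=> i j ij; rewrite mxE dW ?oppr0.
have := rdot_Gdiag_le Y dNW; rewrite mulNmx rdotNl lerNl -rdotNl -mulNmx.
set D := - diag_mx _; have -> // : D = diag_mx (\row_i (extremal_entry false G W i)%:C).
by apply/matrixP => i j; rewrite !mxE extremal_entryN rmorphN mulNrn.
Qed.

Lemma Gdiag_part_Gdiag W : is_Gdiag G (Gdiag_part G W).
Proof. by move=> i j ij; rewrite mxE (negbTE ij). Qed.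

Lemma mxnorm_Gdiag_part W : mxnorm (Gdiag_part G W) <= mxnorm W.
Proof.
rewrite /mxnorm ler_wsqrtr //; apply: ler_sum => i _; apply: ler_sum => j _.
by rewrite mxE; case: ifP => // _; rewrite ComplexField.Normc.normc0 expr0n sqr_ge0.
Qed.

Lemma Gdiag_partB W W' : Gdiag_part G (W - W') = Gdiag_part G W - Gdiag_part G W'.
Proof. by apply/matrixP => i j; rewrite !mxE; case: ifP; rewrite ?subr0. Qed.

Lemma Gdiag_partD W W' : Gdiag_part G (W + W') = Gdiag_part G W + Gdiag_part G W'.
Proof. by apply/matrixP => i j; rewrite !mxE; case: ifP; rewrite ?addr0. Qed.

Lemma Gdiag_partZ c W : Gdiag_part G (c *: W) = c *: Gdiag_part G W.
Proof. by apply/matrixP => i j; rewrite !mxE; case: ifP; rewrite ?mulr0. Qed.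

Lemma Gdiag_comm (e : 'I_n -> R[i]) W : (forall i j, same_block G i j -> e i = e j) ->
  is_Gdiag G W -> diag_mx (\row_i e i) *m W = W *m diag_mx (\row_i e i).
Proof.
move=> eG dW; apply/matrixP => i j; rewrite mul_diag_mx mul_mx_diag !mxE.
have [/eG ->|ij] := boolP (same_block G i j); first by rewrite mulrC.
by rewrite dW // mul0r mulr0.
Qed.

End Blocks.
End Hermitian.

(** * Fibres of the zones *)

Section ZoneFacts.
Variables (R : realType) (d : nat).
Implicit Types (xi : 'rV[R]_d) (ell : 'I_d -> R) (V : set (R * 'rV[R]_d)) (T rho t : R).

Lemma abracket_ge1 ell xi : 1 <= abracket ell xi.
Proof. exact: bigmax_ge_id. Qed.

Lemma abracket_gt0 ell xi : 0 < abracket ell xi.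
Proof. exact: lt_le_trans ltr01 (abracket_ge1 ell xi). Qed.

Definition fiber V xi : set R := [set s | V (s, xi)].

Lemma continuous_on_fiber m p V (f : R -> 'rV[R]_d -> 'M[R[i]]_(m, p)) xi :
  continuous_on V f -> continuous_fiber (fiber V xi) (f ^~ xi).
Proof.
move=> cf t Vt.
have pair : (s, xi) @[s --> nbhs t] --> (nbhs t, nbhs xi).
  by apply: cvg_pair; [exact: cvg_id|exact: cvg_cst].
suff h : (s, xi) @[s --> within (fiber V xi) (nbhs t)] --> within V (nbhs (t, xi)).
  exact: cvg_comp h (cf (t, xi) Vt).
move=> P VP; have {}VP : nbhs (t, xi) (fun r => V r -> P r) by [].
have h : nbhs t (fun s => V (s, xi) -> P (s, xi)).
  by move: (pair _ VP).
exact: h.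
Qed.

Section Symbols.
Variables (ell : 'I_d -> R) (n : nat) (V : set (R * 'rV[R]_d)) (w : R -> R).
Variable f : R -> 'rV[R]_d -> 'M[R[i]]_n.
Hypothesis symb_f : symbol_class ell V w f.

Lemma symbol_continuous xi : continuous_fiber (fiber V xi) (f ^~ xi).
Proof. by apply: continuous_on_fiber; exact: symb_f.1. Qed.

Lemma symbol_bound : exists2 C : R, 0 <= C &
  forall t xi, V (t, xi) -> mxnorm (f t xi) <= C * `|w (zvar ell t xi)|.
Proof.
have [_ [g [g0 _ gC]]] := symb_f; have [C hC] := gC 0%N.
exists `|C| => // t xi Vt; rewrite -g0 // (le_trans (hC _ _ Vt)) //.
by rewrite -normrM ler_norm.
Qed.

Lemma symbol_deriv : exists df : R -> 'rV[R]_d -> 'M[R[i]]_n,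
  is_dt V f df /\
  forall xi, (forall t, fiber V xi t -> 0 < t) -> continuous_fiber (fiber V xi) (df ^~ xi).
Proof.
have [_ [g [g0 gd _]]] := symb_f.
exists (fun t xi => (t^-1)%:C *: g 1%N t xi); split.
  move=> t xi Vt; apply: has_deriv_on_near (gd 0%N _ _ Vt); last exact: g0.
  by near=> s; apply: g0; near: s; exact: withinT.
move=> xi pos t Vt; apply: mxcvgZ; last exact: has_deriv_on_cvg (gd 1%N _ _ Vt).
apply: cvg_within_filter; apply: cvgV; last exact: cvg_id.
by rewrite gt_eqF // pos.
Unshelve. all: by end_near. Qed.

End Symbols.

Section Fibers.
Variables (T : R) (ell : 'I_d -> R) (xi : 'rV[R]_d).
Local Notation ab := (abracket ell xi).

Lemma fiber_zoneP rho t : fiber (zoneP T ell rho) xi t <-> 0 < t <= T /\ ab * t <= rho.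
Proof. by []. Qed.

Lemma fiber_zoneH rho t : fiber (zoneH T ell rho) xi t <-> 0 < t <= T /\ rho^-1 <= ab * t.
Proof. by []. Qed.

Lemma nbhs_zoneP rho t : 0 < t < T -> ab * t < rho -> nbhs t (fiber (zoneP T ell rho) xi).
Proof.
move=> /andP[t0 tT] trho; have h : t < Num.min T (rho / ab).
  by rewrite lt_min tT ltr_pdivlMr ?abracket_gt0 // mulrC.
have tin : t \in `]0, Num.min T (rho / ab)[ by rewrite in_itv /= t0.
apply: (@filterS _ (nbhs t) _ _ _ _ (near_in_itvoo tin)) => s; rewrite in_itv /= lt_min.
move=> /andP[s0 /andP[sT srho]]; apply/fiber_zoneP; rewrite s0 ltW //; split => //.
by rewrite mulrC -ler_pdivlMr ?abracket_gt0 // ltW.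
Qed.

Lemma nbhs_zoneH rho t : 0 < rho -> 0 < t < T -> rho^-1 < ab * t ->
  nbhs t (fiber (zoneH T ell rho) xi).
Proof.
move=> rho0 /andP[t0 tT] trho; have h : rho^-1 / ab < t.
  by rewrite ltr_pdivrMr ?abracket_gt0 // mulrC.
have tin : t \in `](rho^-1 / ab), T[ by rewrite in_itv /= h.
apply: (@filterS _ (nbhs t) _ _ _ _ (near_in_itvoo tin)) => s; rewrite in_itv /=.
move=> /andP[s0 sT]; apply/fiber_zoneH; split.
  by rewrite ltW // andbT (lt_trans _ s0) // divr_gt0 ?invr_gt0 ?abracket_gt0.
by rewrite mulrC -ler_pdivrMr ?abracket_gt0 // ltW.
Qed.

(** Uniqueness of derivatives along D at t needs D to accumulate at t; an interval on the
    left suffices, which includes the case t = T. *)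
Lemma proper_left_fiber (D : set R) t c : c < t -> (forall s, c < s < t -> D s) ->
  ProperFilter (within D t^').
Proof.
move=> ct cD; apply: Build_ProperFilter_ex => P.
move=> DP; have {}DP : nbhs t (fun s => s != t -> D s -> P s) by [].
have := DP; rewrite -nbhs_ballE => -[e /= e0 be].
pose s := t - Num.min (e / 2) ((t - c) / 2).
have m0 : 0 < Num.min (e / 2) ((t - c) / 2) by rewrite lt_min !divr_gt0 // subr_gt0.
have st : s < t by rewrite /s gtrBl.
exists s; apply: be.
- rewrite /ball /= /s opprB addrC subrK gtr0_norm //.
  by rewrite gt_min; apply/orP; left; rewrite ltr_pdivrMr // ltr_pMr // ltr1n.
- by rewrite lt_eqF.
- apply: cD; rewrite st andbT /s ltrBrDl -ltrBrDr gt_min; apply/orP; right.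
  by rewrite ltr_pdivrMr // ltr_pMr ?subr_gt0 // ltr1n.
Qed.

End Fibers.

Lemma conj_solve n (M A dM X : 'M[R[i]]_n) : M \in unitmx ->
  M *m A *m invmx M + dM *m invmx M = X -> M *m A + dM = X *m M.
Proof. by move=> uM <-; rewrite mulmxDl !mulmxKV. Qed.

Section ContinuityOfA.
Variables (T : R) (ell : 'I_d -> R) (rhos : R) (n : nat).
Variables (A M X : R -> 'rV[R]_d -> 'M[R[i]]_n).

Definition left_approachable (D : set R) s : Prop :=
  D s /\ exists2 c, c < s & forall s', c < s' < s -> D s'.

(** The derivative of M in the conjugation identity is a priori an arbitrary witness.
    Where derivatives along the fibre are unique it is the continuous one of the symbol
    class, and A is a continuous function of M, this derivative and X. *)
Lemma conj_continuous_at V xi t : (forall s, fiber V xi s -> 0 < s) ->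
  (\forall s \near within `]0, T] (nbhs t), left_approachable (fiber V xi) s) ->
  left_approachable (fiber V xi) t ->
  invertible_symbol ell V M -> continuous_fiber (fiber V xi) (X ^~ xi) ->
  conjugates_to V A M X ->
  mxcvg (within `]0, T] (nbhs t)) (A ^~ xi) (A t xi).
Proof.
move=> pos nearV Vt [uM sM sM'] cX [dM dMV MA].
have [dM2 [dM2V cdM2]] := symbol_deriv sM.
pose f s := invmx (M s xi) *m (X s xi *m M s xi - dM2 s xi).
have Af s : left_approachable (fiber V xi) s -> A s xi = f s.
  move=> [Vs [c' c's h]]; have e : dM s xi = dM2 s xi.
    have pf := proper_left_fiber c's h.
    exact: has_deriv_on_unique pf (dMV _ _ Vs) (dM2V _ _ Vs).
  by rewrite /f -(conj_solve (uM _ _ Vs) (MA _ _ Vs)) e addrK mulKmx // uM.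
rewrite (Af t Vt).
have cf : mxcvg (within (fiber V xi) (nbhs t)) f (f t).
  have [Vt' _] := Vt.
  apply: mxcvgM; first exact: (symbol_continuous sM').
  apply: mxcvgB; last exact: cdM2.
  by apply: mxcvgM; [exact: cX|exact: (symbol_continuous sM)].
have cf' : mxcvg (within `]0, T] (nbhs t)) f (f t).
  apply: mxcvg_sub cf => P VP.
  have {}VP : nbhs t (fun s => fiber V xi s -> P s) by [].
  have nV : nbhs t (fun s => `]0, T]%classic s -> left_approachable (fiber V xi) s) by [].
  suff : nbhs t (fun s => `]0, T]%classic s -> P s) by [].
  by apply: filterS2 VP nV => s h1 h2 /h2[Vs _]; exact: h1.
by apply: mxcvg_near cf'; apply: filterS nearV => s /Af ->.
Qed.

End ContinuityOfA.

End ZoneFacts.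

(** * Weights and gauges *)

Section Weights.
Variable R : realType.
Implicit Types (z t e : R).

Lemma powR_expR z e : 0 < z -> z `^ e = expR (e * ln z).
Proof. by move=> z0; rewrite /powR gt_eqF. Qed.

Lemma powR_addr z e e' : 0 < z -> z `^ (e + e') = z `^ e * z `^ e'.
Proof. by move=> z0; rewrite !powR_expR // -expRD mulrDl. Qed.

(** All remainders have the form c t^-1 (ab t)^e.  The primitive given here is bounded in
    zone P if e > 0, and in zone H if e < 0, by constants that do not involve ab. *)
Lemma is_derive_powR_scaled ab (c e t : R) : 0 < ab -> 0 < t -> e != 0 ->
  is_derive t 1 (fun s => c / e * (ab * s) `^ e) (c * (t^-1 * (ab * t) `^ e)).
Proof.
move=> ab0 t0 e0; have abt : 0 < ab * t by rewrite mulr_gt0.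
have near0 : \forall s \near t, c / e * expR (e * (ln ab + ln s)) = c / e * (ab * s) `^ e.
  apply: (@filterS _ (nbhs t) _ _ _ _ (lt_nbhsr t0)) => s s0.
  by rewrite powR_expR ?mulr_gt0 // lnM.
apply: near_eq_is_derive near0 _.
have d1 : is_derive t 1 (fun s => e * (ln ab + ln s)) (e * (0 + t^-1)).
  by apply: is_derive_scale; apply: is_derive_add; exact: is_derive1_ln.
have := is_derive_scale (is_derive_comp d1 (is_derive_expR _)) (c / e).
move=> /is_derive_eq; apply; rewrite powR_expR // lnM //.
by rewrite add0r; move: (expR _) => x; field; rewrite e0 gt_eqF.
Qed.

(** With x = - ln z and h = e / (p + 1) this is 1 + x <= (1 + 1 / h) exp (h x), raised to
    the power p. *)
Lemma log_power_bound (e : R) (p : nat) : 0 < e -> exists2 C : R, 0 <= C &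
  forall z, 0 < z <= 1 -> (1 + `|ln z|) ^+ p <= C * z `^ (- e).
Proof.
move=> e0; pose h := e / p.+1%:R; have h0 : 0 < h by rewrite divr_gt0.
exists ((1 + h^-1) ^+ p); first by rewrite exprn_ge0 // addr_ge0 // invr_ge0 ltW.
move=> z /andP[z0 z1]; have lz : ln z <= 0 by exact: ln_le0.
rewrite powR_expR // ler0_norm // mulNr -mulrN.
pose x := - ln z; rewrite -/x; have x0 : 0 <= x by rewrite oppr_ge0.
have b1 : 1 + x <= (1 + h^-1) * expR (h * x).
  have g1 := expR_ge1Dx (h * x).
  have g2 : 1 + x <= (1 + h^-1) * (1 + h * x).
    rewrite mulrDl mul1r mulrDr mulr1 mulKf ?gt_eqF //.
    have := mulr_ge0 (ltW h0) x0; have : 0 <= h^-1 by rewrite invr_ge0 ltW.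
    lra.
  apply: le_trans g2 _; rewrite ler_wpM2l // addr_ge0 // invr_ge0 ltW //.
apply: (@le_trans _ _ (((1 + h^-1) * expR (h * x)) ^+ p)).
  by rewrite lerXn2r // nnegrE ?addr_ge0 // (le_trans _ b1) // addr_ge0.
rewrite exprMn ler_wpM2l ?exprn_ge0 ?addr_ge0 ?invr_ge0 ?(ltW h0) //.
rewrite -expRM_natl ler_expR mulrA ler_wpM2r //.
rewrite /h mulrCA -[leRHS]mulr1 ler_wpM2l ?(ltW e0) //.
by rewrite ler_pdivrMr // mul1r ler_nat.
Qed.

End Weights.

Section SymbolBounds.
Variables (R : realType) (d n : nat) (ell : 'I_d -> R) (V : set (R * 'rV[R]_d)).
Implicit Type f : R -> 'rV[R]_d -> 'M[R[i]]_n.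

Lemma symbS_bound a f : (forall t xi, V (t, xi) -> 0 < zvar ell t xi) -> symbS ell V a f ->
  exists2 C : R, 0 <= C & forall t xi, V (t, xi) -> mxnorm (f t xi) <= C * zvar ell t xi `^ a.
Proof.
move=> V0 /symbol_bound[C C0 hC]; exists C => // t xi Vt.
by rewrite (le_trans (hC _ _ Vt)) // ger0_norm ?powR_ge0.
Qed.

(** Logarithms cost an arbitrarily small power of z. *)
Lemma symbSlog_bound a a' f : (forall t xi, V (t, xi) -> 0 < zvar ell t xi <= 1) -> a' < a ->
  symbSlog ell V a f -> exists2 C : R, 0 <= C &
  forall t xi, V (t, xi) -> mxnorm (f t xi) <= C * zvar ell t xi `^ a'.
Proof.
move=> V0 aa [p /symbol_bound[C C0 hC]].
have [C' C'0 hC'] : exists2 C' : R, 0 <= C' &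
    forall z, 0 < z <= 1 -> (1 + `|ln z|) ^+ p <= C' * z `^ (- (a - a')).
  by apply: log_power_bound; rewrite subr_gt0.
exists (C * C') => [|t xi Vt]; first exact: mulr_ge0.
have zV := V0 _ _ Vt; have [z0 _] := andP zV.
rewrite (le_trans (hC _ _ Vt)) // -mulrA ler_wpM2l //.
rewrite ger0_norm ?mulr_ge0 ?powR_ge0 ?exprn_ge0 ?addr_ge0 //.
have -> : a' = a - (a - a') by rewrite opprB addrC subrK.
rewrite powR_addr // mulrCA ler_wpM2l ?powR_ge0 //; exact: hC'.
Qed.

End SymbolBounds.

Section Gauge.
Variables (R : realType) (n : nat).

(** For dU = A U + F this says d(G U) = S (G U) + G F. *)
Definition gauge_rate (G A : R -> 'M[R[i]]_n) (t : R) (S : 'M[R[i]]_n) : Prop :=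
  exists2 dG, has_deriv_on setT G t dG & dG + G t *m A t = S *m G t.

Lemma gauge_rate_solution (G A : R -> 'M[R[i]]_n) t S p (U F : R -> 'M[R[i]]_(n, p)) :
  gauge_rate G A t S -> has_deriv_on setT U t (A t *m U t + F t) ->
  has_deriv_on setT (fun s => G s *m U s) t (S *m (G t *m U t) + G t *m F t).
Proof.
move=> [dG hG GA] hU; have := has_deriv_onM hG hU.
by rewrite mulmxDr !mulmxA addrA -mulmxDl GA.
Qed.

(** The renormalization identity says that dQ + Q X = S Q, where X is the coefficient of
    the equation for M U, and S the one claimed for Q M U. *)
Lemma gauge_rate_renorm (ab : R) (M Q A : R -> 'M[R[i]]_n) t dM dQ (P0 P1 D Rm : 'M[R[i]]_n) :
  0 < ab -> M t \in unitmx -> Q t \in unitmx ->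
  has_deriv_on setT M t dM -> has_deriv_on setT Q t dQ ->
  M t *m A t *m invmx (M t) + dM *m invmx (M t) = ab%:C *: (P0 + P1) ->
  Rm = (ab^-1)%:C *: dQ + Q t *m (P0 + P1) - (P0 + D) *m Q t ->
  gauge_rate (fun s => Q s *m M s) A t (ab%:C *: (P0 + D + Rm *m invmx (Q t))).
Proof.
move=> ab0 uM uQ hM hQ MA ->; exists (dQ *m M t + Q t *m dM); first exact: has_deriv_onM.
rewrite -addrA -mulmxA -mulmxDr [dM + _]addrC (conj_solve uM MA).
rewrite mulmxA [RHS]mulmxA -mulmxDl; congr (_ *m _).
rewrite -!scalemxAl mulmxDl mulmxKV // [(P0 + D) *m _ + _]addrC subrK.
by rewrite [RHS]scalerDr scalerA -rmorphM mulfV ?gt_eqF // scale1r -scalemxAr.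
Qed.

Lemma gauge_rate_left (G A E : R -> 'M[R[i]]_n) t dE S : E t \in unitmx ->
  has_deriv_on setT E t dE -> gauge_rate G A t S ->
  gauge_rate (fun s => E s *m G s) A t (dE *m invmx (E t) + E t *m S *m invmx (E t)).
Proof.
move=> uE hE [dG hG GA]; exists (dE *m G t + E t *m dG); first exact: has_deriv_onM.
rewrite -addrA -mulmxA -mulmxDr GA mulmxDl !mulmxA.
by rewrite !mulmxKV.
Qed.

(** The energy identity for G U sees only the quadratic form of S, and this from one
    side only for each direction of time. *)
Lemma gauge_estimate (plus : bool) (G A S : R -> 'M[R[i]]_n) (U F : R -> 'cV[R[i]]_n)
    (K kappa : R -> R) a b c : a <= b ->
  continuous_fiber `[a, b] G -> continuous_fiber `[a, b] U -> continuous_fiber `[a, b] F ->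
  (forall t, a < t < b -> has_deriv_on setT U t (A t *m U t + F t)) ->
  (forall t, a < t < b -> gauge_rate G A t (S t)) ->
  continuous_real `[a, b] K -> (forall t, a < t < b -> is_derive t 1 K (kappa t)) ->
  (forall t, a < t < b -> 0 <= kappa t) -> K b - K a <= c ->
  (forall t, a < t < b -> forall y : 'cV[R[i]]_n,
     (if plus then rdot (S t *m y) y else - rdot (S t *m y) y) <= kappa t * mxnorm y ^+ 2) ->
  let I := \int[lebesgue_measure]_(x in `[a, b]) mxnorm (G x *m F x) in
  if plus then mxnorm (G b *m U b) <= expR c * (mxnorm (G a *m U a) + I)
  else mxnorm (G a *m U a) <= expR c * (mxnorm (G b *m U b) + I).
Proof.
move=> ab cG cU cF dU rG cK dK k0 Kc rS /=.
have cGU : continuous_fiber `[a, b] (fun s => G s *m U s).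
  by move=> t Dt; apply: mxcvgM; [exact: cG|exact: cU].
have cg : continuous_real `[a, b] (fun s => mxnorm (G s *m F s)).
  by apply: continuous_fiber_mxnorm => t Dt; apply: mxcvgM; [exact: cG|exact: cF].
pose I s := \int[lebesgue_measure]_(x in `[a, s]) mxnorm (G x *m F x).
have cI := primitive_continuous ab cg; rewrite -/I in cI.
have dI t : a < t < b -> is_derive t 1 I (mxnorm (G t *m F t)) by exact: primitive_deriv.
have -> : \int[lebesgue_measure]_(x in `[a, b]) mxnorm (G x *m F x) = I b - I a.
  by rewrite /I primitive_start subr0.
pose dY t := S t *m (G t *m U t) + G t *m F t.
have hdY t : a < t < b -> has_deriv_on setT (fun s => G s *m U s) t (dY t).
  by move=> tab; apply: gauge_rate_solution; [exact: rG|exact: dU].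
have g0 t : a < t < b -> 0 <= mxnorm (G t *m F t) by move=> _; exact: mxnorm_ge0.
case: plus rS => rS.
  apply: (@energy_forward R n 1 (fun s => G s *m U s) dY K kappa I
    (fun s => mxnorm (G s *m F s)) a b c ab cGU cK cI hdY dK dI k0 g0 Kc) => t tab.
  by rewrite rdotDl lerD // ?rdot_le //; exact: rS.
apply: (@energy_backward R n 1 (fun s => G s *m U s) dY K kappa I
    (fun s => mxnorm (G s *m F s)) a b c ab cGU cK cI hdY dK dI k0 g0 Kc) => t tab.
rewrite rdotDl opprD lerD //; first exact: rS.
by rewrite -rdotNl (le_trans (rdot_le _ _)) // mxnormN.
Qed.

Lemma rdot_mul_bound (S : 'M[R[i]]_n) p (y : 'M[R[i]]_(n, p)) k : mxnorm S <= k ->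
  `|rdot (S *m y) y| <= k * mxnorm y ^+ 2.
Proof.
move=> Sk; have h : mxnorm (S *m y) * mxnorm y <= k * mxnorm y ^+ 2.
  rewrite expr2 mulrA ler_wpM2r ?mxnorm_ge0 // (le_trans (mxnormM _ _)) //.
  by rewrite ler_wpM2r ?mxnorm_ge0.
have h1 := rdot_le (S *m y) y; have h2 := rdot_le (- (S *m y)) y.
rewrite rdotNl mxnormN in h2.
by rewrite ler_norml; apply/andP; split; lra.
Qed.

(** From |Q X| >= |X| - |(Q - 1) X| >= |X| / 2, so that Q is injective. *)
Lemma near_id_unit (Q : 'M[R[i]]_n) : mxnorm (Q - 1%:M) <= 2^-1 ->
  Q \in unitmx /\ mxnorm (invmx Q) <= 2 * mxnorm (1%:M : 'M[R[i]]_n).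
Proof.
move=> Q1; have lower p (X : 'M[R[i]]_(n, p)) : mxnorm X <= 2 * mxnorm (Q *m X).
  have h1 := ler_mxnormB (Q *m X) ((Q - 1%:M) *m X).
  have e : Q *m X - (Q - 1%:M) *m X = X by rewrite mulmxBl mul1mx opprB addrC subrK.
  rewrite e in h1; have h2 := mxnormM (Q - 1%:M) X.
  have h3 := ler_wpM2r (mxnorm_ge0 X) Q1; lra.
have uQ : Q \in unitmx.
  apply: mulmx_cV_inj_unit => v Qv; apply: mxnorm0_eq0; apply/eqP.
  by rewrite eq_le mxnorm_ge0 andbT (le_trans (lower _ v)) // Qv mxnorm0 mulr0.
by split => //; have := lower _ (invmx Q); rewrite mulmxV.
Qed.

End Gauge.

(** * The gauge in zone P *)

Section SumBounds.
Variables (R : realType) (d n : nat).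

Lemma sum_bound (V : set (R * 'rV[R]_d)) (w : R -> 'rV[R]_d -> R)
    (f : nat -> R -> 'rV[R]_d -> 'M[R[i]]_n) :
  (forall t xi, V (t, xi) -> 0 <= w t xi) ->
  forall a b, (forall k, (a <= k < b)%N -> exists2 C : R, 0 <= C &
    forall t xi, V (t, xi) -> mxnorm (f k t xi) <= C * w t xi) ->
  exists2 C : R, 0 <= C &
    forall t xi, V (t, xi) -> mxnorm (\sum_(a <= k < b) f k t xi) <= C * w t xi.
Proof.
move=> w0 a; elim=> [|b ih] hf.
  by exists 0 => // t xi Vt; rewrite big_geq // mxnorm0 mul0r.
have [ab|ba] := leqP a b; last first.
  by exists 0 => // t xi Vt; rewrite big_geq // mxnorm0 mul0r.
have [C C0 hC] : exists2 C : R, 0 <= C &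
    forall t xi, V (t, xi) -> mxnorm (\sum_(a <= k < b) f k t xi) <= C * w t xi.
  by apply: ih => k /andP[ak kb]; apply: hf; rewrite ak ltnS ltnW.
have [C' C'0 hC'] : exists2 C : R, 0 <= C &
    forall t xi, V (t, xi) -> mxnorm (f b t xi) <= C * w t xi.
  by apply: hf; rewrite ab ltnSn.
exists (C + C') => [|t xi Vt]; first exact: addr_ge0.
rewrite big_nat_recr //= mulrDl (le_trans (ler_mxnormD _ _)) // lerD //.
  exact: hC.
exact: hC'.
Qed.

Lemma Qmx_deriv (V : set (R * 'rV[R]_d)) (Ns dN : nat -> R -> 'rV[R]_d -> 'M[R[i]]_n) m t xi :
  nbhs t (fiber V xi) -> (forall k, (1 <= k)%N -> is_dt V (Ns k) (dN k)) ->
  has_deriv_on setT (Qmx Ns m ^~ xi) t (\sum_(1 <= k < m.+1) dN k t xi).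
Proof.
move=> tV hN; have Vt : V (t, xi) by exact: nbhs_singleton tV.
have h0 : has_deriv_on setT (fun s => \sum_(1 <= k < m.+1) Ns k s xi) t
    (\sum_(1 <= k < m.+1) dN k t xi).
  have e (g : nat -> 'M[R[i]]_n) :
      \sum_(1 <= k < m.+1) g k = \sum_(1 <= k < m.+1 | (1 <= k)%N) g k.
    by apply: congr_big_nat => // k /andP[-> _].
  rewrite e (_ : (fun s => _) = fun s => \sum_(1 <= k < m.+1 | (1 <= k)%N) Ns k s xi); last first.
    by apply/funext => s; rewrite e.
  apply: has_deriv_on_sum => k k1; apply: has_deriv_on_sub (hN k k1 _ _ Vt).
  by apply: filterS tV.
by rewrite -[X in has_deriv_on _ _ _ X]add0r; apply: has_deriv_onD; first exact: has_deriv_on_cst.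
Qed.

Lemma Qmx_continuous (V : set (R * 'rV[R]_d)) (Ns : nat -> R -> 'rV[R]_d -> 'M[R[i]]_n) m xi :
  (forall k, (1 <= k)%N -> continuous_fiber (fiber V xi) (Ns k ^~ xi)) ->
  continuous_fiber (fiber V xi) (Qmx Ns m ^~ xi).
Proof.
move=> cN t Vt; apply: mxcvgD; first exact: mxcvg_cst.
have e (g : nat -> 'M[R[i]]_n) :
    \sum_(1 <= k < m.+1) g k = \sum_(1 <= k < m.+1 | (1 <= k)%N) g k.
  by apply: congr_big_nat => // k /andP[-> _].
rewrite e (_ : (fun s => _) = fun s => \sum_(1 <= k < m.+1 | (1 <= k)%N) Ns k s xi); last first.
  by apply/funext => s; rewrite e.
by apply: mxcvg_sum => k k1; exact: cN.
Qed.

Lemma renorm_identity_at (ell : 'I_d -> R) (V : set (R * 'rV[R]_d))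
    (P0 P1 : R -> 'rV[R]_d -> 'M[R[i]]_n) (Ds Ns Rs : nat -> R -> 'rV[R]_d -> 'M[R[i]]_n) m :
  ((1 <= m)%N \/ forall t xi, V (t, xi) -> Rs 0%N t xi = P1 t xi) ->
  renorm_identity ell V P0 P1 Ds Ns Rs ->
  exists2 dN : nat -> R -> 'rV[R]_d -> 'M[R[i]]_n,
    (forall k, (1 <= k)%N -> is_dt V (Ns k) (dN k)) &
    forall t xi, V (t, xi) -> Rs m t xi =
      ((abracket ell xi)^-1)%:C *: (\sum_(1 <= k < m.+1) dN k t xi)
      + Qmx Ns m t xi *m (P0 t xi + P1 t xi)
      - (P0 t xi + \sum_(1 <= k < m.+1) Ds k t xi) *m Qmx Ns m t xi.
Proof.
move=> m1 [dN [hN hR]]; exists dN => // t xi Vt.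
have [m0|m0] := posnP m; last by rewrite hR // scaler_sumr.
case: m1 => [|R0]; rewrite m0 // R0 // /Qmx !big_geq // scaler0 add0r !addr0.
by rewrite mul1mx mulmx1 addrAC subrr add0r.
Qed.

End SumBounds.

Section SmallPowers.
Variable R : realType.

Lemma small_power (C e : R) : 0 <= C -> 0 < e ->
  exists2 r : R, 0 < r & forall z, 0 < z <= r -> C * z `^ e <= 2^-1.
Proof.
move=> C0 e0; pose x : R := (2 * (C + 1))^-1; have x0 : 0 < x.
  by rewrite invr_gt0 mulr_gt0 // ltr_wpDl.
exists (x `^ e^-1); first exact: powR_gt0.
move=> z /andP[z0 zx]; apply: (@le_trans _ _ (C * x)).
  rewrite ler_wpM2l //; have := @ge0_ler_powR _ e (ltW e0) z (x `^ e^-1).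
  rewrite !nnegrE => /(_ (ltW z0) (powR_ge0 _ _) zx).
  by rewrite -powRrM mulVf ?gt_eqF // powRr1 // ltW.
rewrite /x ler_pdivrMr ?mulr_gt0 // ?ltr_wpDl // mulrA mulVf // mul1r lerDl //.
Qed.

Lemma powR_le1_anti (z a b : R) : 0 < z <= 1 -> b <= a -> z `^ a <= z `^ b.
Proof. by move=> z01 ba; apply: ger_powR. Qed.

End SmallPowers.

(** The derivative of the exponential E cancels the leading term ab z^-1 B, which
    commutes with E. *)
Lemma conj_cancel_commuting (R : realType) n (E B D W : 'M[R[i]]_n) (ab z t : R) :
  E \in unitmx -> E *m B = B *m E -> ab * z^-1 = t^-1 ->
  (- t^-1)%:C *: (B *m E) *m invmx E +
    E *m (ab%:C *: ((z^-1)%:C *: B + D + W)) *m invmx E =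
  ab%:C *: (E *m D *m invmx E + E *m W *m invmx E).
Proof.
move=> uE EB abz.
rewrite -addrA [ab%:C *: (_ + (D + W))]scalerDr scalerA -rmorphM abz mulmxDr mulmxDl addrA.
rewrite -scalemxAl mulmxK // -scalemxAr -scalemxAl EB mulmxK //.
rewrite -scalerDl -rmorphD addNr rmorph0 scale0r add0r.
by rewrite -scalemxAr -scalemxAl mulmxDr mulmxDl.
Qed.

Lemma invmx_mul (R : realType) n (M N : 'M[R[i]]_n) : M \in unitmx -> N \in unitmx ->
  invmx (M *m N) = invmx N *m invmx M.
Proof.
move=> uM uN; have e : M *m N *m (invmx N *m invmx M) = 1%:M.
  by rewrite mulmxA mulmxK // mulmxV.
by rewrite -[LHS]mulmx1 -e mulKmx // unitmx_mul uM.
Qed.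

(** Conjugation by E costs z^-e on D and z^(-2 b) on the remainder; the weight
    z^(2 e - 1) is left in both cases. *)
Lemma gauge_coefficient_bound (R : realType) n (E E' D Rm Q' : 'M[R[i]]_n)
    (z b e mu CJ CD CR I : R) : 0 < z <= 1 -> 0 <= CJ -> 0 <= CR -> 0 <= I ->
  mxnorm (E *m D *m E') <= CJ * z `^ (- e) * mxnorm D ->
  mxnorm D <= CD * z `^ (3 * e - 1) -> mxnorm Rm <= CR * z `^ mu ->
  mxnorm Q' <= 2 * I -> mxnorm E <= I * z `^ (- b) -> mxnorm E' <= I * z `^ (- b) ->
  2 * e - 1 <= mu - 2 * b ->
  mxnorm (E *m D *m E' + E *m (Rm *m Q') *m E') <=
    (CJ * CD + I * CR * (2 * I) * I) * z `^ (2 * e - 1).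
Proof.
move=> z01 CJ0 CR0 I0 hJ hD hR hQ hE hE' emu; have [z0 _] := andP z01.
have p0 a : 0 <= z `^ a by exact: powR_ge0.
rewrite (le_trans (ler_mxnormD _ _)) // mulrDl lerD //.
  apply: (le_trans hJ); apply: (@le_trans _ _ (CJ * z `^ (- e) * (CD * z `^ (3 * e - 1)))).
    by rewrite ler_wpM2l // mulr_ge0.
  have -> : 2 * e - 1 = - e + (3 * e - 1) by ring.
  by rewrite (powR_addr (- e) _ z0) [leLHS]mulrACA.
apply: (@le_trans _ _ (mxnorm E * (mxnorm Rm * mxnorm Q') * mxnorm E')).
  rewrite (le_trans (mxnormM _ _)) // ler_wpM2r ?mxnorm_ge0 //.
  by rewrite (le_trans (mxnormM _ _)) // ler_wpM2l ?mxnorm_ge0 // mxnormM.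
apply: (@le_trans _ _ (I * z `^ (- b) * (CR * z `^ mu * (2 * I)) * (I * z `^ (- b)))).
  by rewrite ler_pM ?mulr_ge0 ?mxnorm_ge0 // ler_pM ?mulr_ge0 ?mxnorm_ge0 // ler_pM ?mxnorm_ge0.
have -> : I * z `^ (- b) * (CR * z `^ mu * (2 * I)) * (I * z `^ (- b)) =
    I * CR * (2 * I) * I * (z `^ mu * (z `^ (- b) * z `^ (- b))) by ring.
rewrite ler_wpM2l ?mulr_ge0 // -!powR_addr //; apply: powR_le1_anti => //.
by apply: (le_trans emu); lra.
Qed.

Lemma gauge_product_bound (R : realType) n (E Q M : 'M[R[i]]_n) (e c c' : R) :
  E \in unitmx -> M \in unitmx -> mxnorm (Q - 1%:M) <= 2^-1 ->
  mxnorm E <= e -> mxnorm (invmx E) <= e -> mxnorm M <= c -> mxnorm (invmx M) <= c' ->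
  [/\ E *m Q *m M \in unitmx,
      mxnorm (E *m Q *m M) <= e * (2^-1 + mxnorm (1%:M : 'M[R[i]]_n)) * c
    & mxnorm (invmx (E *m Q *m M)) <= c' * (2 * mxnorm (1%:M : 'M[R[i]]_n)) * e].
Proof.
move=> uE uM Q1 E1 E2 M1 M2; have [uQ iQ] := near_id_unit Q1.
have bQ : mxnorm Q <= 2^-1 + mxnorm (1%:M : 'M[R[i]]_n).
  have := ler_mxnormD (Q - 1%:M) 1%:M; rewrite subrK => /le_trans; apply.
  by rewrite lerD2r.
have uEQ : E *m Q \in unitmx by rewrite unitmx_mul uE.
split; first by rewrite unitmx_mul uEQ.
  apply: le_trans (mxnormM _ _) _; apply: ler_pM; rewrite ?mxnorm_ge0 //.
  by apply: le_trans (mxnormM _ _) _; apply: ler_pM; rewrite ?mxnorm_ge0.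
rewrite !invmx_mul // -mulrA; apply: le_trans (mxnormM _ _) _; apply: ler_pM; rewrite ?mxnorm_ge0 //.
by apply: le_trans (mxnormM _ _) _; apply: ler_pM; rewrite ?mxnorm_ge0.
Qed.

Section ZoneP.
Variables (R : realType) (d n : nat) (T : R) (ell : 'I_d -> R) (rhos aP beta : R).
Variables (A MP RP : R -> 'rV[R]_d -> 'M[R[i]]_n) (BP : 'rV[R]_d -> 'M[R[i]]_n).
Variables (Ds Ns Rs : nat -> R -> 'rV[R]_d -> 'M[R[i]]_n) (m : nat).
Local Notation Z := (zoneP T ell rhos).
Local Notation ab := (abracket ell).
Hypothesis rhos01 : 0 < rhos < 1.
Hypothesis hP : assumption_P T ell rhos A MP BP RP aP.
Hypothesis hren : renormalization_P T ell rhos BP RP aP Ds Ns Rs.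
Hypothesis BPbeta : forall xi, mxnorm (BP xi) <= beta.
Hypothesis m_large : 2 * beta <= m%:R * (aP + 1).

Definition gaugeP t xi := Emx_P ell BP t xi *m Qmx Ns m t xi *m MP t xi.

Let aP1 : 0 < aP + 1. Proof. by case: hP => _ _ _ [h _] _; rewrite -(opprK 1) subr_gt0. Qed.
Let beta0 : 0 <= beta. Proof. exact: le_trans (mxnorm_ge0 _) (BPbeta 0). Qed.
(* One quarter of aP + 1 for the logarithms, one for the conjugation by E_P; two are left. *)
Let eta := (aP + 1) / 4.
Let eta0 : 0 < eta. Proof. by rewrite divr_gt0. Qed.

Lemma zoneP_z t xi : Z (t, xi) -> 0 < zvar ell t xi <= 1.
Proof.
move=> [/andP[t0 _] zr]; rewrite mulr_gt0 ?abracket_gt0 //=.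
by apply: le_trans zr _; case/andP: rhos01 => _ /ltW.
Qed.

Let Z0 t xi : Z (t, xi) -> 0 < zvar ell t xi.
Proof. by case/zoneP_z/andP. Qed.

Lemma zoneP_sub rho xi : rho <= rhos -> fiber (zoneP T ell rho) xi `<=` fiber Z xi.
Proof. by move=> rr t [h1 h2]; split => //; exact: le_trans rr. Qed.

Lemma symbSlog_N k : (1 <= k)%N -> symbSlog ell Z (k%:R * (aP + 1)) (Ns k).
Proof. by move=> k1; case: hren => /(_ k k1)[]. Qed.

Lemma Q_near_id_P : exists2 C : R, 0 <= C & forall t xi, Z (t, xi) ->
  mxnorm (Qmx Ns m t xi - 1%:M) <= C * zvar ell t xi `^ eta.
Proof.
have [|k /andP[k1 _]|C C0 hC] := @sum_bound R d n Z (fun t xi => zvar ell t xi `^ eta) Ns _ 1 m.+1.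
- by move=> t xi _; exact: powR_ge0.
- apply: symbSlog_bound zoneP_z _ (symbSlog_N k1).
  have k1' : 1 <= k%:R :> R by rewrite ler1n.
  apply: (@lt_le_trans _ _ (1 * (aP + 1))); last by rewrite ler_wpM2r // ltW.
  by rewrite mul1r /eta ltr_pdivrMr // ltr_pMr // ltr1n.
by exists C => // t xi Vt; rewrite /Qmx addrC addKr; exact: hC.
Qed.

Lemma Dsum_bound_P : exists2 C : R, 0 <= C & forall t xi, Z (t, xi) ->
  mxnorm (\sum_(1 <= k < m.+1) Ds k t xi) <= C * zvar ell t xi `^ (3 * eta - 1).
Proof.
apply: sum_bound => [t xi _|k /andP[k1 _]]; first exact: powR_ge0.
case: hren => /(_ k k1)[hD _ _ _] _ _.
apply: symbSlog_bound zoneP_z _ hD.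
have k1' : 1 <= k%:R :> R by rewrite ler1n.
rewrite ltrD2r; apply: (@lt_le_trans _ _ (1 * (aP + 1))); last by rewrite ler_wpM2r // ltW.
have : aP + 1 = 4 * eta by rewrite /eta; field.
by move=> ->; rewrite mul1r ltr_pM2r // ltr_nat.
Qed.

Lemma R_bound_P : exists2 C : R, 0 <= C & forall t xi, Z (t, xi) ->
  mxnorm (Rs m t xi) <= C * zvar ell t xi `^ (m%:R * (aP + 1) + aP - eta).
Proof.
have lt_eta (a : R) : a - eta < a by rewrite gtrBl.
have [m0|m0] := posnP m.
  case: hP => _ _ _ [_ hR] _; have [C C0 hC] := symbSlog_bound zoneP_z (lt_eta aP) hR.
  exists C => // t xi Vt.
  by rewrite m0; case: hren => _ h0 _; rewrite h0 // mul0r add0r; exact: hC.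
case: hren => /(_ m m0)[_ _ _ hR] _ _.
exact: symbSlog_bound zoneP_z (lt_eta _) hR.
Qed.

Lemma EmxPE t xi : Emx_P ell BP t xi = mxexp ((- ln (zvar ell t xi))%:C *: BP xi).
Proof. by rewrite /Emx_P rmorphN. Qed.

Lemma EmxP_unit t xi : Emx_P ell BP t xi \in unitmx.
Proof. by rewrite EmxPE; exact: mxexp_unit. Qed.

Lemma EmxP_bound t xi : Z (t, xi) ->
  mxnorm (Emx_P ell BP t xi) <= mxnorm (1%:M : 'M[R[i]]_n) * zvar ell t xi `^ (- beta) /\
  mxnorm (invmx (Emx_P ell BP t xi)) <= mxnorm (1%:M : 'M[R[i]]_n) * zvar ell t xi `^ (- beta).
Proof.
move=> Vt; have /andP[z0 z1] := zoneP_z Vt.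
have s0 : 0 <= - ln (zvar ell t xi) by rewrite oppr_ge0 ln_le0.
have e : zvar ell t xi `^ (- beta) = expR (beta * - ln (zvar ell t xi)).
  by rewrite powR_expR // mulNr mulrN.
have bound (B : 'M[R[i]]_n) : mxnorm B <= beta -> mxnorm (mxexp ((- ln (zvar ell t xi))%:C *: B)) <=
    mxnorm (1%:M : 'M[R[i]]_n) * zvar ell t xi `^ (- beta).
  move=> Bb; rewrite e [leRHS]mulrC (le_trans (mxnorm_mxexp B s0)) //.
  apply: ler_wpM2r; first exact: mxnorm_ge0.
  by rewrite ler_expR; apply: ler_wpM2r.
rewrite EmxPE invmx_mxexp; split; apply: bound => //.
by rewrite mxnormN.
Qed.

Lemma EmxP_deriv t xi : 0 < t ->
  has_deriv_on setT (Emx_P ell BP ^~ xi) t ((- t^-1)%:C *: (BP xi *m Emx_P ell BP t xi)).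
Proof.
move=> t0; have ab0 := abracket_gt0 ell xi.
have dl : is_derive t 1 (fun s => - ln (zvar ell s xi)) (- t^-1).
  have d1 : is_derive t 1 (fun s => zvar ell s xi) (ab xi * 1) by apply: is_derive_scale.
  have z0 : 0 < zvar ell t xi by rewrite mulr_gt0.
  have := is_derive_opp (is_derive_comp d1 (is_derive1_ln z0)).
  by move=> /is_derive_eq; apply; rewrite /zvar; field; rewrite !gt_eqF.
rewrite EmxPE (_ : (fun s => _) = fun s => mxexp ((- ln (zvar ell s xi))%:C *: BP xi)).
  exact: (has_deriv_on_comp (mxexp_deriv _ _) dl).
by apply/funext => s; rewrite EmxPE.
Qed.

(** The coefficient of the gauged system is <<xi>> times the conjugate by E of
    sum_k D^(k) + R^(m) Q^-1.  Being diagonal, the first matrix costs a factor z^-eta only;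
    for the second, m has been chosen large.  As 2 eta > 0, the rate t^-1 z^(2 eta) is
    integrable at t = 0. *)
Lemma gaugeP_rate : exists rho1, 0 < rho1 < rhos /\
  (forall t xi, zoneP T ell rho1 (t, xi) -> mxnorm (Qmx Ns m t xi - 1%:M) <= 2^-1) /\
  exists2 C : R, 0 <= C & forall t xi, 0 < t < T -> zvar ell t xi <= rho1 ->
    exists2 S, gauge_rate (gaugeP ^~ xi) (A ^~ xi) t S &
      mxnorm S <= C * (t^-1 * zvar ell t xi `^ (2 * eta)).
Proof.
have [CQ CQ0 hQ] := Q_near_id_P; have [r r0 hr] := small_power CQ0 eta0.
have [rhos0 rhos1] := andP rhos01.
pose rho1 := Num.min r (rhos / 2).
have rho10 : 0 < rho1 by rewrite lt_min r0 divr_gt0.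
have rho1s : rho1 < rhos.
  by rewrite gt_min; apply/orP; right; rewrite ltr_pdivrMr // ltr_pMr // ltr1n.
have Q1 t xi : zoneP T ell rho1 (t, xi) -> mxnorm (Qmx Ns m t xi - 1%:M) <= 2^-1.
  move=> Vt; have Zt : Z (t, xi) by exact: (zoneP_sub (ltW rho1s)).
  apply: le_trans (hQ _ _ Zt) (hr _ _).
  have [z0 _] := andP (zoneP_z Zt); rewrite z0 /=.
  by case: Vt => _ /= zr; rewrite (le_trans zr) // ge_min lexx.
exists rho1; split; first by rewrite rho10.
split; first exact: Q1.
have [CD CD0 hD] := Dsum_bound_P; have [CR CR0 hR] := R_bound_P.
have [CJ CJ0 hJ] := jordan_conj_growth n eta0.
pose I1 := mxnorm (1%:M : 'M[R[i]]_n); have I10 : 0 <= I1 by exact: mxnorm_ge0.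
exists (CJ * CD + I1 * CR * (2 * I1) * I1).
  by rewrite addr_ge0 // !mulr_ge0.
move=> t xi t0T zr; have [t0 tT] := andP t0T.
have V1t : zoneP T ell rho1 (t, xi) by split => //; rewrite /strip /= t0 ltW.
have Zt : Z (t, xi) by exact: (zoneP_sub (ltW rho1s)).
have /andP[z0 z1] := zoneP_z Zt.
have tZ : nbhs t (fiber Z xi) by apply: nbhs_zoneP => //; exact: le_lt_trans rho1s.
have [uQ iQ] := near_id_unit (Q1 _ _ V1t).
have ab0 := abracket_gt0 ell xi.
have [[uM sM _] _ JB _ [dM dMV MA]] := hP.
have [dN hN hRs] : exists2 dN : nat -> R -> 'rV[R]_d -> 'M[R[i]]_n,
    (forall k, (1 <= k)%N -> is_dt Z (Ns k) (dN k)) &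
    forall t xi, Z (t, xi) -> Rs m t xi = ((ab xi)^-1)%:C *: (\sum_(1 <= k < m.+1) dN k t xi)
      + Qmx Ns m t xi *m (((zvar ell t xi)^-1)%:C *: BP xi + RP t xi)
      - (((zvar ell t xi)^-1)%:C *: BP xi + \sum_(1 <= k < m.+1) Ds k t xi) *m Qmx Ns m t xi.
  have [_ h0 hid] := hren; apply: (renorm_identity_at _ hid); right; exact: h0.
have rQM := @gauge_rate_renorm R n (ab xi) (MP ^~ xi) (Qmx Ns m ^~ xi) (A ^~ xi) t
  (dM t xi) (\sum_(1 <= k < m.+1) dN k t xi) (((zvar ell t xi)^-1)%:C *: BP xi) (RP t xi)
  (\sum_(1 <= k < m.+1) Ds k t xi) (Rs m t xi) ab0 (uM _ _ Zt) uQ.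
have hMt : has_deriv_on setT (MP ^~ xi) t (dM t xi).
  by apply: has_deriv_on_sub (dMV _ _ Zt); apply: filterS tZ.
have {}rQM := rQM hMt (Qmx_deriv m tZ hN).
have abz : ab xi * (zvar ell t xi)^-1 = t^-1.
  by rewrite /zvar invfM mulrA mulfV ?mul1r // gt_eqF.
have MA' : MP t xi *m A t xi *m invmx (MP t xi) + dM t xi *m invmx (MP t xi) =
    (ab xi)%:C *: (((zvar ell t xi)^-1)%:C *: BP xi + RP t xi).
  by rewrite (MA _ _ Zt) scalerDr scalerA -rmorphM abz.
have {}rQM := rQM MA' (hRs _ _ Zt).
have rE := gauge_rate_left (EmxP_unit t xi) (EmxP_deriv xi t0) rQM.
have EB : Emx_P ell BP t xi *m BP xi = BP xi *m Emx_P ell BP t xi.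
  by rewrite EmxPE mxexp_comm.
rewrite (conj_cancel_commuting _ _ (EmxP_unit t xi) EB abz) in rE.
have [E1 E2] := EmxP_bound Zt; have hRt := hR _ _ Zt; have hDt := hD _ _ Zt.
have hJt := hJ (BP xi) (\sum_(1 <= k < m.+1) Ds k t xi) (- ln (zvar ell t xi)) (JB xi).
rewrite -EmxPE -invmx_mxexp -EmxPE in hJt.
have dD : is_diag_mx (\sum_(1 <= k < m.+1) Ds k t xi).
  apply/is_diag_mxP => i j ij; rewrite summxE big_nat big1 // => k /andP[k1 _].
  have [/(_ k k1)[_ hd _ _] _ _] := hren.
  by have /is_diag_mxP := hd _ _ Zt; apply.
have s0 : 0 <= - ln (zvar ell t xi) by rewrite oppr_ge0 ln_le0.
have {}hJt := hJt dD s0.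
have e1 : expR (eta * - ln (zvar ell t xi)) = zvar ell t xi `^ (- eta).
  by rewrite powR_expR // mulNr mulrN.
rewrite e1 in hJt.
eexists.
  by rewrite /gaugeP; under eq_fun do rewrite -mulmxA; exact: rE.
rewrite mxnormZr gtr0_norm //.
have z01 : 0 < zvar ell t xi <= 1 by rewrite z0.
have aP4 : aP = 4 * eta - 1 by rewrite /eta; field.
have expo : 2 * eta - 1 <= m%:R * (aP + 1) + aP - eta - 2 * beta.
  rewrite [X in _ + X - _ - _]aP4; move: (m%:R * (aP + 1)) eta m_large eta0 => q e h1 h2; lra.
have bnd := gauge_coefficient_bound z01 CJ0 CR0 I10 hJt hDt hRt iQ E1 E2 expo.
apply: (@le_trans _ _ (ab xi * ((CJ * CD + I1 * CR * (2 * I1) * I1) * zvar ell t xi `^ (2 * eta - 1)))).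
  by rewrite ler_wpM2l // ltW.
rewrite mulrCA ler_wpM2l ?addr_ge0 ?mulr_ge0 //.
by rewrite powR_addr // powR_inv1 ?(ltW z0) // mulrCA mulrC abz.
Qed.

Lemma gaugeP_bound rho1 : 0 < rho1 <= rhos ->
  (forall t xi, zoneP T ell rho1 (t, xi) -> mxnorm (Qmx Ns m t xi - 1%:M) <= 2^-1) ->
  exists2 C : R, 0 <= C & forall t xi, zoneP T ell rho1 (t, xi) ->
    [/\ gaugeP t xi \in unitmx,
        mxnorm (gaugeP t xi) <= C * zvar ell t xi `^ (- beta)
      & mxnorm (invmx (gaugeP t xi)) <= C * zvar ell t xi `^ (- beta)].
Proof.
move=> /andP[rho10 rho1s] Q1; have [[uM sM sM'] _ _ _ _] := hP.
have [CM CM0 hM] := symbS_bound Z0 sM; have [CM' CM'0 hM'] := symbS_bound Z0 sM'.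
pose I1 := mxnorm (1%:M : 'M[R[i]]_n); have I10 : 0 <= I1 by exact: mxnorm_ge0.
exists (I1 * (2^-1 + I1) * CM + CM' * (2 * I1) * I1).
  by rewrite addr_ge0 // !mulr_ge0 // addr_ge0.
move=> t xi Vt; have Zt : Z (t, xi) by exact: (zoneP_sub rho1s).
have [E1 E2] := EmxP_bound Zt; have hMt := hM _ _ Zt; have hM't := hM' _ _ Zt.
rewrite powRr0 mulr1 in hMt; rewrite powRr0 mulr1 in hM't.
have [uG G1 G2] := gauge_product_bound (EmxP_unit t xi) (uM _ _ Zt) (Q1 _ _ Vt) E1 E2 hMt hM't.
have p0 : 0 <= zvar ell t xi `^ (- beta) by exact: powR_ge0.
split=> //; [apply: (le_trans G1)|apply: (le_trans G2)].
  by rewrite -/I1 -!mulrA [zvar _ _ _ `^ _ * _]mulrC !mulrA ler_wpM2r // lerDl !mulr_ge0.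
by rewrite -/I1 !mulrA ler_wpM2r // lerDr !mulr_ge0 // addr_ge0.
Qed.

Lemma gaugeP_continuous xi : continuous_fiber (fiber Z xi) (gaugeP ^~ xi).
Proof.
have [[_ sM _] _ _ _ _] := hP.
move=> t Vt; apply: mxcvgM; last exact: (symbol_continuous sM).
apply: mxcvgM; last first.
  apply: Qmx_continuous Vt => k k1; have [p sN] := symbSlog_N k1.
  exact: (symbol_continuous sN).
have t0 : 0 < t by case: Vt => /andP[].
apply: has_deriv_on_cvg; apply: has_deriv_on_sub (EmxP_deriv xi t0).
by apply: (@nearW _ (nbhs t)) => s _; exact: I.
Qed.

End ZoneP.

(** * The integrated extremal exponents *)

Lemma ell_star_gt (R : realType) (d : nat) (ell : 'I_d -> R) : (0 < d)%N ->
  (forall i, -1 < ell i) -> 0 < ell_star ell + 1.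
Proof.
move=> d0 hl; have i0 : 'I_d := Ordinal d0.
pose x := \big[Num.min/ell i0]_(i < d) ell i.
have [j ej] : exists j, x = ell j.
  rewrite /x; elim/big_ind: _ => [|y z [j1 ->] [j2 ->]|i _]; [by exists i0| |by exists i].
  by rewrite /Num.min; case: ifP => _; [exists j1|exists j2].
have h : x <= ell_star ell.
  apply: lb_le_inf; first by exists (ell i0); exists i0.
  by move=> _ [i _ <-]; exact: bigmin_le_cond.
have := hl j; rewrite -ej => hx; rewrite -ltrBlDr sub0r; exact: lt_le_trans h.
Qed.

Section ExtremalExponent.
Variables (R : realType) (d n : nat) (T : R) (ell : 'I_d -> R) (rhos beta : R).
Variables (BH : R -> 'rV[R]_d -> 'M[R[i]]_n) (G : {set {set 'I_n}}).
Local Notation Z := (zoneH T ell rhos).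
Local Notation ab := (abracket ell).
Hypothesis rhos01 : 0 < rhos < 1.
Hypothesis partG : finset.partition G (finset.setTfor 'I_n).
Hypothesis cBH : forall xi, continuous_fiber (fiber Z xi) (BH ^~ xi).
Hypothesis BHbeta : forall t xi, Z (t, xi) -> mxnorm (BH t xi) <= beta.
Hypothesis beta0 : 0 <= beta.

Definition extremal (plus : bool) xi (i : 'I_n) (t : R) : R :=
  extremal_entry plus G (Gdiag_part G (BH t xi)) i.

Lemma extremal_continuous plus xi i : continuous_real (fiber Z xi) (extremal plus xi i).
Proof.
move=> t Vt; apply/cvgrPdist_le => e e0; have /cvgrPdist_le /(_ e e0) := cBH Vt.
apply: filterS => s; rewrite sub0r normrN ger0_norm ?mxnorm_ge0 // => h.
rewrite distrC (le_trans (extremal_entry_lipschitz partG _ _ _ _)) //.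
by rewrite -Gdiag_partB (le_trans (mxnorm_Gdiag_part _ _)).
Qed.

Lemma extremal_bound plus xi i t : Z (t, xi) -> `|extremal plus xi i t| <= beta.
Proof.
move=> Vt; rewrite (le_trans (extremal_entry_bound partG _ _ _)) //.
by rewrite (le_trans (mxnorm_Gdiag_part _ _)) // BHbeta.
Qed.

Section FixedFrequency.
Variables (rho : R) (xi : 'rV[R]_d) (plus : bool).
Hypothesis rho0s : 0 < rho <= rhos.
Let c := (ab xi)^-1 * rho^-1.
Let rho0 : 0 < rho. Proof. by case/andP: rho0s. Qed.

Lemma zoneH_start_gt0 : 0 < c.
Proof. by rewrite mulr_gt0 ?invr_gt0 ?abracket_gt0. Qed.

Lemma zoneH_segment t : c <= t <= T -> Z (t, xi).
Proof.
move=> /andP[ct tT]; split; first by rewrite /strip /= tT andbT (lt_le_trans zoneH_start_gt0).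
rewrite /= /zvar; apply: (@le_trans _ _ rho^-1).
  by rewrite lef_pV2 ?posrE //; [case/andP: rho0s|case/andP: rhos01].
by rewrite -ler_pdivrMl ?abracket_gt0.
Qed.

Lemma segment_sub_fiber : `[c, T]%classic `<=` fiber Z xi.
Proof. by move=> t; rewrite /= in_itv /=; exact: zoneH_segment. Qed.

Lemma bexp_integrand_continuous i :
  continuous_real `[c, T] (fun t => t^-1 * extremal plus xi i t).
Proof.
apply: continuous_realM; last exact: continuous_real_sub segment_sub_fiber (@extremal_continuous _ _ _).
move=> t; rewrite /= in_itv /= => /andP[ct _]; apply: cvg_within_filter.
apply: cvgV; last exact: cvg_id.
by rewrite gt_eqF // (lt_le_trans zoneH_start_gt0).
Qed.

Let b i t := bexp_H plus ell rho G BH i t xi.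

Lemma bexp_continuous i : c <= T -> continuous_real `[c, T] (b i).
Proof. by move=> cT; exact: (primitive_continuous cT (@bexp_integrand_continuous i)). Qed.

Lemma bexp_deriv i t : c < t < T -> is_derive t 1 (b i) (t^-1 * extremal plus xi i t).
Proof. by move=> tc; exact: (primitive_deriv (@bexp_integrand_continuous i) tc). Qed.

(** Since |b'| <= beta / t, both beta ln t - b and beta ln t + b are nondecreasing.  At the
    start c of the zone b vanishes, and ab c = 1 / rho >= 1. *)
Lemma bexp_bound i t : c <= t <= T -> `|b i t| <= beta * ln (zvar ell t xi).
Proof.
move=> /andP[ct tT]; have cT := le_trans ct tT; have c0 := zoneH_start_gt0.
have t0 : 0 < t := lt_le_trans c0 ct.
have sub : `[c, t]%classic `<=` `[c, T]%classic by apply: subset_itvl; rewrite bnd_simp.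
have bc : b i c = 0 by exact: primitive_start.
have lnc (s : R) : 0 < s -> is_derive s 1 (fun s => beta * ln s) (beta * s^-1).
  by move=> s0; apply: is_derive_scale; exact: is_derive1_ln.
have clnc : continuous_real `[c, t] (fun s => beta * ln s).
  move=> s; rewrite /= in_itv /= => /andP[cs _]; apply: cvgM; first exact: cvg_cst.
  by apply: cvg_within_filter; apply: continuous_ln; rewrite (lt_le_trans c0).
have cb := continuous_real_sub sub (@bexp_continuous i cT).
have ext (s : R) : c < s < t -> - beta <= extremal plus xi i s <= beta.
  move=> /andP[cs st]; rewrite -ler_norml; apply: extremal_bound; apply: zoneH_segment.
  by rewrite ltW //= (le_trans (ltW st)).
have s0 (s : R) : c < s < t -> 0 < s^-1 by move=> /andP[cs _]; rewrite invr_gt0 (lt_trans c0).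
have db (s : R) : c < s < t -> is_derive s 1 (b i) (s^-1 * extremal plus xi i s).
  by move=> /andP[cs st]; apply: bexp_deriv; rewrite cs (lt_le_trans st).
have up : beta * ln c - b i c <= beta * ln t - b i t.
  apply: (@nondecreasing_of_deriv R (fun s => beta * ln s - b i s)
    (fun s => beta * s^-1 - s^-1 * extremal plus xi i s)) => //.
  - by apply: continuous_realD => //; exact: continuous_realN.
  - move=> s cst; apply: is_derive_sub; last exact: db.
    by apply: lnc; have := s0 _ cst; rewrite invr_gt0.
  - move=> s cst; rewrite mulrC -mulrBr mulr_ge0 ?(ltW (s0 _ cst)) // subr_ge0.
    by case/andP: (ext _ cst).
have dn : beta * ln c + b i c <= beta * ln t + b i t.
  apply: (@nondecreasing_of_deriv R (fun s => beta * ln s + b i s)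
    (fun s => beta * s^-1 + s^-1 * extremal plus xi i s)) => //.
  - by apply: continuous_realD.
  - move=> s cst; apply: is_derive_add; last exact: db.
    by apply: lnc; have := s0 _ cst; rewrite invr_gt0.
  - move=> s cst; rewrite mulrC -mulrDr mulr_ge0 ?(ltW (s0 _ cst)) //.
    by have /andP[] := ext _ cst; rewrite -subr_ge0 opprK addrC.
rewrite bc subr0 in up; rewrite bc addr0 in dn.
have lz : beta * (ln t - ln c) <= beta * ln (zvar ell t xi).
  rewrite ler_wpM2l // /zvar lnM ?posrE ?abracket_gt0 // addrC lerD2r.
  rewrite /c lnM ?posrE ?invr_gt0 ?abracket_gt0 // !lnV ?posrE ?abracket_gt0 //.
  rewrite opprD !opprK gerDl; apply: ln_le0.
  by case/andP: rho0s => _ /le_trans -> //; case/andP: rhos01 => _ /ltW.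
by rewrite ler_norml; apply/andP; split; lra.
Qed.

Let E t := Emx_H plus ell rho G BH t xi.
Definition EmxH_inv t : 'M[R[i]]_n := diag_mx (\row_i (expR (b i t))%:C).

Lemma EmxH_mulV t : E t *m EmxH_inv t = 1%:M.
Proof.
rewrite mulmx_diag; apply/matrixP => i j; rewrite !mxE.
by rewrite -rmorphM /= mulrC expRxMexpNx_1.
Qed.

Lemma EmxH_unit t : E t \in unitmx.
Proof. exact: (mulmx1_unit (EmxH_mulV t)).1. Qed.

Lemma EmxH_invE t : invmx (E t) = EmxH_inv t.
Proof. by rewrite -[LHS]mulmx1 -(EmxH_mulV t) mulKmx // EmxH_unit. Qed.

Lemma EmxH_bound t : c <= t <= T ->
  mxnorm (E t) <= (\sum_(i < n) \sum_(j < n) 1) * zvar ell t xi `^ beta /\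
  mxnorm (invmx (E t)) <= (\sum_(i < n) \sum_(j < n) 1) * zvar ell t xi `^ beta.
Proof.
move=> ctT; have z0 : 0 < zvar ell t xi.
  by case/andP: ctT => ct _; rewrite mulr_gt0 ?abracket_gt0 // (lt_le_trans zoneH_start_gt0).
have diag_bound (g : 'I_n -> R) : (forall i, `|g i| <= beta * ln (zvar ell t xi)) ->
   mxnorm (diag_mx (\row_i (expR (g i))%:C) : 'M[R[i]]_n) <=
   (\sum_(i < n) \sum_(j < n) 1) * zvar ell t xi `^ beta.
  move=> hg; apply: le_trans (mxnorm_le_sum _) _.
  rewrite mulr_suml; apply: ler_sum => i _; rewrite mulr_suml; apply: ler_sum => j _.
  rewrite mul1r !mxE; have [_|_] := eqVneq i j; last first.
    by rewrite mulr0n /= normr0 addr0 powR_ge0.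
  rewrite mulr1n /= normr0 addr0 ger0_norm ?expR_ge0 // powR_expR // ler_expR.
  exact: le_trans (ler_norm _) (hg i).
rewrite EmxH_invE; split; apply: diag_bound => i; last exact: bexp_bound.
by rewrite normrN; exact: bexp_bound.
Qed.

Lemma EmxH_deriv t : c < t < T -> has_deriv_on setT E t
  (- (t^-1)%:C *: (diag_mx (\row_i (extremal plus xi i t)%:C) *m E t)).
Proof.
move=> ctT; have de i : is_derive t 1 (fun s => expR (- b i s))
    (expR (- b i t) * (- (t^-1 * extremal plus xi i t))).
  exact: (is_derive_comp (is_derive_opp (bexp_deriv i ctT)) (is_derive_expR _)).
apply: has_deriv_on_entries => i j; rewrite mxE mulmx_diag !mxE.
  rewrite (_ : (fun s => _) = fun s => if i == j then expR (- b i s) else 0); last first.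
    by apply/funext => s; rewrite !mxE; case: eqP.
  case: eqVneq => [_|_]; last first.
    by rewrite mulr0n mulr0; exact: is_derive_const.
  apply: is_derive_eq (de i) _; rewrite mulr1n -!rmorphM -rmorphN -rmorphM /= mulrC.
  by rewrite mulrA !mulNr.
rewrite (_ : (fun s => _) = fun=> 0); last first.
  by apply/funext => s; rewrite !mxE; case: eqP.
apply: is_derive_eq (is_derive_const _ _) _.
by case: eqP => _; rewrite ?mulr0n ?mulr0 // mulr1n -!rmorphM -rmorphN -rmorphM.
Qed.

Lemma EmxH_continuous : c <= T -> continuous_fiber `[c, T] E.
Proof.
move=> cT t Dt; apply: mxcvg_entries => i j.
  have ce : continuous_real `[c, T] (fun s => expR (- b i s)).
    apply: (@continuous_real_comp _ _ _ expR); last exact: continuous_expR.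
    by apply: continuous_realN; exact: bexp_continuous.
  have [<-|ij] := eqVneq i j.
    rewrite (_ : (fun s => _) = fun s => expR (- b i s)); last first.
      by apply/funext => s; rewrite !mxE eqxx.
    by rewrite !mxE eqxx; exact: ce.
  rewrite (_ : (fun s => _) = fun=> 0); last by apply/funext => s; rewrite !mxE (negbTE ij).
  by rewrite !mxE (negbTE ij); exact: cvg_cst.
rewrite (_ : (fun s => _) = fun=> 0); last by apply/funext => s; rewrite !mxE; case: eqP.
by rewrite !mxE; case: eqP => _; exact: cvg_cst.
Qed.

Lemma bexp_H_block t i j : same_block G i j -> b i t = b j t.
Proof.
move=> ij; rewrite /b /bexp_H; apply: eq_Rintegral => s _.
by rewrite (extremal_entry_block _ _ ij).
Qed.

(** The blocks of E are scalar, so E commutes with all G-diagonal matrices. *)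
Lemma EmxH_comm t (W : 'M[R[i]]_n) : is_Gdiag G W -> E t *m W = W *m E t.
Proof.
move=> dW; apply: (@Gdiag_comm R n G (fun i => (expR (- b i t))%:C)) => [i j ij|//].
by rewrite (bexp_H_block t ij).
Qed.

End FixedFrequency.
End ExtremalExponent.

(** * The gauge in zone H *)

(** Here E commutes with all terms but the remainder W; the only trace that E leaves on
    them is its own derivative - t^-1 Mu E. *)
Lemma conj_block_commuting (R : realType) n (E P B D W Mu : 'M[R[i]]_n) (ab z t : R) :
  E \in unitmx -> E *m P = P *m E -> E *m B = B *m E -> E *m D = D *m E -> ab * z^-1 = t^-1 ->
  - (t^-1)%:C *: (Mu *m E) *m invmx E +
    E *m (ab%:C *: (P + ((z^-1)%:C *: B + D) + W)) *m invmx E =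
  ab%:C *: P + (t^-1)%:C *: (B - Mu) + ab%:C *: (D + E *m W *m invmx E).
Proof.
move=> uE EP EB ED abz.
have -> : E *m (ab%:C *: (P + ((z^-1)%:C *: B + D) + W)) *m invmx E =
    ab%:C *: P + (t^-1)%:C *: B + ab%:C *: (D + E *m W *m invmx E).
  rewrite -abz rmorphM -!scalerA -!scalerDr -scalemxAr -scalemxAl; congr (_ *: _).
  rewrite !mulmxDr !mulmxDl -scalemxAr -scalemxAl EP EB ED !mulmxK //.
  by rewrite !addrA.
rewrite -scalemxAl mulmxK // scaleNr scalerBr addrC -!addrA; congr (_ + (_ + _)).
by rewrite addrC.
Qed.

Section ZoneH.
Variables (R : realType) (d n : nat) (T : R) (ell : 'I_d -> R) (rhos aH beta : R).
Variables (lam : R -> 'M[R]_d) (A MH DH BH RH : R -> 'rV[R]_d -> 'M[R[i]]_n).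
Variables (G : {set {set 'I_n}}) (Ds Ns Rs : nat -> R -> 'rV[R]_d -> 'M[R[i]]_n) (m : nat).
Local Notation Z := (zoneH T ell rhos).
Local Notation ab := (abracket ell).
Let l1 := ell_star ell + 1.
Hypothesis rhos01 : 0 < rhos < 1.
Hypothesis l10 : 0 < l1.
Hypothesis partG : finset.partition G (finset.setTfor 'I_n).
Hypothesis hH : assumption_H T ell lam rhos A MH DH BH RH aH.
Hypothesis hren : renormalization_H T ell lam rhos DH BH RH G Ds Ns Rs.
Hypothesis BHbeta : forall t xi, Z (t, xi) -> mxnorm (BH t xi) <= beta.
Hypothesis beta0 : 0 <= beta.
Hypothesis m1 : (1 <= m)%N.
Hypothesis m_large : 2 * beta + l1 <= m%:R * l1.

Definition gaugeH plus rho t xi :=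
  Emx_H plus ell rho G BH t xi *m Qmx Ns m t xi *m MH t xi.

Let delta := Num.min l1 (-1 - aH).

Lemma deltaH_gt0 : 0 < delta.
Proof. by case: hH => _ _ _ [h _] _; rewrite lt_min l10 /= subr_gt0. Qed.

Lemma zoneH_z t xi : Z (t, xi) -> 1 <= zvar ell t xi.
Proof.
move=> [_ /= h]; apply: le_trans h; rewrite invf_ge1; first by case/andP: rhos01 => _ /ltW.
by case/andP: rhos01.
Qed.

Lemma zoneH_z0 t xi : Z (t, xi) -> 0 < zvar ell t xi.
Proof. by move=> /zoneH_z; exact: lt_le_trans. Qed.

Lemma zoneH_sub rho xi : 0 < rho <= rhos -> fiber (zoneH T ell rho) xi `<=` fiber Z xi.
Proof.
move=> /andP[rho0 rr] t [h1 h2]; split => //; apply: le_trans h2.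
by rewrite lef_pV2 ?posrE //; case/andP: rhos01.
Qed.

Let cBH xi : continuous_fiber (fiber Z xi) (BH ^~ xi).
Proof. by case: hH => _ [sB _] _ _ _; exact: (symbol_continuous sB). Qed.

Lemma powR_ge1_mono (z a b : R) : 1 <= z -> a <= b -> z `^ a <= z `^ b.
Proof. by move=> z1 h; exact: ler_powR. Qed.

Lemma Q_near_id_H : exists2 C : R, 0 <= C & forall t xi, Z (t, xi) ->
  mxnorm (Qmx Ns m t xi - 1%:M) <= C * zvar ell t xi `^ (- l1).
Proof.
have [|k /andP[k1 _]|C C0 hC] := @sum_bound R d n Z (fun t xi => zvar ell t xi `^ (- l1)) Ns _ 1 m.+1.
- by move=> t xi _; exact: powR_ge0.
- case: hren => /(_ k k1)[_ _ sN _] _ _.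
  have [C C0 hC] := symbS_bound zoneH_z0 sN; exists C => // t xi Vt.
  rewrite (le_trans (hC _ _ Vt)) // ler_wpM2l // powR_ge1_mono ?zoneH_z //.
  by rewrite lerN2 -/l1 ler_peMl ?ler1n // ltW.
by exists C => // t xi Vt; rewrite /Qmx addrC addKr; exact: hC.
Qed.

Lemma remainder_bound_H : exists2 C : R, 0 <= C & forall t xi, Z (t, xi) ->
  mxnorm (Gdiag_part G (RH t xi) + \sum_(2 <= k < m.+1) Ds k t xi) <=
  C * zvar ell t xi `^ (- delta - 1).
Proof.
have [C C0 hC] : exists2 C : R, 0 <= C & forall t xi, Z (t, xi) ->
    mxnorm (\sum_(2 <= k < m.+1) Ds k t xi) <= C * zvar ell t xi `^ (- delta - 1).
  apply: sum_bound => [t xi _|k /andP[k2 _]]; first exact: powR_ge0.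
  case: hren => /(_ k (ltnW k2))[sD _ _ _] _ _.
  have [C C0 hC] := symbS_bound zoneH_z0 sD; exists C => // t xi Vt.
  rewrite (le_trans (hC _ _ Vt)) // ler_wpM2l // powR_ge1_mono ?zoneH_z //.
  rewrite lerD2r lerN2 -/l1 (@le_trans _ _ l1) // ?ge_min ?lexx //.
  apply: ler_peMl; first exact: ltW.
  have : 2 <= k%:R :> R by rewrite ler_nat.
  by move=> h; lra.
case: hH => _ _ _ [_ sR] _; have [C' C'0 hC'] := symbS_bound zoneH_z0 sR.
exists (C' + C) => [|t xi Vt]; first exact: addr_ge0.
rewrite (le_trans (ler_mxnormD _ _)) // mulrDl lerD // ?hC //.
rewrite (le_trans (mxnorm_Gdiag_part _ _)) // (le_trans (hC' _ _ Vt)) // ler_wpM2l //.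
rewrite powR_ge1_mono ?zoneH_z //.
have : delta <= -1 - aH by rewrite ge_min lexx orbT.
lra.
Qed.

Lemma R_bound_H : exists2 C : R, 0 <= C & forall t xi, Z (t, xi) ->
  mxnorm (Rs m t xi) <= C * zvar ell t xi `^ (- (m%:R * l1) - 1).
Proof.
case: hren => /(_ m m1)[_ _ _ sR] _ _.
exact: (symbS_bound zoneH_z0 sR).
Qed.

(** The oscillating term is skew-adjoint: it drops out of the energy identity. *)
Lemma rdot_oscillation (D : 'M[R[i]]_n) (r : R) (y : 'cV[R[i]]_n) :
  is_diag_mx D -> (forall i j, complex.Im (D i j) = 0) ->
  rdot ((('i * r%:C) *: D) *m y) y = 0.
Proof.
move=> dD rD; have offD := is_diag_offdiag dD.
rewrite -scalemxAl /rdot big1 // => i _; rewrite big1 // => j _.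
have -> : (('i * r%:C) *: (D *m y)) i j = 'i * r%:C * (D i i * y i j).
  rewrite !mxE; congr (_ * _); rewrite (bigD1 i) //= big1 ?addr0 // => k ki.
  by rewrite offD ?mul0r // eq_sym.
have := rD i i.
by case: (D i i) (y i j) => a b [u v] /= ->; ring.
Qed.

Lemma diag_Gdiag (D : 'M[R[i]]_n) : is_diag_mx D -> is_Gdiag G D.
Proof.
move=> dD i j ij; apply: (is_diag_offdiag dD); apply: contraNneq ij => ->.
by rewrite /same_block.
Qed.

(** Zone H of a small rho1 contains only large z, where Q is close to the identity. *)
Lemma Q_half_H : exists2 rho1 : R, 0 < rho1 < rhos &
  forall t xi, zoneH T ell rho1 (t, xi) -> mxnorm (Qmx Ns m t xi - 1%:M) <= 2^-1.
Proof.
have [CQ CQ0 hQ] := Q_near_id_H; have [r r0 hr] := small_power CQ0 l10.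
have [rhos0 rhos1] := andP rhos01; pose rho1 := Num.min r (rhos / 2).
have rho10 : 0 < rho1 by rewrite lt_min r0 divr_gt0.
have rho1s : rho1 < rhos.
  by rewrite gt_min; apply/orP; right; rewrite ltr_pdivrMr // ltr_pMr // ltr1n.
exists rho1; first by rewrite rho10.
move=> t xi Vt; have Zt : Z (t, xi) by apply: (@zoneH_sub rho1) => //; rewrite rho10 ltW.
apply: le_trans (hQ _ _ Zt) _; have z0 := zoneH_z0 Zt.
have -> : zvar ell t xi `^ (- l1) = (zvar ell t xi)^-1 `^ l1.
  by rewrite !powR_expR ?invr_gt0 // lnV ?posrE // mulNr mulrN.
apply: hr; rewrite invr_gt0 z0 /= -[r]invrK lef_pV2 ?posrE ?invr_gt0 //.
case: Vt => _ /=; apply: le_trans; rewrite lef_pV2 ?posrE //.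
by rewrite ge_min lexx.
Qed.

(** In the gauged coefficient the oscillating term is skew-adjoint, the term
    t^-1 (B_G - B_(G,+)), or t^-1 (B_G - B_(G,-)), has a sign as a quadratic form, and the
    remainders are O(<<xi>> z^(- delta - 1)). *)
Lemma gaugeH_rate rho1 : 0 < rho1 < rhos ->
  (forall t xi, zoneH T ell rho1 (t, xi) -> mxnorm (Qmx Ns m t xi - 1%:M) <= 2^-1) ->
  exists2 C : R, 0 <= C & forall plus rho t xi, 0 < rho <= rho1 -> 0 < t < T ->
    rho^-1 < zvar ell t xi ->
    exists2 S, gauge_rate (gaugeH plus rho ^~ xi) (A ^~ xi) t S &
      forall y : 'cV[R[i]]_n, (if plus then rdot (S *m y) y else - rdot (S *m y) y) <=
        C * (t^-1 * zvar ell t xi `^ (- delta)) * mxnorm y ^+ 2.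
Proof.
move=> /andP[rho10 rho1s] Q1.
have [CW CW0 hW] := remainder_bound_H; have [CR CR0 hR] := R_bound_H.
pose I1 := mxnorm (1%:M : 'M[R[i]]_n); have I10 : 0 <= I1 by exact: mxnorm_ge0.
pose N2 : R := \sum_(i < n) \sum_(j < n) 1.
have N20 : 0 <= N2 by do 2 (apply: sumr_ge0 => ? _).
exists (CW + N2 * (CR * (2 * I1)) * N2); first by rewrite addr_ge0 // !mulr_ge0.
move=> plus rho t xi /andP[rho0 rhor] t0T zr; have [t0 tT] := andP t0T.
have rho0s : 0 < rho <= rhos by rewrite rho0 (le_trans rhor) // ltW.
have Vt : zoneH T ell rho (t, xi) by split; [rewrite /strip /= t0 ltW|exact: ltW].
have V1t : zoneH T ell rho1 (t, xi).
  by case: Vt => h1 h2; split => //; apply: le_trans h2; rewrite lef_pV2 ?posrE.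
have Zt : Z (t, xi) by exact: (zoneH_sub rho0s).
have z1 := zoneH_z Zt; have z0 := zoneH_z0 Zt; have ab0 := abracket_gt0 ell xi.
have tZ : nbhs t (fiber Z xi).
  by apply: (@filterS _ (nbhs t) _ _ _ (zoneH_sub rho0s) (nbhs_zoneH rho0 t0T zr)).
have ct : (ab xi)^-1 * rho^-1 < t by rewrite ltr_pdivrMl.
have ctT : (ab xi)^-1 * rho^-1 < t < T by rewrite ct.
have ctT' : (ab xi)^-1 * rho^-1 <= t <= T by rewrite !ltW.
have [uQ iQ] := near_id_unit (Q1 _ _ V1t).
have [[uM sM _] _ [_ rD] _ [dM dMV MA]] := hH.
have [dD imD] := rD _ _ Zt.
have [dN hN hRs] : exists2 dN : nat -> R -> 'rV[R]_d -> 'M[R[i]]_n,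
    (forall k, (1 <= k)%N -> is_dt Z (Ns k) (dN k)) &
    forall t xi, Z (t, xi) -> Rs m t xi = ((ab xi)^-1)%:C *: (\sum_(1 <= k < m.+1) dN k t xi)
      + Qmx Ns m t xi *m (('i * (zfun ell lam t xi)%:C) *: DH t xi +
          (((zvar ell t xi)^-1)%:C *: BH t xi + RH t xi))
      - (('i * (zfun ell lam t xi)%:C) *: DH t xi + \sum_(1 <= k < m.+1) Ds k t xi) *m Qmx Ns m t xi.
  by have [_ _ hid] := hren; apply: (renorm_identity_at _ hid); left.
have hMt : has_deriv_on setT (MH ^~ xi) t (dM t xi).
  by apply: has_deriv_on_sub (dMV _ _ Zt); apply: filterS tZ.
have abz : ab xi * (zvar ell t xi)^-1 = t^-1.
  by rewrite /zvar invfM mulrA mulfV ?mul1r // gt_eqF.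
pose P0 := ('i * (zfun ell lam t xi)%:C) *: DH t xi.
have abP0 : (ab xi)%:C *: P0 = ('i * (hfun ell lam t xi)%:C) *: DH t xi.
  rewrite /P0 scalerA mulrCA -rmorphM /zfun mulrA mulfV ?mul1r // gt_eqF //.
have MA' : MH t xi *m A t xi *m invmx (MH t xi) + dM t xi *m invmx (MH t xi) =
    (ab xi)%:C *: (P0 + (((zvar ell t xi)^-1)%:C *: BH t xi + RH t xi)).
  by rewrite (MA _ _ Zt) scalerDr abP0 scalerDr scalerA -rmorphM abz addrA.
have rQM := @gauge_rate_renorm R n (ab xi) (MH ^~ xi) (Qmx Ns m ^~ xi) (A ^~ xi) t
  (dM t xi) (\sum_(1 <= k < m.+1) dN k t xi) P0 _ (\sum_(1 <= k < m.+1) Ds k t xi) (Rs m t xi)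
  ab0 (uM _ _ Zt) uQ hMt (Qmx_deriv m tZ hN) MA' (hRs _ _ Zt).
have dE := EmxH_deriv rhos01 partG cBH plus rho0s ctT.
have uE : Emx_H plus ell rho G BH t xi \in unitmx by exact: EmxH_unit.
have rE := gauge_rate_left uE dE rQM.
have comm W : is_Gdiag G W -> Emx_H plus ell rho G BH t xi *m W = W *m Emx_H plus ell rho G BH t xi.
  by exact: EmxH_comm.
have [E1 E2] := EmxH_bound rhos01 partG cBH BHbeta beta0 plus rho0s ctT'.
rewrite -/N2 in E1 E2.
set E := Emx_H plus ell rho G BH t xi in rE comm uE E1 E2.
pose BG := Gdiag_part G (BH t xi).
pose D2 := Gdiag_part G (RH t xi) + \sum_(2 <= k < m.+1) Ds k t xi.
have hDs : \sum_(1 <= k < m.+1) Ds k t xi = ((zvar ell t xi)^-1)%:C *: BG + D2.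
  rewrite big_ltn // addrA; congr (_ + _).
  by have [_ -> // _] := hren; rewrite Gdiag_partD Gdiag_partZ.
have GD2 : is_Gdiag G D2.
  move=> i j ij; rewrite mxE Gdiag_part_Gdiag // add0r summxE big_nat big1 // => k /andP[k2 _].
  have [/(_ k (ltnW k2))[_ hd _ _] _ _] := hren.
  exact: (hd _ _ Zt _ _ ij).
have GP0 : is_Gdiag G P0 by move=> i j ij; rewrite mxE (diag_Gdiag dD ij) mulr0.
rewrite hDs (conj_block_commuting _ _ uE (comm _ GP0) (comm _ (@Gdiag_part_Gdiag _ _ G _))
  (comm _ GD2) abz) in rE.
have hWt := hW _ _ Zt; have hRt := hR _ _ Zt; rewrite -/D2 in hWt.
set W := D2 + E *m (Rs m t xi *m invmx (Qmx Ns m t xi)) *m invmx E in rE.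
have bW : mxnorm W <= (CW + N2 * (CR * (2 * I1)) * N2) * zvar ell t xi `^ (- delta - 1).
  rewrite /W (le_trans (ler_mxnormD _ _)) // mulrDl lerD //.
  set z := zvar ell t xi in z0 z1 E1 E2 hRt *.
  apply: (@le_trans _ _ (N2 * z `^ beta * (CR * z `^ (- (m%:R * l1) - 1) * (2 * I1)) * (N2 * z `^ beta))).
    apply: (le_trans (mxnormM _ _)); apply: ler_pM; rewrite ?mxnorm_ge0 //.
    apply: (le_trans (mxnormM _ _)); apply: ler_pM; rewrite ?mxnorm_ge0 //.
    by apply: (le_trans (mxnormM _ _)); apply: ler_pM; rewrite ?mxnorm_ge0.
  have -> : N2 * z `^ beta * (CR * z `^ (- (m%:R * l1) - 1) * (2 * I1)) * (N2 * z `^ beta) =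
      N2 * (CR * (2 * I1)) * N2 * (z `^ (- (m%:R * l1) - 1) * (z `^ beta * z `^ beta)) by ring.
  apply: ler_wpM2l; first by rewrite !mulr_ge0.
  rewrite -!powR_addr //; apply: powR_ge1_mono => //.
  have : delta <= l1 by rewrite ge_min lexx.
  by move: delta (m%:R * l1) m_large => x q hq hx; lra.
eexists.
  by rewrite /gaugeH; under eq_fun do rewrite -mulmxA; exact: rE.
move=> y.
have abW : mxnorm ((ab xi)%:C *: W) <=
    (CW + N2 * (CR * (2 * I1)) * N2) * (t^-1 * zvar ell t xi `^ (- delta)).
  rewrite mxnormZr gtr0_norm //; apply: (le_trans (ler_wpM2l (ltW ab0) bW)).
  by rewrite mulrCA powR_addr // powR_inv1 ?(ltW z0) // [ab xi * _]mulrCA abz [_ * t^-1]mulrC.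
have rW := rdot_mul_bound y abW.
rewrite !mulmxDl !rdotDl abP0 rdot_oscillation // add0r -scalemxAl rdotZl mulmxBl rdotDl rdotNl.
have t1 : 0 <= t^-1 by rewrite invr_ge0 ltW.
move: rW; rewrite ler_norml => /andP[rW1 rW2].
set Mu := diag_mx _.
have form : (if plus then rdot (BG *m y) y - rdot (Mu *m y) y
             else rdot (Mu *m y) y - rdot (BG *m y) y) <= 0.
  rewrite /Mu /extremal; case: (plus); rewrite subr_le0.
    by apply: rdot_Gdiag_le => //; exact: Gdiag_part_Gdiag.
  by apply: rdot_Gdiag_ge => //; exact: Gdiag_part_Gdiag.
move: form rW1 rW2; move: (rdot (BG *m y) y) (rdot (Mu *m y) y) (rdot (_ *m y) y) (_ * mxnorm y ^+ 2).
move=> p q w k form rW1 rW2; move: form; case: (plus) => form.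
  by have := mulr_ge0_le0 t1 form; lra.
by have := mulr_ge0_le0 t1 form; lra.
Qed.

Lemma gaugeH_bound rho1 rho : 0 < rho <= rho1 -> rho1 <= rhos ->
  (forall t xi, zoneH T ell rho1 (t, xi) -> mxnorm (Qmx Ns m t xi - 1%:M) <= 2^-1) ->
  exists2 C : R, 0 <= C & forall plus t xi, zoneH T ell rho (t, xi) ->
    [/\ gaugeH plus rho t xi \in unitmx,
        mxnorm (gaugeH plus rho t xi) <= C * zvar ell t xi `^ beta
      & mxnorm (invmx (gaugeH plus rho t xi)) <= C * zvar ell t xi `^ beta].
Proof.
move=> /andP[rho0 rhor] rho1s Q1; have [[uM sM sM'] _ _ _ _] := hH.
have [CM CM0 hM] := symbS_bound zoneH_z0 sM; have [CM' CM'0 hM'] := symbS_bound zoneH_z0 sM'.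
pose I1 := mxnorm (1%:M : 'M[R[i]]_n); have I10 : 0 <= I1 by exact: mxnorm_ge0.
pose N2 : R := \sum_(i < n) \sum_(j < n) 1.
have N20 : 0 <= N2 by do 2 (apply: sumr_ge0 => ? _).
exists (N2 * (2^-1 + I1) * CM + CM' * (2 * I1) * N2).
  by rewrite addr_ge0 // !mulr_ge0 // addr_ge0.
move=> plus t xi Vt; have rho0s : 0 < rho <= rhos by rewrite rho0 (le_trans rhor).
have Zt : Z (t, xi) by exact: (zoneH_sub rho0s).
have V1t : zoneH T ell rho1 (t, xi).
  by case: Vt => h1 h2; split => //; apply: le_trans h2; rewrite lef_pV2 ?posrE // (lt_le_trans rho0).
have ctT : (ab xi)^-1 * rho^-1 <= t <= T.
  by case: Vt => /andP[_ ->] /= h; rewrite andbT ler_pdivrMl ?abracket_gt0.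
have [E1 E2] := EmxH_bound rhos01 partG cBH BHbeta beta0 plus rho0s ctT; rewrite -/N2 in E1 E2.
have hMt := hM _ _ Zt; have hM't := hM' _ _ Zt.
rewrite powRr0 mulr1 in hMt; rewrite powRr0 mulr1 in hM't.
have uE : Emx_H plus ell rho G BH t xi \in unitmx by exact: EmxH_unit.
have [uG G1 G2] := gauge_product_bound uE (uM _ _ Zt) (Q1 _ _ V1t) E1 E2 hMt hM't.
have p0 : 0 <= zvar ell t xi `^ beta by exact: powR_ge0.
split=> //; [apply: (le_trans G1)|apply: (le_trans G2)].
  by rewrite -/I1 -!mulrA [zvar _ _ _ `^ _ * _]mulrC !mulrA ler_wpM2r // lerDl !mulr_ge0.
by rewrite -/I1 !mulrA ler_wpM2r // lerDr !mulr_ge0 // addr_ge0.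
Qed.

Lemma gaugeH_continuous plus rho xi : 0 < rho <= rhos ->
  continuous_fiber (fiber (zoneH T ell rho) xi) (gaugeH plus rho ^~ xi).
Proof.
have [[_ sM _] _ _ _ _] := hH; move=> rho0s.
have sub := @zoneH_sub rho xi rho0s.
move=> t Vt; apply: mxcvgM; last exact: (continuous_fiber_sub sub (@symbol_continuous _ _ _ _ _ _ _ sM xi) Vt).
apply: mxcvgM; last first.
  apply: (continuous_fiber_sub sub _ Vt).
  by apply: Qmx_continuous => k k1; have [/(_ k k1)[_ _ sN _] _ _] := hren; exact: (symbol_continuous sN).
have fib s : fiber (zoneH T ell rho) xi s -> (ab xi)^-1 * rho^-1 <= s <= T.
  by case=> /andP[_ ->] /= h; rewrite andbT ler_pdivrMl ?abracket_gt0.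
have cT : (ab xi)^-1 * rho^-1 <= T by case/andP: (fib _ Vt) => h1 h2; exact: le_trans h2.
have cE := EmxH_continuous rhos01 partG cBH plus rho0s cT.
by apply: (continuous_fiber_sub _ cE) => // s /fib; rewrite /= in_itv.
Qed.

End ZoneH.

(** * Continuity of the coefficient matrix *)

Section CoefficientContinuity.
Variables (R : realType) (d n : nat) (T : R) (ell : 'I_d -> R) (rhos aP aH alpha c0 : R).
Variables (lam0 : 'M[R]_d) (lams : R -> 'M[R]_d).
Variables (A MP RP MH DH BH RH : R -> 'rV[R]_d -> 'M[R[i]]_n) (BP : 'rV[R]_d -> 'M[R[i]]_n).
Local Notation lam := (fun t => lam0 + lams t).
Local Notation ab := (abracket ell).
Hypothesis rhos01 : 0 < rhos < 1.
Hypothesis hspeed : speed_assumption T ell alpha lam0 lams c0.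
Hypothesis hI : assumption_I T ell rhos A.
Hypothesis hP : assumption_P T ell rhos A MP BP RP aP.
Hypothesis hH : assumption_H T ell lam rhos A MH DH BH RH aH.

Lemma hfun_continuous xi : continuous_real `]0, T] (fun t => hfun ell lam t xi).
Proof.
move=> t Dt; have /andP[t0 tT] : 0 < t <= T by move: Dt; rewrite /= in_itv.
have [[g [g0 gd _]] _] := hspeed.
have clam i j : (lams s) i j @[s --> within `]0, T] (nbhs t)] --> (lams t) i j.
  have h : mxcvg (within `]0, T] (nbhs t)) (fun s => map_mx (real_complex R) (lams s))
      (map_mx (real_complex R) (lams t)).
    rewrite -g0 ?t0 //; apply: mxcvg_near (has_deriv_on_cvg (gd 0%N t _)); last by rewrite t0.
    apply: (@filterS _ (nbhs t) _ (fun=> True)); last exact: filterT.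
    by move=> s _ Ds; rewrite g0 //; move: Ds; rewrite /= in_itv.
  have e s : complex.Re ((map_mx (real_complex R) (lams s)) i j) = lams s i j by rewrite mxE.
  rewrite -e (_ : (fun s => lams s i j) = fun s => complex.Re ((map_mx (real_complex R) (lams s)) i j)).
    exact: (mxcvg_Re (i := i) (j := j) h).
  by apply/funext => s; rewrite e.
suff h : hsq ell lam s xi @[s --> within `]0, T] (nbhs t)] --> hsq ell lam t xi.
  exact: cvg_comp h (@sqrt_continuous R _).
rewrite /hsq; apply: cvgr_sum => i; apply: cvgr_sum => j.
apply: cvgM; last exact: cvg_cst.
apply: cvgM; last exact: cvg_cst.
apply: cvgM.
  have [dp _] := is_derive1_powR (ell i + ell j) t0.
  apply: cvg_within_filter.
  have : {for t, continuous (fun s : R => s `^ (ell i + ell j))}.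
    by apply: differentiable_continuous; apply/derivable1_diffP.
  exact.
rewrite mxE; under eq_fun do rewrite mxE.
by apply: cvgD; [exact: cvg_cst|exact: clam].
Qed.

Lemma inv_time_continuous (D : set R) (t : R) : 0 < t ->
  (fun s : R => s^-1) @ within D (nbhs t) --> t^-1.
Proof. by move=> t0; apply: cvg_within_filter; apply: cvgV; [rewrite gt_eqF|exact: cvg_id]. Qed.

(** In the interior of each zone A is recovered from the conjugated system; the open
    zones cover (0, T] because zone I is taken for a smaller parameter. *)
Lemma coefficient_continuous xi : continuous_fiber `]0, T] (A ^~ xi).
Proof.
move=> t Dt; have t0T : 0 < t <= T by move: Dt; rewrite /= in_itv.
have [t0 tT] := andP t0T; have [rho0 rho1] := andP rhos01.
have ab0 := abracket_gt0 ell xi.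
have cz : ab xi * s @[s --> nbhs t] --> ab xi * t by apply: cvgM; [exact: cvg_cst|exact: cvg_id].
have near_lt c : ab xi * t < c -> \forall s \near t, ab xi * s < c.
  by move=> h; exact: (cz [set x | x < c] (lt_nbhsl h)).
have near_gt c : c < ab xi * t -> \forall s \near t, c < ab xi * s.
  by move=> h; exact: (cz [set x | c < x] (lt_nbhsr h)).
have inD (s : R) : `]0, T]%classic s -> 0 < s <= T by rewrite /= in_itv.
have [zP|zP] := ltP (ab xi * t) rhos.
  have app s : 0 < s <= T -> ab xi * s < rhos -> left_approachable (fiber (zoneP T ell rhos) xi) s.
    move=> /andP[s0 sT] sr; split; first by split; [rewrite /strip /= s0|exact: ltW].
    exists 0 => // s' /andP[s'0 s's]; split; first by rewrite /strip /= s'0 (le_trans (ltW s's)).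
    by rewrite /= /zvar (le_trans _ (ltW sr)) // ler_pM2l // ltW.
  have [sM _ _ [_ [p sR]] cj] := hP.
  apply: (conj_continuous_at _ _ (app t t0T zP) sM _ cj).
  - by move=> s [/andP[]].
  - by apply: (@filterS _ (nbhs t) _ _ _ _ (near_lt _ zP)) => s sr Ds; apply: app => //; exact: inD.
  - move=> s Vs; apply: mxcvgD.
      by apply: mxcvgZ; [apply: inv_time_continuous; case: Vs => /andP[]|exact: mxcvg_cst].
    by apply: mxcvgZc; exact: (symbol_continuous sR).
have [zH|zH] := ltP rhos^-1 (ab xi * t).
  have app s : 0 < s <= T -> rhos^-1 < ab xi * s -> left_approachable (fiber (zoneH T ell rhos) xi) s.
    move=> /andP[s0 sT] sr; split; first by split; [rewrite /strip /= s0|exact: ltW].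
    exists (rhos^-1 / ab xi); first by rewrite ltr_pdivrMr // mulrC.
    move=> s' /andP[h s's]; split; last by rewrite /= /zvar mulrC -ler_pdivrMr // ltW.
    by rewrite /strip /= (le_trans (ltW s's)) // andbT (lt_trans _ h) // divr_gt0 ?invr_gt0.
  have [sM [sB _] [sD _] [_ sR] cj] := hH.
  apply: (conj_continuous_at _ _ (app t t0T zH) sM _ cj).
  - by move=> s [/andP[]].
  - by apply: (@filterS _ (nbhs t) _ _ _ _ (near_gt _ zH)) => s sr Ds; apply: app => //; exact: inD.
  - move=> s Vs; have s0 : 0 < s by case: Vs => /andP[].
    apply: mxcvgD; last by apply: mxcvgZc; exact: (symbol_continuous sR).
    apply: mxcvgD; last by apply: mxcvgZ; [exact: inv_time_continuous|exact: (symbol_continuous sB)].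
    rewrite -scalerA; under eq_fun do rewrite -scalerA.
    apply: mxcvgZc; apply: mxcvgZ; last exact: (symbol_continuous sD).
    have Ts : `]0, T]%classic s by case: Vs => h _; rewrite /= in_itv.
    have h := @hfun_continuous xi s Ts.
    apply: cvg_trans h; apply: cvg_app => P VP.
    have {}VP : nbhs s (fun s => `]0, T]%classic s -> P s) by [].
    suff : nbhs s (fun s => fiber (zoneH T ell rhos) xi s -> P s) by [].
    by apply: filterS VP => r h' [r0 _]; apply: h'; rewrite /= in_itv.
have r2 : 0 < rhos / 2 <= rhos.
  by rewrite divr_gt0 //= ler_pdivrMr // ler_pMr // ler1n.
have [_ r2s] := andP r2.
have r2lt : rhos / 2 < rhos by rewrite ltr_pdivrMr // ltr_pMr // ltr1n.
have sA := hI r2; have cA := @symbol_continuous _ _ _ _ _ _ _ sA xi.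
have z1 : rhos / 2 < ab xi * t by exact: lt_le_trans zP.
have z2 : ab xi * t < (rhos / 2)^-1.
  by apply: le_lt_trans zH _; rewrite ltf_pV2 ?posrE // divr_gt0.
have Vt : fiber (zoneI T ell (rhos / 2)) xi t by split; [|rewrite /zvar /= !ltW].
have ct := cA t Vt.
have e s : A s xi = (ab xi)%:C *: ((ab xi)^-1%:C *: A s xi).
  by rewrite scalerA -rmorphM mulfV ?gt_eqF // scale1r.
rewrite (_ : A ^~ xi = fun s => (ab xi)%:C *: ((ab xi)^-1%:C *: A s xi)); last first.
  by apply/funext => s; exact: e.
rewrite e; apply: mxcvgZc.
apply: mxcvg_sub ct => P VP.
have {}VP : nbhs t (fun s => fiber (zoneI T ell (rhos / 2)) xi s -> P s) by [].
suff : nbhs t (fun s => `]0, T]%classic s -> P s) by [].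
apply: (@filterS3 _ (nbhs t) _ _ _ _ _ _ VP (near_gt _ z1) (near_lt _ z2)) => s hP' s1 s2 /inD Ds.
by apply: hP'; split => //; rewrite /zvar /= !ltW.
Qed.

End CoefficientContinuity.

(** * Increments of primitives *)

Section Primitives.
Variable R : realType.
Local Notation mu := (@lebesgue_measure R).
Implicit Types (h g : R -> R) (T a b : R).

Lemma primitive_mono h T a b : mu.-integrable `]0, T] (EFin \o h) -> (forall t, 0 <= h t) ->
  0 <= a -> a <= b -> b <= T ->
  0 <= \int[mu]_(x in `]0, b]) h x - \int[mu]_(x in `]0, a]) h x.
Proof.
move=> ih h0 a0 ab bT; rewrite Rintegral_itvB.
- by apply: Rintegral_ge0 => x _.
- by apply: integrableS ih => //; apply: subset_itvl.
- by rewrite bnd_simp.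
- by rewrite bnd_simp.
Qed.

Lemma primitive_increment h g T a b : mu.-integrable `]0, T] (EFin \o h) ->
  0 < a -> a <= b -> b <= T -> (forall t, a < t < b -> h t = g t) ->
  continuous_real `[a, b] g ->
  \int[mu]_(x in `]0, b]) h x - \int[mu]_(x in `]0, a]) h x = \int[mu]_(x in `[a, b]) g x.
Proof.
move=> ih a0 ab bT hg cg; rewrite Rintegral_itvB ?bnd_simp ?(ltW a0) //; last first.
  by apply: integrableS ih => //; apply: subset_itvl; rewrite bnd_simp.
have iab (f : R -> R) c (u v : itv_bound R) : mu.-integrable [set` Interval c (BRight b)] (EFin \o f) ->
    (c <= u)%O -> (v <= BRight b)%O -> mu.-integrable [set` Interval u v] (EFin \o f).
  by move=> ic cu vb; apply: integrableS ic => //; exact: subset_itv.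
have i0b : mu.-integrable `]0, b] (EFin \o h).
  by apply: integrableS ih => //; apply: subset_itvl; rewrite bnd_simp.
rewrite -(@Rintegral_itv_bndo_bndc _ (BRight a) b); last first.
  by apply: iab i0b _ _; rewrite bnd_simp // ltW.
have igcc := integrable_continuous_real cg.
rewrite -(@Rintegral_itv_obnd_cbnd _ a (BRight b)); last first.
  by apply: iab igcc _ _; rewrite bnd_simp.
rewrite -(@Rintegral_itv_bndo_bndc _ (BRight a) b); last first.
  by apply: iab igcc _ _; rewrite bnd_simp.
by apply: eq_Rintegral => x; rewrite inE /= in_itv /=; exact: hg.
Qed.

End Primitives.

(** * Gluing the zones at a fixed frequency *)

Section OneSidedEstimates.
Variable R : realType.
Implicit Types (y Phi : R -> R) (a b c C : R).

Definition propagates (plus : bool) y Phi C a b : Prop :=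
  if plus then y b <= C * (y a + (Phi b - Phi a)) else y a <= C * (y b + (Phi b - Phi a)).

Lemma propagates_refl plus y Phi C a : 0 <= y a -> 1 <= C -> propagates plus y Phi C a a.
Proof. by move=> y0 C1; rewrite /propagates subrr addr0; case: plus; rewrite ler_peMl. Qed.

Lemma propagates_trans plus y Phi C C' a b c : 1 <= C -> 1 <= C' ->
  (forall t, 0 <= y t) -> Phi a <= Phi b -> Phi b <= Phi c ->
  propagates plus y Phi C a b -> propagates plus y Phi C' b c ->
  propagates plus y Phi (C' * C) a c.
Proof.
move=> C1 C'1 y0 Pab Pbc; rewrite /propagates.
have p0 : 0 <= Phi b - Phi a by rewrite subr_ge0.
have q0 : 0 <= Phi c - Phi b by rewrite subr_ge0.
have -> : Phi c - Phi a = (Phi b - Phi a) + (Phi c - Phi b) by ring.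
move: p0 q0 (y0 a) (y0 b) (y0 c); move: (Phi b - Phi a) (Phi c - Phi b) (y a) (y b) (y c).
move=> p q ya yb yc p0 q0 ya0 yb0 yc0.
have C'0 : 0 <= C' by exact: le_trans ler01 C'1.
have C0 : 0 <= C by exact: le_trans ler01 C1.
case: plus => h1 h2.
  apply: (le_trans h2); rewrite -mulrA ler_wpM2l // addrA mulrDr lerD // ler_peMl //.
apply: (le_trans h1); rewrite [C' * C]mulrC -mulrA ler_wpM2l //.
rewrite [p + q]addrC addrA mulrDr lerD // ler_peMl //.
Qed.

Lemma derive_continuous_real (D : set R) (f : R -> R) :
  (forall t, D t -> exists l, is_derive t 1 f l) -> continuous_real D f.
Proof.
move=> df t Dt; have [l [dft _]] := df _ Dt; apply: cvg_within_filter.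
have : {for t, continuous f} by apply: differentiable_continuous; apply/derivable1_diffP.
exact.
Qed.

End OneSidedEstimates.

(** All that is used at one frequency: a gauge in zone P with an integrable rate, a gauge
    in zone H with a one-sided integrable rate, and bounds at the zone boundaries, where
    the gauges meet the identity.  The constants CP, ..., kap are common to all
    frequencies, whereas ab, that is <<xi>>, is not. *)
Record adapted_gauges (R : realType) (n : nat) (T ab rho : R) (A GP GH : R -> 'M[R[i]]_n)
    (CP eP CI CH eH kap : R) (plus : bool) : Prop := AdaptedGauges {
  time_gt0 : 0 < T;
  bracket_gt0 : 0 < ab;
  rho_itv : 0 < rho < 1;
  coef_continuous : continuous_fiber `]0, T] A;
  gaugeP_cont : continuous_fiber [set t | 0 < t <= T /\ ab * t <= rho] GP;
  gaugeH_cont : continuous_fiber [set t | 0 < t <= T /\ rho^-1 <= ab * t] GH;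
  CP_ge0 : 0 <= CP; CI_ge0 : 0 <= CI; CH_ge0 : 0 <= CH; eP_gt0 : 0 < eP; eH_gt0 : 0 < eH;
  kap_ge1 : 1 <= kap;
  rate_P : forall t, 0 < t < T -> ab * t <= rho ->
    exists2 S, gauge_rate GP A t S & mxnorm S <= CP * (t^-1 * (ab * t) `^ eP);
  bound_I : forall t, 0 < t <= T -> rho <= ab * t <= rho^-1 -> mxnorm (A t) <= CI * ab;
  rate_H : forall t, 0 < t < T -> rho^-1 < ab * t ->
    exists2 S, gauge_rate GH A t S & forall y : 'cV[R[i]]_n,
      (if plus then rdot (S *m y) y else - rdot (S *m y) y) <=
        CH * (t^-1 * (ab * t) `^ (- eH)) * mxnorm y ^+ 2;
  unit_P : forall t, 0 < t <= T -> ab * t <= rho -> GP t \in unitmx;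
  unit_H : forall t, 0 < t <= T -> rho^-1 <= ab * t -> GH t \in unitmx;
  match_P : forall t, 0 < t <= T -> ab * t = rho ->
    mxnorm (GP t) <= kap /\ mxnorm (invmx (GP t)) <= kap;
  match_H : forall t, 0 < t <= T -> ab * t = rho^-1 ->
    mxnorm (GH t) <= kap /\ mxnorm (invmx (GH t)) <= kap }.

Section Assembly.
Variables (R : realType) (n : nat) (T ab rho : R) (A GP GH : R -> 'M[R[i]]_n).
Variables (CP eP CI CH eH kap : R) (plus : bool).
Local Notation mu := (@lebesgue_measure R).
Hypothesis ag : adapted_gauges T ab rho A GP GH CP eP CI CH eH kap plus.
Let ab0 := bracket_gt0 ag.
Let rho01 := rho_itv ag.
Let cGP := gaugeP_cont ag.
Let cGH := gaugeH_cont ag.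
Let CP0 := CP_ge0 ag.
Let CI0 := CI_ge0 ag.
Let CH0 := CH_ge0 ag.
Let eP0 := eP_gt0 ag.
Let eH0 := eH_gt0 ag.
Let kap1 := kap_ge1 ag.
Let rateP := rate_P ag.
Let boundI := bound_I ag.
Let rateH := rate_H ag.
Let unitP := unit_P ag.
Let unitH := unit_H ag.
Let matchP := match_P ag.
Let matchH := match_H ag.

(** The matrix that takes U to U_A. *)
Definition piecewise_gauge t : 'M[R[i]]_n :=
  if ab * t < rho then GP t else if ab * t <= rho^-1 then 1%:M else GH t.
Local Notation W := piecewise_gauge.

Let rho0 : 0 < rho. Proof. by case/andP: rho01. Qed.
Let kap0 : 0 <= kap. Proof. exact: le_trans ler01 kap1. Qed.
Let rhoV : rho < rho^-1.
Proof. by case/andP: rho01 => _ h; apply: (lt_trans h); rewrite invf_gt1. Qed.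

Lemma piecewise_gauge_unit t : 0 < t <= T -> W t \in unitmx.
Proof.
move=> tT; rewrite /W; case: ifPn => [/ltW h|_]; first exact: unitP.
case: ifPn => [_|]; first exact: unitmx1.
by rewrite -ltNge => /ltW h; exact: unitH.
Qed.

(** At the two zone boundaries the piecewise gauge differs from the continuous gauge G0
    of the adjacent zone; kap bounds the jump. *)
Definition comparable_at (G0 : R -> 'M[R[i]]_n) t : Prop := forall X : 'cV[R[i]]_n,
  mxnorm (W t *m X) <= kap * mxnorm (G0 t *m X) /\ mxnorm (G0 t *m X) <= kap * mxnorm (W t *m X).

Lemma comparable_eq G0 t : W t = G0 t -> comparable_at G0 t.
Proof. by move=> e X; rewrite e; split; apply: ler_peMl => //; exact: mxnorm_ge0. Qed.

Lemma comparable_jump G0 t : W t = 1%:M -> G0 t \in unitmx ->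
  mxnorm (G0 t) <= kap -> mxnorm (invmx (G0 t)) <= kap -> comparable_at G0 t.
Proof.
move=> e uG h1 h2 X; rewrite e mul1mx; split.
  rewrite -[X in mxnorm X <= _](mulKmx uG) (le_trans (mxnormM _ _)) // ler_wpM2r //.
  exact: mxnorm_ge0.
by rewrite (le_trans (mxnormM _ _)) // ler_wpM2r // mxnorm_ge0.
Qed.

Lemma gaugeP_comparable t : 0 < t <= T -> ab * t <= rho -> comparable_at GP t.
Proof.
move=> tT; rewrite le_eqVlt => /predU1P[e|h]; last by apply: comparable_eq; rewrite /W h.
have [h1 h2] := matchP tT e; apply: comparable_jump => //.
  by rewrite /W e ltxx (ltW rhoV).
by apply: unitP => //; rewrite e.
Qed.

Lemma gaugeH_comparable t : 0 < t <= T -> rho^-1 <= ab * t -> comparable_at GH t.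
Proof.
move=> tT; rewrite le_eqVlt => /predU1P[/esym e|h].
  have [h1 h2] := matchH tT e; apply: comparable_jump => //.
    by rewrite /W e ltNge (ltW rhoV) /= lexx.
  by apply: unitH => //; rewrite e.
by apply: comparable_eq; rewrite /W ltNge (ltW (lt_trans rhoV h)) /= leNgt h.
Qed.

Section Solution.
Variables (U F : R -> 'cV[R[i]]_n).
Hypotheses (cU : continuous_fiber `]0, T] U) (cF : continuous_fiber `]0, T] F).
Hypothesis dU : forall t, 0 < t < T -> has_deriv_on setT U t (A t *m U t + F t).

Local Notation y := (fun t => mxnorm (W t *m U t)).
Local Notation h := (fun t => mxnorm (W t *m F t)).
Definition forcing t := \int[mu]_(x in `]0, t]) h x.

Hypothesis ih : mu.-integrable `]0, T] (EFin \o h).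

Let sub_cc a b : 0 < a -> b <= T -> `[a, b]%classic `<=` `]0, T]%classic.
Proof. by move=> a0 bT; apply: subset_itv; rewrite bnd_simp. Qed.

Lemma forcing_mono a b : 0 <= a -> a <= b -> b <= T -> forcing a <= forcing b.
Proof.
by move=> *; rewrite -subr_ge0; apply: (primitive_mono ih) => // t; exact: mxnorm_ge0.
Qed.

(** The energy estimate in one zone; the jumps at its two ends cost kap ^ 2. *)
Lemma piece_estimate s (G0 : R -> 'M[R[i]]_n) (K kappa : R -> R) c a b : 0 < a -> a <= b -> b <= T ->
  continuous_fiber `[a, b] G0 -> (forall t, a < t < b -> W t = G0 t) ->
  comparable_at G0 a -> comparable_at G0 b ->
  (forall t, a <= t <= b -> is_derive t 1 K (kappa t)) ->
  (forall t, a < t < b -> 0 <= kappa t) -> K b - K a <= c ->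
  (forall t, a < t < b -> exists2 S, gauge_rate G0 A t S & forall y : 'cV[R[i]]_n,
     (if s then rdot (S *m y) y else - rdot (S *m y) y) <= kappa t * mxnorm y ^+ 2) ->
  propagates s y forcing (kap ^+ 2 * expR c) a b.
Proof.
move=> a0 ab_ bT cG WG Ca Cb dK k0 Kc rS.
have cU' := continuous_fiber_sub (sub_cc a0 bT) cU.
have cF' := continuous_fiber_sub (sub_cc a0 bT) cF.
have [S hS] : {S : R -> 'M[R[i]]_n & forall t, a < t < b -> gauge_rate G0 A t (S t) /\
    forall y : 'cV[R[i]]_n, (if s then rdot (S t *m y) y else - rdot (S t *m y) y) <=
      kappa t * mxnorm y ^+ 2}.
  apply: (@boolp.choice _ _ (fun t S => a < t < b -> gauge_rate G0 A t S /\
    forall y : 'cV[R[i]]_n, (if s then rdot (S *m y) y else - rdot (S *m y) y) <=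
      kappa t * mxnorm y ^+ 2)) => t; have [tab|] := boolP (a < t < b); last by exists 0.
  by have [S h1 h2] := rS t tab; exists S.
have dU' t : a < t < b -> has_deriv_on setT U t (A t *m U t + F t).
  by move=> /andP[at_ tb]; apply: dU; rewrite (lt_trans a0) //= (lt_le_trans tb).
have cK : continuous_real `[a, b] K.
  by apply: derive_continuous_real => t; rewrite /= in_itv /= => /dK dKt; exists (kappa t).
have dK' t : a < t < b -> is_derive t 1 K (kappa t).
  by move=> /andP[at_ tb]; apply: dK; rewrite !ltW.
have g1 t : a < t < b -> gauge_rate G0 A t (S t) by move=> /hS[].
have g2 t : a < t < b -> forall y : 'cV[R[i]]_n,
    (if s then rdot (S t *m y) y else - rdot (S t *m y) y) <= kappa t * mxnorm y ^+ 2.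
  by move=> /hS[].
have := gauge_estimate ab_ cG cU' cF' dU' g1 cK dK' k0 Kc g2.
have cg : continuous_real `[a, b] (fun x => mxnorm (G0 x *m F x)).
  by apply: continuous_fiber_mxnorm => t Dt; apply: mxcvgM; [exact: cG|exact: cF'].
have hg t : a < t < b -> h t = mxnorm (G0 t *m F t) by move=> /WG ->.
rewrite /= -(primitive_increment ih a0 ab_ bT hg cg) -!/(forcing _).
have p0 : 0 <= forcing b - forcing a by rewrite subr_ge0 forcing_mono // ltW.
have [Ca1 Ca2] := Ca (U a); have [Cb1 Cb2] := Cb (U b); rewrite /propagates.
move: p0 Ca1 Ca2 Cb1 Cb2 (mxnorm_ge0 (W a *m U a)) (mxnorm_ge0 (W b *m U b)) (expR_ge0 c).
move: (forcing b - forcing a) (mxnorm (W a *m U a)) (mxnorm (W b *m U b))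
  (mxnorm (G0 a *m U a)) (mxnorm (G0 b *m U b)) (expR c).
move=> p wa wb ga gb e p0 Ca1 Ca2 Cb1 Cb2 wa0 wb0 e0.
have e2 : kap ^+ 2 * e = kap * (e * kap) by ring.
have pk : p <= kap * p by rewrite ler_peMl.
rewrite e2; case: (s) => hh.
  apply: (le_trans Cb1); rewrite -!mulrA ler_wpM2l // (le_trans hh) // ler_wpM2l //.
  by rewrite mulrDr lerD.
apply: (le_trans Ca1); rewrite -!mulrA ler_wpM2l // (le_trans hh) // ler_wpM2l //.
by rewrite mulrDr lerD.
Qed.

(** The norm of the coefficient is integrable, so both directions of time are covered. *)
Lemma propagates_P s a b : 0 < a -> a <= b -> b <= T -> ab * b <= rho ->
  propagates s y forcing (kap ^+ 2 * expR (CP / eP)) a b.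
Proof.
move=> a0 ab_ bT zb.
have fib t : a <= t <= b -> 0 < t <= T /\ ab * t <= rho.
  move=> /andP[at_ tb]; rewrite (lt_le_trans a0) //= (le_trans tb) //; split => //.
  by rewrite (le_trans _ zb) // ler_pM2l.
have dK t : a <= t <= b -> is_derive t 1 (fun s => CP / eP * (ab * s) `^ eP) (CP * (t^-1 * (ab * t) `^ eP)).
  by move=> /fib[/andP[t0 _] _]; apply: is_derive_powR_scaled => //; rewrite gt_eqF.
have cc t : a < t < b -> a <= t <= b by move=> /andP[? ?]; rewrite !ltW.
apply: (@piece_estimate s GP _ _ _ a b a0 ab_ bT _ _ _ _ dK).
- by apply: continuous_fiber_sub cGP => t; rewrite /= in_itv /=; exact: fib.
- move=> t /andP[at_ tb]; rewrite /W (_ : ab * t < rho) //.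
  by rewrite (lt_le_trans _ zb) // ltr_pM2l.
- by have [] := fib a; rewrite ?lexx // => *; exact: gaugeP_comparable.
- by have [] := fib b; rewrite ?lexx ?ab_ // => *; exact: gaugeP_comparable.
- by move=> t /cc/fib[/andP[t0 _] _]; rewrite mulr_ge0 // mulr_ge0 ?powR_ge0 // invr_ge0 ltW.
- have c0 : 0 <= CP / eP by rewrite divr_ge0 // ltW.
  apply: (@le_trans _ _ (CP / eP * (ab * b) `^ eP)); first by rewrite gerBl mulr_ge0 // powR_ge0.
  rewrite -[leRHS]mulr1 ler_wpM2l //; have -> : 1 = 1 `^ eP :> R by rewrite powR1.
  rewrite ge0_ler_powR ?nnegrE ?(ltW eP0) //.
    by rewrite mulr_ge0 ?(ltW ab0) // (le_trans (ltW a0)).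
  by apply: (le_trans zb); rewrite ltW //; case/andP: rho01.
- move=> t tab; have [/andP[t0 tT] zt] := fib t (cc t tab).
  have [|//|S g hS] := @rateP t.
    by rewrite t0 (lt_le_trans _ bT) //; case/andP: tab.
  exists S => // v; have := rdot_mul_bound v hS; rewrite ler_norml => /andP[h1 h2].
  by case: (s) => //; rewrite lerNl.
Qed.

Lemma propagates_I s a b : 0 < a -> a <= b -> b <= T -> rho <= ab * a -> ab * b <= rho^-1 ->
  propagates s y forcing (kap ^+ 2 * expR (CI / rho)) a b.
Proof.
move=> a0 ab_ bT za zb.
have fib t : a <= t <= b -> 0 < t <= T /\ rho <= ab * t <= rho^-1.
  move=> /andP[at_ tb]; rewrite (lt_le_trans a0) //= (le_trans tb) //; split => //.
  rewrite (le_trans za) ?ler_pM2l //= (le_trans _ zb) // ler_pM2l //.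
have W1 t : a <= t <= b -> W t = 1%:M.
  by move=> /fib[_ /andP[h1 h2]]; rewrite /W ltNge h1 /= h2.
have dK t : a <= t <= b -> is_derive t 1 (fun s => (CI * ab) * s) (CI * ab).
  move=> _; rewrite -[X in is_derive _ _ _ X]mulr1; apply: is_derive_scale.
have cc t : a < t < b -> a <= t <= b by move=> /andP[? ?]; rewrite !ltW.
apply: (@piece_estimate s (fun=> 1%:M) _ _ _ a b a0 ab_ bT _ _ _ _ dK).
- by move=> t _; exact: mxcvg_cst.
- by move=> t /cc /W1.
- by apply: comparable_eq; apply: W1; rewrite lexx.
- by apply: comparable_eq; apply: W1; rewrite lexx ab_.
- by move=> t _; rewrite mulr_ge0 // ltW.
- apply: (@le_trans _ _ ((CI * ab) * b)).
    by rewrite gerBl mulr_ge0 ?mulr_ge0 // ltW.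
  by rewrite -mulrA ler_wpM2l.
- move=> t tab; have [t0T zt] := fib t (cc t tab); exists (A t).
    exists 0; first exact: has_deriv_on_cst.
    by rewrite add0r mul1mx mulmx1.
  move=> v; have := rdot_mul_bound v (boundI t0T zt); rewrite ler_norml => /andP[h1 h2].
  by case: (s) => //; rewrite lerNl.
Qed.

Lemma propagates_H a b : 0 < a -> a <= b -> b <= T -> rho^-1 <= ab * a ->
  propagates plus y forcing (kap ^+ 2 * expR (CH / eH)) a b.
Proof.
move=> a0 ab_ bT za.
have fib t : a <= t <= b -> 0 < t <= T /\ rho^-1 <= ab * t.
  move=> /andP[at_ tb]; rewrite (lt_le_trans a0) //= (le_trans tb) //; split => //.
  by rewrite (le_trans za) // ler_pM2l.
have dK t : a <= t <= b -> is_derive t 1 (fun s => CH / (- eH) * (ab * s) `^ (- eH))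
    (CH * (t^-1 * (ab * t) `^ (- eH))).
  move=> /fib[/andP[t0 _] _]; apply: is_derive_powR_scaled => //.
  by rewrite oppr_eq0 gt_eqF.
have cc t : a < t < b -> a <= t <= b by move=> /andP[? ?]; rewrite !ltW.
apply: (@piece_estimate plus GH _ _ _ a b a0 ab_ bT _ _ _ _ dK).
- by apply: continuous_fiber_sub cGH => t; rewrite /= in_itv /=; exact: fib.
- move=> t /andP[at_ tb]; have zt : rho^-1 < ab * t by rewrite (le_lt_trans za) // ltr_pM2l.
  by rewrite /W ltNge (ltW (lt_trans rhoV zt)) /= leNgt zt.
- by have [] := fib a; rewrite ?lexx // => *; exact: gaugeH_comparable.
- by have [] := fib b; rewrite ?lexx ?ab_ // => *; exact: gaugeH_comparable.
- by move=> t /cc/fib[/andP[t0 _] _]; rewrite mulr_ge0 // mulr_ge0 ?powR_ge0 // invr_ge0 ltW.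
- have c0 : 0 <= CH / eH by rewrite divr_ge0 // ltW.
  rewrite invrN mulrN !mulNr opprK addrC.
  apply: (@le_trans _ _ (CH / eH * (ab * a) `^ (- eH))); first by rewrite gerBl mulr_ge0 // powR_ge0.
  have za1 : 1 <= ab * a.
    by apply: le_trans za; rewrite invf_ge1 // ltW //; case/andP: rho01.
  rewrite -[leRHS]mulr1 ler_wpM2l // -(powRr0 (ab * a)) ler_powR //.
  by rewrite oppr_le0 ltW.
- move=> t tab; have [/andP[t0 tT] zt] := fib t (cc t tab).
  apply: rateH; first by rewrite t0 (lt_le_trans _ bT) //; case/andP: tab.
  by rewrite (le_lt_trans za) // ltr_pM2l //; case/andP: tab.
Qed.

Definition propagation_constant :=
  kap ^+ 2 * expR (CH / eH) * (kap ^+ 2 * expR (CI / rho) * (kap ^+ 2 * expR (CP / eP))).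

Let factor_ge1 c e : 0 <= c -> 0 < e -> 1 <= kap ^+ 2 * expR (c / e).
Proof.
move=> c0 e0; rewrite -[leLHS]mul1r ler_pM // ?exprn_ege1 //.
by apply: le_trans (expR_ge1Dx _); rewrite lerDl divr_ge0 // ltW.
Qed.

Lemma propagation_constant_ge1 : 1 <= propagation_constant.
Proof. by apply: mulr_ege1; [|apply: mulr_ege1]; exact: factor_ge1. Qed.

(** The three zones follow each other in time; the estimates compose. *)
Lemma propagates_all a b : 0 < a -> a <= b -> b <= T ->
  propagates plus y forcing propagation_constant a b.
Proof.
move=> a0 ab_ bT.
(* The zone boundaries clamped to the interval; some of the three pieces may be reduced
   to a point. *)
pose p := Num.max a (Num.min b (rho / ab)); pose q := Num.max a (Num.min b (rho^-1 / ab)).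
have ap : a <= p by rewrite le_max lexx.
have pb : p <= b by rewrite ge_max ab_ ge_min lexx.
have qb : q <= b by rewrite ge_max ab_ ge_min lexx.
have pq : p <= q.
  rewrite ge_max le_max lexx /= le_max; apply/orP; right.
  rewrite le_min ge_min lexx /= ge_min; apply/orP; right.
  by rewrite ler_pM2r ?invr_gt0 // ltW.
have y0 t : 0 <= y t by exact: mxnorm_ge0.
have p0 := lt_le_trans a0 ap; have q0 := lt_le_trans p0 pq.
have pT := le_trans pb bT; have qT := le_trans qb bT.
rewrite /propagation_constant.
have PP : propagates plus y forcing (kap ^+ 2 * expR (CP / eP)) a p.
  have [e|ap'] := eqVneq a p; first by rewrite -e; apply: propagates_refl => //; exact: factor_ge1.
  apply: propagates_P => //.
  have : p <= rho / ab.
    move: ap'; rewrite /p; case: (leP a (Num.min b (rho / ab))) => [h _|_]; last by rewrite eqxx.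
    by rewrite ge_min lexx orbT.
  by rewrite ler_pdivlMr // mulrC.
have PI : propagates plus y forcing (kap ^+ 2 * expR (CI / rho)) p q.
  have [e|pq'] := eqVneq p q; first by rewrite -e; apply: propagates_refl => //; exact: factor_ge1.
  have pltq : p < q by rewrite lt_neqAle pq'.
  apply: propagates_I => //.
    rewrite mulrC -ler_pdivrMr //; rewrite leNgt; apply/negP => pr.
    move: pr; rewrite gt_max => /andP[ar]; rewrite gt_min ltxx orbF => br.
    have bp : b <= p by rewrite /p (min_l (ltW br)) le_max lexx orbT.
    by move: (lt_le_trans pltq qb); rewrite ltNge bp.
  rewrite mulrC -ler_pdivlMr //; move: pltq; rewrite {1}/q lt_max.
  rewrite ltNge ap /= => pm.
  rewrite /q ge_max ge_min lexx orbT andbT.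
  by apply: (le_trans ap); apply: (le_trans (ltW pm)); rewrite ge_min lexx orbT.
have PH : propagates plus y forcing (kap ^+ 2 * expR (CH / eH)) q b.
  have [e|qb'] := eqVneq q b; first by rewrite -e; apply: propagates_refl => //; exact: factor_ge1.
  have qltb : q < b by rewrite lt_neqAle qb'.
  apply: propagates_H => //; rewrite mulrC -ler_pdivrMr //.
  rewrite leNgt; apply/negP => qr.
  move: qr; rewrite gt_max => /andP[ar]; rewrite gt_min ltxx orbF => br.
  have bq : b <= q by rewrite /q (min_l (ltW br)) le_max lexx orbT.
  by move: qltb; rewrite ltNge bq.
have mono u v : 0 < u -> u <= v -> v <= T -> forcing u <= forcing v.
  by move=> u0; exact: forcing_mono (ltW u0).
apply: (propagates_trans _ _ y0 _ _ _ PH); rewrite ?factor_ge1 ?mono //.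
  by apply: mulr_ege1; exact: factor_ge1.
  exact: le_trans pq.
apply: (propagates_trans _ _ y0 _ _ PP PI); rewrite ?factor_ge1 ?mono //.
Qed.

End Solution.
End Assembly.

(** * Limits at t = 0 *)

Section Limits.
Variable R : realType.

(** Adding H, which is monotone and bounded below, makes each real or imaginary part of
    an entry monotone and bounded below. *)
Lemma mxcvg_of_increments m p (Y : R -> 'M[R[i]]_(m, p)) (H : R -> R) (t1 L : R) : 0 < t1 ->
  (forall a b, 0 < a -> a <= b -> b <= t1 -> mxnorm (Y b - Y a) <= H b - H a) ->
  (forall a, 0 < a <= t1 -> L <= H a) ->
  exists l, mxcvg 0^'+ Y l.
Proof.
move=> t10 YH LH.
have mono (g : R -> R) :
    (forall a b, 0 < a -> a <= b -> b <= t1 -> `|g b - g a| <= H b - H a) ->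
    exists l : R, g t @[t --> 0^'+] --> l.
  move=> gH.
  have Hmono a b : 0 < a -> a <= b -> b <= t1 -> H a <= H b.
    by move=> a0 ab bt; rewrite -subr_ge0 (le_trans _ (gH a b a0 ab bt)).
  have cvg_mono (f : R -> R) (M : R) : (forall a b, 0 < a -> a <= b -> b <= t1 -> f a <= f b) ->
      (forall a, 0 < a -> a <= t1 -> M <= f a) -> cvg (f t @[t --> 0^'+]).
    move=> f1 f2; apply: nondecreasing_at_right_is_cvgr.
      near=> x; have xt : x < t1 by near: x; exact: nbhs_right_lt.
      move=> a b; rewrite !in_itv /= => /andP[a0 _] /andP[_ bx] ab.
      by apply: f1 => //; rewrite ltW // (lt_trans bx).
    near=> x; have xt : x < t1 by near: x; exact: nbhs_right_lt.
    exists M => _ [a /= + <-]; rewrite in_itv /= => /andP[a0 ax].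
    by apply: f2 => //; rewrite ltW // (lt_trans ax).
  have cH : cvg (H t @[t --> 0^'+]).
    by apply: (cvg_mono _ L) => // a a0 at1; apply: LH; rewrite a0.
  have cgH : cvg ((g t + H t) @[t --> 0^'+]).
    apply: (cvg_mono _ (g t1 - H t1 + (L + L))) => [a b a0 ab bt|a a0 at1].
      by have := gH a b a0 ab bt; rewrite ler_norml => /andP[+ _]; lra.
    have := gH a t1 a0 at1 (lexx _); rewrite ler_norml => /andP[_].
    by have := LH a; rewrite a0 at1 => /(_ isT); lra.
  have /cvg_ex[/= l1 h1] := cgH; have /cvg_ex[/= l2 h2] := cH; exists (l1 - l2).
  rewrite (_ : g = fun t => (g t + H t) - H t); last by apply/funext => t; rewrite addrK.
  exact: cvgB h1 h2.
have Re_inc (k : 'I_m * 'I_p) : exists l : R, complex.Re (Y t k.1 k.2) @[t --> 0^'+] --> l.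
  apply: mono => a b a0 ab bt; apply: le_trans (YH a b a0 ab bt).
  have -> : complex.Re (Y b k.1 k.2) - complex.Re (Y a k.1 k.2) = complex.Re ((Y b - Y a) k.1 k.2).
    by rewrite !mxE complexReD complexReN.
  exact: le_trans (Re_le_normc _) (normc_le_mxnorm _ _ _).
have Im_inc (k : 'I_m * 'I_p) : exists l : R, complex.Im (Y t k.1 k.2) @[t --> 0^'+] --> l.
  apply: mono => a b a0 ab bt; apply: le_trans (YH a b a0 ab bt).
  have -> : complex.Im (Y b k.1 k.2) - complex.Im (Y a k.1 k.2) = complex.Im ((Y b - Y a) k.1 k.2).
    by rewrite !mxE complexImD complexImN.
  exact: le_trans (Im_le_normc _) (normc_le_mxnorm _ _ _).
have [lr hr] := boolp.choice Re_inc; have [li hi] := boolp.choice Im_inc.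
exists (\matrix_(i, j) (lr (i, j) +i* li (i, j))).
apply: mxcvg_entries => i j; rewrite mxE /=; [exact: (hr (i, j))|exact: (hi (i, j))].
Unshelve. all: by end_near. Qed.

End Limits.

Section AssemblyLimits.
Variables (R : realType) (n : nat) (T ab rho : R) (A GP GH : R -> 'M[R[i]]_n).
Variables (CP eP CI CH eH kap : R) (plus : bool).
Local Notation mu := (@lebesgue_measure R).
Hypothesis ag : adapted_gauges T ab rho A GP GH CP eP CI CH eH kap plus.
Local Notation W := (piecewise_gauge ab rho GP GH).
Let T0 := time_gt0 ag.
Let ab0 := bracket_gt0 ag.
Let rho01 := rho_itv ag.
Let rho0 : 0 < rho. Proof. by case/andP: rho01. Qed.

Section Forcing.
Variable F : R -> 'cV[R[i]]_n.
Hypothesis cF : continuous_fiber `]0, T] F.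
Local Notation h := (fun t => mxnorm (W t *m F t)).

Lemma forcing_measurable : measurable_fun `]0, T] h.
Proof.
have mz : measurable_fun `]0, T]%classic (fun t : R => ab * t).
  by apply: subspace_continuous_measurable_fun => //; apply/continuous_real_within => t _;
    apply: cvg_within_filter; apply: cvgM; [exact: cvg_cst|exact: cvg_id].
have -> : h = fun t => if ab * t < rho then mxnorm (GP t *m F t) else
    if ab * t <= rho^-1 then mxnorm (F t) else mxnorm (GH t *m F t).
  apply/funext => t; rewrite /piecewise_gauge.
  by case: ifP => // _; case: ifP => // _; rewrite mul1mx.
have piece (D : set R) (G0 : R -> 'M[R[i]]_n) : measurable D -> D `<=` `]0, T]%classic ->
    continuous_fiber D G0 -> measurable_fun D (fun t => mxnorm (G0 t *m F t)).
  move=> mD DT cG; apply: subspace_continuous_measurable_fun => //.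
  apply/continuous_real_within; apply: continuous_fiber_mxnorm => t Dt.
  by apply: mxcvgM; [exact: cG|exact: (continuous_fiber_sub DT cF)].
have mlt : measurable_fun `]0, T]%classic (fun t : R => ab * t < rho).
  by apply: measurable_fun_ltr => //; exact: measurable_cst.
have mle : measurable_fun `]0, T]%classic (fun t : R => ab * t <= rho^-1).
  by apply: measurable_fun_ler => //; exact: measurable_cst.
have m1 b : measurable (`]0, T]%classic `&` (fun t : R => ab * t < rho) @^-1` [set b]).
  exact: mlt.
have inD (t : R) : `]0, T]%classic t -> 0 < t <= T by rewrite /= in_itv.
apply: measurable_fun_if => //.
  apply: piece; [exact: m1|by move=> t []|].
  by apply: continuous_fiber_sub (gaugeP_cont ag) => t [/inD t0T /= tr]; split => //; exact: ltW.
have mle' : measurable_fun (`]0, T]%classic `&` (fun t : R => ab * t < rho) @^-1` [set false])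
    (fun t : R => ab * t <= rho^-1).
  by apply: measurable_funS mle => // t [].
have m2 b : measurable ((`]0, T]%classic `&` (fun t : R => ab * t < rho) @^-1` [set false])
    `&` (fun t : R => ab * t <= rho^-1) @^-1` [set b]).
  by apply: mle' => //; exact: m1.
apply: measurable_fun_if => //.
  rewrite (_ : (fun t => mxnorm (F t)) = fun t => mxnorm (1%:M *m F t)); last first.
    by apply/funext => t; rewrite mul1mx.
  by apply: piece; [exact: m2|move=> t [[]]|move=> t _; exact: mxcvg_cst].
apply: piece; [exact: m2|by move=> t [[]]|].
apply: continuous_fiber_sub (gaugeH_cont ag) => t [[/inD t0T _] /= tr]; split => //.
by rewrite leNgt; apply/negP => /ltW; rewrite tr.
Qed.

Lemma forcing_integrable : (\int[mu]_(t in `]0%R, T]) (h t)%:E < +oo)%E ->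
  mu.-integrable `]0, T] (EFin \o h).
Proof.
move=> fin; apply/integrableP; split.
  by apply/measurable_EFinP; exact: forcing_measurable.
rewrite (_ : (\int[mu]_(x in _) _)%E = (\int[mu]_(t in `]0%R, T]) (h t)%:E)%E) //.
by apply: eq_integral => x _ /=; rewrite ger0_norm ?mxnorm_ge0.
Qed.

Lemma forcingE t : mu.-integrable `]0, T] (EFin \o h) -> t <= T ->
  (\int[mu]_(s in `]0%R, t]) (h s)%:E)%E = (forcing ab rho GP GH F t)%:E.
Proof.
move=> ih tT; rewrite fineK //; apply: integrable_fin_num => //.
by apply: integrableS ih => //; apply: subset_itvl; rewrite bnd_simp.
Qed.

End Forcing.

Section Solution.
Variables (U F : R -> 'cV[R[i]]_n).
Hypotheses (cU : continuous_fiber `]0, T] U) (cF : continuous_fiber `]0, T] F).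
Hypothesis dU : forall t, 0 < t < T -> has_deriv_on setT U t (A t *m U t + F t).
Local Notation y := (fun t => mxnorm (W t *m U t)).
Local Notation h := (fun t => mxnorm (W t *m F t)).
Hypothesis ih : mu.-integrable `]0, T] (EFin \o h).
Local Notation Phi := (forcing ab rho GP GH F).
Local Notation C := (propagation_constant rho CP eP CI CH eH kap).

Lemma forcing_ge0 t : 0 <= Phi t.
Proof. by apply: Rintegral_ge0 => x _; exact: mxnorm_ge0. Qed.

(** Near t = 0 the coefficient of the gauged system is integrable, so that the gauged
    solution is a Cauchy family. *)
Lemma gauged_limit : exists u, mxcvg 0^'+ (fun t => W t *m U t) u.
Proof.
(* Half of the boundary time, so that the gauge is GP on all of (0, t1]. *)
pose t1 := Num.min T (rho / ab / 2).
have t10 : 0 < t1 by rewrite lt_min T0 !divr_gt0.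
have t1T : t1 <= T by rewrite ge_min lexx.
have zt t : t <= t1 -> ab * t < rho.
  move=> tt; rewrite mulrC -ltr_pdivlMr // (le_lt_trans tt) // gt_min; apply/orP; right.
  by rewrite ltr_pdivrMr // ltr_pMr ?divr_gt0 // ltr1n.
have WGP t : t <= t1 -> W t = GP t by move=> /zt h; rewrite /piecewise_gauge h.
pose c := kap ^+ 2 * expR (CP / eP); pose B := c * (y t1 + Phi t1).
have c0 : 0 <= c by rewrite mulr_ge0 ?expR_ge0 // sqr_ge0.
have B0 : 0 <= B by rewrite mulr_ge0 ?addr_ge0 ?mxnorm_ge0 ?forcing_ge0.
have yB t : 0 < t -> t <= t1 -> y t <= B.
  move=> t0 tt; have := propagates_P ag cU cF dU ih false t0 tt t1T (ltW (zt _ (lexx t1))).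
  rewrite /propagates -/c => /le_trans; apply; rewrite ler_wpM2l // lerD2l gerBl.
  exact: forcing_ge0.
have eP0 := eP_gt0 ag; have CP0 := CP_ge0 ag.
pose K t := CP / eP * (ab * t) `^ eP; pose k t := CP * (t^-1 * (ab * t) `^ eP).
apply: (@mxcvg_of_increments _ _ _ _ (fun t => B * K t + Phi t) t1 0 t10) => [a b a0 ab_ bt|a _].
  have bT := le_trans bt t1T.
  have cc t : a < t < b -> [/\ 0 < t, t < T & t <= t1].
    move=> /andP[at_ tb]; split; [exact: lt_trans at_|exact: lt_le_trans bT|].
    by rewrite ltW // (lt_le_trans tb).
  have inT : `[a, b]%classic `<=` `]0, T]%classic by apply: subset_itv; rewrite bnd_simp.
  have cGP : continuous_fiber `[a, b] GP.
    apply: continuous_fiber_sub (gaugeP_cont ag) => t; rewrite /= in_itv /= => /andP[at_ tb].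
    by rewrite (lt_le_trans a0) //= (le_trans tb) // ltW // zt // (le_trans tb).
  have cU' := continuous_fiber_sub inT cU; have cF' := continuous_fiber_sub inT cF.
  have cg : continuous_real `[a, b] (fun t => mxnorm (GP t *m F t)).
    by apply: continuous_fiber_mxnorm => t Dt; apply: mxcvgM; [exact: cGP|exact: cF'].
  have hg t : a < t < b -> h t = mxnorm (GP t *m F t) by move=> /cc[_ _ /WGP ->].
  have e := primitive_increment ih a0 ab_ bT hg cg.
  pose I s := \int[mu]_(x in `[a, s]) mxnorm (GP x *m F x).
  have dI (t : R) : a < t < b -> is_derive t 1 I (mxnorm (GP t *m F t)) by exact: primitive_deriv.
  have dK (t : R) : 0 < t -> is_derive t 1 K (k t).
    by move=> t0; apply: is_derive_powR_scaled => //; rewrite gt_eqF.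
  have -> : B * K b + Phi b - (B * K a + Phi a) = (B * K b + I b) - (B * K a + I a).
    rewrite /I primitive_start -e /forcing; ring.
  rewrite !WGP //; last exact: le_trans bt.
  have [S hS] : {S : R -> 'M[R[i]]_n & forall t, a < t < b ->
      gauge_rate GP A t (S t) /\ mxnorm (S t) <= k t}.
    apply: (@boolp.choice _ _ (fun t S => a < t < b -> gauge_rate GP A t S /\ mxnorm S <= k t)) => t.
    have [tab|] := boolP (a < t < b); last by exists 0.
    have [t0 tT tt1] := cc t tab; have [||S h1 h2] := rate_P ag (t := t); last by exists S.
      by rewrite t0.
    by rewrite ltW // zt.
  apply: (@mxnorm_increment R n 1 (fun t => GP t *m U t)
    (fun t => S t *m (GP t *m U t) + GP t *m F t) (fun t => B * K t + I t)
    (fun t => B * k t + mxnorm (GP t *m F t)) a b ab_).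
  - by move=> t Dt; apply: mxcvgM; [exact: cGP|exact: cU'].
  - apply: continuous_realD; last exact: primitive_continuous ab_ cg.
    apply: continuous_realM; first exact: continuous_real_cst.
    apply: derive_continuous_real => t; rewrite /= in_itv /= => /andP[at_ _].
    by exists (k t); apply: dK; exact: lt_le_trans at_.
  - move=> t tab; have [t0 tT _] := cc t tab.
    apply: gauge_rate_solution; first exact: (hS t tab).1.
    by apply: dU; rewrite t0.
  - move=> t tab; have [t0 _ _] := cc t tab; apply: is_derive_add; last exact: dI.
    by apply: is_derive_scale; exact: dK.
  move=> t tab; have [t0 _ tt1] := cc t tab; have [_ Sk] := hS t tab.
  apply: le_trans (ler_mxnormD _ _) _; rewrite lerD2r mulrC.
  apply: le_trans (mxnormM _ _) _; apply: ler_pM; rewrite ?mxnorm_ge0 //.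
  by rewrite -WGP //; exact: yB.
by rewrite addr_ge0 ?forcing_ge0 // mulr_ge0 // mulr_ge0 ?powR_ge0 // divr_ge0 // ltW.
Qed.

Lemma gauged_limit_bound u t0 : mxcvg 0^'+ (fun t => W t *m U t) u -> 0 < t0 <= T ->
  if plus then y t0 <= C * (mxnorm u + Phi t0) else mxnorm u <= C * (y t0 + Phi t0).
Proof.
move=> yu /andP[t00 t0T]; 
  have ny : mxnorm (W t *m U t) @[t --> 0^'+] --> mxnorm u by exact: mxcvg_norm yu.
have C0 : 0 <= C by exact: le_trans ler01 (propagation_constant_ge1 ag).
have pr t : 0 < t -> t <= t0 -> if plus then y t0 <= C * (y t + Phi t0)
    else y t <= C * (y t0 + Phi t0).
  move=> tp tt; have := propagates_all ag cU cF dU ih tp tt t0T; rewrite /propagates.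
  by case: (plus) => /le_trans; apply; rewrite ler_wpM2l // lerD2l gerBl forcing_ge0.
have nt : \forall t \near 0^'+, 0 < t <= t0.
  near=> t; apply/andP; split; first by near: t; exact: nbhs_right_gt.
  by near: t; exact: nbhs_right_le.
case: (plus) pr => pr.
  have cv : C * (y t + Phi t0) @[t --> 0^'+] --> C * (mxnorm u + Phi t0).
    by apply: cvgM; [exact: cvg_cst|apply: cvgD; [exact: ny|exact: cvg_cst]].
  by apply: (cvgr_to_ge cv); apply: filterS nt => t /andP[]; exact: pr.
have ub : \forall t \near 0^'+, y t <= C * (y t0 + Phi t0).
  by apply: filterS nt => t /andP[]; exact: pr.
exact: cvgr_to_le ny ub.
Unshelve. all: by end_near. Qed.

End Solution.
End AssemblyLimits.

(** * Scattering at a fixed frequency *)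

Section Scattering.
Variables (R : realType) (n : nat) (T ab rho : R) (A GP GH : R -> 'M[R[i]]_n).
Variables (CP eP CI CH eH kap : R).
Local Notation mu := (@lebesgue_measure R).
Hypothesis ag : adapted_gauges T ab rho A GP GH CP eP CI CH eH kap true.
Local Notation W := (piecewise_gauge ab rho GP GH).

Lemma zero_integrable :
  mu.-integrable `]0, T] (EFin \o (fun t => mxnorm (W t *m (0 : 'cV[R[i]]_n)))).
Proof.
rewrite (_ : _ \o _ = cst 0%E); first exact: integrable0.
by apply/funext => t; rewrite /= mulmx0 mxnorm0.
Qed.

Lemma continuous_of_deriv p (U dU : R -> 'M[R[i]]_(n, p)) :
  (forall t, 0 < t <= T -> has_deriv_on setT U t (dU t)) -> continuous_fiber `]0, T] U.
Proof.
move=> hU t; rewrite /= in_itv /= => /hU/has_deriv_on_cvg ct.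
apply: mxcvg_sub ct => P VP; have {}VP : nbhs t (fun s => setT s -> P s) by [].
suff : nbhs t (fun s => `]0, T]%classic s -> P s) by [].
by apply: filterS VP => s Ps _; exact: Ps.
Qed.

(** The forward estimate without forcing, started at t = 0. *)
Lemma zero_limit_unique (U : R -> 'cV[R[i]]_n) : continuous_fiber `]0, T] U ->
  (forall t, 0 < t < T -> has_deriv_on setT U t (A t *m U t)) ->
  mxcvg 0^'+ (fun t => W t *m U t) 0 -> forall t, 0 < t <= T -> U t = 0.
Proof.
move=> cU dU U0 t t0T.
have cF : continuous_fiber `]0, T] (fun=> 0 : 'cV[R[i]]_n) by move=> s _; exact: mxcvg_cst.
have dU' s : 0 < s < T -> has_deriv_on setT U s (A s *m U s + 0) by rewrite addr0; exact: dU.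
have := gauged_limit_bound ag cU cF dU' zero_integrable U0 t0T.
rewrite mxnorm0 add0r /forcing (_ : \int[mu]_(x in _) _ = 0); last first.
  rewrite (@eq_Rintegral _ _ _ _ _ (cst 0)) => [|x _]; last by rewrite mulmx0 mxnorm0.
  by rewrite /Rintegral integral0.
rewrite mulr0 => h; have WU : W t *m U t = 0.
  by apply: mxnorm0_eq0; apply/eqP; rewrite eq_le h mxnorm_ge0.
by rewrite -(mulKmx (piecewise_gauge_unit ag t0T) (U t)) WU mulmx0.
Qed.

(** The gauged fundamental matrix has a limit at t = 0; by the forward estimate no
    nonzero solution is lost there, so the limit is invertible and any limit can be
    prescribed. *)
Lemma scattering_exists (F : R -> 'cV[R[i]]_n) u : continuous_fiber `]0, T] F ->
  mu.-integrable `]0, T] (EFin \o (fun t => mxnorm (W t *m F t))) ->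
  exists2 U : R -> 'cV[R[i]]_n,
    forall t, 0 < t <= T -> has_deriv_on setT U t (A t *m U t + F t) &
    mxcvg 0^'+ (fun t => W t *m U t) u.
Proof.
move=> cF ih; have T0 := time_gt0 ag; have cA := coef_continuous ag.
have [U1 _ dU1] := @linear_ode_exists R n 1 A F 0 T T0 cA cF.
have cO : continuous_fiber `]0, T] (fun=> 0 : 'M[R[i]]_n) by move=> s _; exact: mxcvg_cst.
have [Y YT dY] := @linear_ode_exists R n n A (fun=> 0) 1%:M T T0 cA cO.
have cO1 : continuous_fiber `]0, T] (fun=> 0 : 'cV[R[i]]_n) by move=> s _; exact: mxcvg_cst.
have dYc (c : 'cV[R[i]]_n) t : 0 < t <= T ->
    has_deriv_on setT (fun s => Y s *m c) t (A t *m (Y t *m c)).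
  move=> t0T; have := has_deriv_onM (dY t t0T) (has_deriv_on_cst setT t c).
  by rewrite addr0 mulmx0 addr0 mulmxA.
have cYc (c : 'cV[R[i]]_n) : continuous_fiber `]0, T] (fun s => Y s *m c).
  exact: (@continuous_of_deriv _ _ (fun t => A t *m (Y t *m c)) (dYc c)).
have le_lt (t : R) : 0 < t < T -> 0 < t <= T by move=> /andP[-> /ltW].
have [l hl] : {l : 'I_n -> 'cV[R[i]]_n & forall j,
    mxcvg 0^'+ (fun t => W t *m (Y t *m delta_mx j 0)) (l j)}.
  apply: (@boolp.choice _ _ (fun j lj => mxcvg 0^'+ (fun t => W t *m (Y t *m delta_mx j 0)) lj)) => j.
  apply: (gauged_limit ag (cYc _) cO1 _ zero_integrable) => t /le_lt tT.
  by rewrite addr0; exact: dYc.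
(* L is the limit of the gauged fundamental matrix, obtained column by column. *)
pose L : 'M[R[i]]_n := \matrix_(i, j) l j i 0.
have cL : mxcvg 0^'+ (fun t => W t *m Y t) L.
  have e t i j : (W t *m Y t) i j = (W t *m (Y t *m (delta_mx j 0 : 'cV[R[i]]_n))) i 0.
    rewrite mulmxA; move: (W t *m Y t) => V. by rewrite -colE mxE.
  by apply: mxcvg_entries => i j; rewrite mxE; under eq_fun do rewrite e;
    [apply: mxcvg_Re; exact: hl|apply: mxcvg_Im; exact: hl].
have cLc (c : 'cV[R[i]]_n) : mxcvg 0^'+ (fun t => W t *m (Y t *m c)) (L *m c).
  rewrite (_ : (fun t => _) = fun t => W t *m Y t *m c); last by apply/funext => t; rewrite mulmxA.
  by apply: mxcvgM; [exact: cL|exact: mxcvg_cst].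
have uL : L \in unitmx.
  apply: mulmx_cV_inj_unit => c Lc.
  have YTc := zero_limit_unique (cYc c) (fun t h => dYc c t (le_lt t h)).
  rewrite -Lc in YTc; have := YTc (cLc c) T; rewrite T0 lexx => /(_ isT).
  by rewrite YT mul1mx Lc.
have cU1 := continuous_of_deriv dU1.
have [w hw] := gauged_limit ag cU1 cF (fun t h => dU1 t (le_lt t h)) ih.
pose v := invmx L *m (u - w); exists (fun t => U1 t + Y t *m v).
  move=> t t0T; rewrite mulmxDr addrAC; apply: has_deriv_onD; [exact: dU1|exact: dYc].
rewrite (_ : (fun t => _) = fun t => W t *m U1 t + W t *m (Y t *m v)); last first.
  by apply/funext => t; rewrite mulmxDr.
have -> : u = w + L *m v by rewrite /v mulKVmx // addrC subrK.
by apply: mxcvgD; [exact: hw|exact: cLc].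
Qed.

End Scattering.

(** * Uniformity in the frequency *)

Section Thresholds.
Variables (R : realType) (d n : nat).

Definition sup_mxnormP (BP : 'rV[R]_d -> 'M[R[i]]_n) : R := sup (range (fun xi => mxnorm (BP xi))).

Definition sup_mxnormH (Z : set (R * 'rV[R]_d)) (BH : R -> 'rV[R]_d -> 'M[R[i]]_n) : R :=
  sup [set mxnorm (BH q.1 q.2) | q in Z].

(** Ensures m (aP + 1) >= 2 sup |BP|: the last remainder in zone P must absorb E_P and its
    inverse, each of size z^(- sup |BP|). *)
Definition mP_threshold (aP : R) (BP : 'rV[R]_d -> 'M[R[i]]_n) : nat :=
  Num.bound (2 * sup_mxnormP BP / (aP + 1)).

(** Ensures m (l + 1) >= 2 sup |BH| + (l + 1): the last remainder in zone H must absorb E_H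
    and its inverse, each of size z^(sup |BH|), and still be integrable in time. *)
Definition mH_threshold (l : R) (Z : set (R * 'rV[R]_d)) (BH : R -> 'rV[R]_d -> 'M[R[i]]_n) : nat :=
  Num.bound ((2 * sup_mxnormH Z BH + (l + 1)) / (l + 1)).

Lemma bound_large (x y : R) (m : nat) : 0 < y -> 0 <= x -> (Num.bound (x / y) <= m)%N ->
  x <= m%:R * y.
Proof.
move=> y0 x0 hm; rewrite -ler_pdivrMr //.
have h := archi_boundP (divr_ge0 x0 (ltW y0)).
by rewrite (le_trans (ltW h)) // ler_nat.
Qed.

Variables (T : R) (ell : 'I_d -> R) (rhos : R).

(** Every fibre of zone P is nonempty, so the bound on B_P holds for all frequencies. *)
Lemma sup_mxnormP_ge BP xi : 0 < T -> 0 < rhos ->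
  symbS ell (zoneP T ell rhos) 0 (fun _ xi => BP xi) -> mxnorm (BP xi) <= sup_mxnormP BP.
Proof.
move=> T0 rhos0 sB.
have z0 t xi' : zoneP T ell rhos (t, xi') -> 0 < zvar ell t xi'.
  by move=> [/andP[t0 _] _]; rewrite mulr_gt0 // abracket_gt0.
have [C C0 hC] := symbS_bound z0 sB.
apply: sup_upper_bound; last by exists xi.
split; first by exists (mxnorm (BP xi)), xi.
exists C => _ [xi' _ <-]; have ab0 := abracket_gt0 ell xi'.
pose t := Num.min T (rhos / abracket ell xi').
have Zt : zoneP T ell rhos (t, xi').
  split; first by rewrite /strip /= lt_min T0 divr_gt0 //= ge_min lexx.
  by rewrite /zvar /= mulrC -ler_pdivlMr // ge_min lexx orbT.
by have := hC _ _ Zt; rewrite powRr0 mulr1.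
Qed.

Lemma sup_mxnormH_ge BH t xi : 0 < rhos -> symbS ell (zoneH T ell rhos) 0 BH ->
  zoneH T ell rhos (t, xi) -> mxnorm (BH t xi) <= sup_mxnormH (zoneH T ell rhos) BH.
Proof.
move=> rhos0 sB Zt.
have z0 s xi' : zoneH T ell rhos (s, xi') -> 0 < zvar ell s xi'.
  by move=> [_ /=]; apply: lt_le_trans; rewrite invr_gt0.
have [C C0 hC] := symbS_bound z0 sB.
apply: sup_upper_bound; last by exists (t, xi).
split; first by exists (mxnorm (BH t xi)), (t, xi).
exists C => _ [[s xi'] Zs <-] /=.
by have := hC _ _ Zs; rewrite powRr0 mulr1.
Qed.

Lemma sup_mxnormH_ge0 Z BH : 0 <= sup_mxnormH Z BH.
Proof.
rewrite /sup_mxnormH; set S := [set _ | _ in _].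
have [hS|/sup_out ->//] := pselect (has_sup S).
have [[y Sy] _] := hS; apply: (@le_trans _ _ y); last exact: (sup_upper_bound hS).
by case: Sy => q _ <-; exact: mxnorm_ge0.
Qed.

End Thresholds.

Section Adapted.
Variables (R : realType) (d n : nat) (T : R) (ell : 'I_d -> R) (alpha : R).
Variables (lam0 : 'M[R]_d) (lams : R -> 'M[R]_d) (c0 : R).
Variables (A : R -> 'rV[R]_d -> 'M[R[i]]_n) (rhos : R).
Variables (MP : R -> 'rV[R]_d -> 'M[R[i]]_n) (BP : 'rV[R]_d -> 'M[R[i]]_n).
Variables (RP : R -> 'rV[R]_d -> 'M[R[i]]_n) (aP : R).
Variables (MH DH BH RH : R -> 'rV[R]_d -> 'M[R[i]]_n) (aH : R) (G : {set {set 'I_n}}).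
Variables (DPm NPm RPm DHm NHm RHm : nat -> R -> 'rV[R]_d -> 'M[R[i]]_n) (mP mH : nat).
Local Notation ab := (abracket ell).
Local Notation lam := (fun t => lam0 + lams t).
Hypothesis d_gt0 : (0 < d)%N.
Hypothesis T0 : 0 < T.
Hypothesis ell_gt : forall i, -1 < ell i.
Hypothesis hspeed : speed_assumption T ell alpha lam0 lams c0.
Hypothesis rhos01 : 0 < rhos < 1.
Hypothesis hI : assumption_I T ell rhos A.
Hypothesis hP : assumption_P T ell rhos A MP BP RP aP.
Hypothesis hH : assumption_H T ell lam rhos A MH DH BH RH aH.
Hypothesis partG : finset.partition G (finset.setTfor 'I_n).
Hypothesis hrenP : renormalization_P T ell rhos BP RP aP DPm NPm RPm.
Hypothesis hrenH : renormalization_H T ell lam rhos DH BH RH G DHm NHm RHm.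
Hypothesis mP_large : (mP_threshold aP BP <= mP)%N.
Hypothesis mH1 : (1 <= mH)%N.
Hypothesis mH_large : (mH_threshold (ell_star ell) (zoneH T ell rhos) BH <= mH)%N.

(** Neither rho1 nor the constants depend on the frequency.  As rho0 tends to 0 the
    constants CI and kap deteriorate, because zone I grows and the gauges are matched to
    the identity at extreme values of z. *)
Lemma adapted_gauges_exist : exists rho1 : R, 0 < rho1 <= rhos /\
  forall rho0 : R, 0 < rho0 <= rho1 -> exists CP eP CI CH eH kap : R,
  forall plus xi, adapted_gauges T (ab xi) rho0 (A ^~ xi)
    (gaugeP ell MP BP NPm mP ^~ xi) (gaugeH ell MH BH G NHm mH plus rho0 ^~ xi)
    CP eP CI CH eH kap plus.
Proof.
have [rhos0 rhos1] := andP rhos01.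
have l10 := ell_star_gt d_gt0 ell_gt.
have aP1 : 0 < aP + 1 by case: hP => _ _ _ [h _] _; rewrite -(opprK 1) subr_gt0.
pose bP := sup_mxnormP BP; pose bH := sup_mxnormH (zoneH T ell rhos) BH.
have BPb xi : mxnorm (BP xi) <= bP.
  by case: hP => _ sB _ _ _; exact: sup_mxnormP_ge sB.
have BHb t xi : zoneH T ell rhos (t, xi) -> mxnorm (BH t xi) <= bH.
  by case: hH => _ [sB _] _ _ _; exact: sup_mxnormH_ge.
have bP0 : 0 <= bP by exact: le_trans (mxnorm_ge0 _) (BPb 0).
have bH0 : 0 <= bH by exact: sup_mxnormH_ge0.
have mPl : 2 * bP <= mP%:R * (aP + 1) by apply: bound_large => //; rewrite mulr_ge0.
have mHl : 2 * bH + (ell_star ell + 1) <= mH%:R * (ell_star ell + 1).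
  by apply: bound_large => //; rewrite addr_ge0 ?mulr_ge0 // ltW.
have [rP [rP01 [QP [CP CP0 rateP]]]] := gaugeP_rate rhos01 hP hrenP BPb mPl.
have [rH rH01 QH] := Q_half_H mH rhos01 l10 hrenH.
have [CH CH0 rateH] := gaugeH_rate rhos01 l10 partG hH hrenH BHb bH0 mH1 mHl rH01 QH.
have [rP0 rPs] := andP rP01; have [rH0 rHs] := andP rH01.
exists (Num.min rP rH); split.
  by rewrite lt_min rP0 rH0 /= ge_min (ltW rPs).
move=> rho0 /andP[rho00]; rewrite le_min => /andP[rho0P rho0H].
have rho0s : rho0 <= rhos by apply: (le_trans rho0P); exact: ltW.
have rP0s : 0 < rP <= rhos by rewrite rP0 ltW.
have [KP KP0 boundP] := gaugeP_bound rhos01 hP BPb rP0s QP.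
have rho0rH : 0 < rho0 <= rH by rewrite rho00.
have [KH KH0 boundH] := gaugeH_bound rhos01 partG hH BHb bH0 rho0rH (ltW rHs) QH.
have zI t xi : zoneI T ell rho0 (t, xi) -> 0 < zvar ell t xi.
  by move=> [_ /andP[/= h _]]; exact: lt_le_trans h.
have rho00s : 0 < rho0 <= rhos by rewrite rho00.
have [CI CI0 boundI] := symbS_bound zI (hI rho00s).
exists CP, (2 * ((aP + 1) / 4)), CI, CH, (Num.min (ell_star ell + 1) (-1 - aH)).
pose kap := Num.max 1 (Num.max (KP * rho0 `^ (- bP)) (KH * rho0^-1 `^ bH)).
exists kap => plus xi; have ab0 := abracket_gt0 ell xi.
have kP : KP * rho0 `^ (- bP) <= kap by rewrite !le_max lexx orbT.
have kH : KH * rho0^-1 `^ bH <= kap by rewrite !le_max lexx !orbT.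
have cP : continuous_fiber (fiber (zoneP T ell rhos) xi) (gaugeP ell MP BP NPm mP ^~ xi).
  exact: gaugeP_continuous hP hrenP xi.
split => //.
- by rewrite rho00 (le_lt_trans rho0s).
- exact: coefficient_continuous rhos01 hspeed hI hP hH xi.
- by apply: continuous_fiber_sub cP; exact: zoneP_sub.
- exact: gaugeH_continuous rhos01 partG hH hrenH plus rho0 xi rho00s.
- by rewrite mulr_gt0 // divr_gt0.
- exact: deltaH_gt0 l10 hH.
- by rewrite le_max lexx.
- by move=> t tT zt; apply: rateP => //; exact: le_trans rho0P.
- move=> t tT zt; have := boundI t xi; rewrite powRr0 mulr1 => /(_ (conj tT zt)).
  by rewrite mxnormZr gtr0_norm ?invr_gt0 // mulrC ler_pdivrMr.
- by move=> t tT zt; exact: rateH.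
- by move=> t tT zt; have [] := boundP t xi (conj tT (le_trans zt rho0P)).
- by move=> t tT zt; have [] := boundH plus t xi (conj tT zt).
- move=> t tT zt; have Zt : zoneP T ell rP (t, xi) by split => //; rewrite /zvar /= zt.
  have [_ h1 h2] := boundP t xi Zt; have ez : zvar ell t xi = rho0 by [].
  rewrite ez in h1; rewrite ez in h2.
  by split; [exact: le_trans kP|exact: le_trans kP].
- move=> t tT zt; have Zt : zoneH T ell rho0 (t, xi) by split => //; rewrite /zvar /= zt.
  have [_ h1 h2] := boundH plus t xi Zt; have ez : zvar ell t xi = rho0^-1 by [].
  rewrite ez in h1; rewrite ez in h2.
  by split; [exact: le_trans kH|exact: le_trans kH].
Qed.

End Adapted.

(** * Asymptotics and scattering *)

Section Solutions.
Variables (R : realType) (d n : nat) (T : R) (A : R -> 'rV[R]_d -> 'M[R[i]]_n).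
Hypothesis T0 : 0 < T.
Hypothesis cA : forall xi, continuous_fiber `]0, T] (A ^~ xi).
Implicit Types (F U : R -> 'rV[R]_d -> 'cV[R[i]]_n).

Lemma fiber_strip (xi : 'rV[R]_d) : fiber (strip T) xi = `]0, T]%classic.
Proof. by apply/seteqP; split => t; rewrite /fiber /strip /= in_itv. Qed.

Lemma is_solution_of_fibers F U : (forall xi, continuous_fiber `]0, T] (F ^~ xi)) ->
  (forall xi t, 0 < t <= T -> has_deriv_on setT (U ^~ xi) t (A t xi *m U t xi + F t xi)) ->
  is_solution T A F U.
Proof.
move=> cF dU; exists (fun t xi => A t xi *m U t xi + F t xi); split => //.
- move=> t xi t0T; apply: has_deriv_on_sub (dU xi t t0T).
  by apply: (@nearW _ (nbhs t)) => s.
- move=> xi t Dt; apply: mxcvgD; last exact: cF.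
  apply: mxcvgM; first exact: cA.
  exact: (@continuous_of_deriv R n T 1 (U ^~ xi) _ (dU xi)).
Qed.

(** Derivatives of solutions are one-sided at T; in the interior of (0, T) they are
    two-sided, which is all that the estimates use. *)
Lemma fibers_of_is_solution F U : is_solution T A F U -> forall xi,
  continuous_fiber `]0, T] (U ^~ xi) /\
  forall t, 0 < t < T -> has_deriv_on setT (U ^~ xi) t (A t xi *m U t xi + F t xi).
Proof.
move=> [dU [hU _ dUE]] xi; split.
  move=> t Dt; rewrite -(fiber_strip xi) in Dt; rewrite -(fiber_strip xi).
  exact: has_deriv_on_cvg (hU t xi Dt).
move=> t /andP[t0 tT]; have t0T : 0 < t <= T by rewrite t0 ltW.
rewrite -dUE //; apply: has_deriv_on_sub (hU t xi t0T).
have tin : t \in `]0, T[ by rewrite in_itv /= t0.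
apply: (@filterS _ (nbhs t) _ _ _ _ (near_in_itvoo tin)) => s; rewrite in_itv /= => /andP[s0 sT] _.
by rewrite /strip /= s0 ltW.
Qed.

Lemma solution_difference F U U' : is_solution T A F U -> is_solution T A F U' -> forall xi,
  continuous_fiber `]0, T] (fun t => U t xi - U' t xi) /\
  forall t, 0 < t < T ->
    has_deriv_on setT (fun t => U t xi - U' t xi) t (A t xi *m (U t xi - U' t xi)).
Proof.
move=> hU hU' xi; have [cU dU] := fibers_of_is_solution hU xi.
have [cU' dU'] := fibers_of_is_solution hU' xi; split.
  by move=> t Dt; apply: mxcvgB; [exact: cU|exact: cU'].
move=> t tT; have := has_deriv_onB (dU t tT) (dU' t tT).
by rewrite opprD addrACA subrr addr0 -mulmxBr.
Qed.

Lemma cauchy_problem F (u : 'rV[R]_d -> 'cV[R[i]]_n) :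
  (forall xi, continuous_fiber `]0, T] (F ^~ xi)) ->
  exists U, [/\ is_solution T A F U, forall xi, U T xi = u xi &
    forall U', is_solution T A F U' -> (forall xi, U' T xi = u xi) -> agree_on_strip T U' U].
Proof.
move=> cF; have [V hV] : {V : 'rV[R]_d -> R -> 'cV[R[i]]_n & forall xi, V xi T = u xi /\
    forall t, 0 < t <= T -> has_deriv_on setT (V xi) t (A t xi *m V xi t + F t xi)}.
  apply: (@boolp.choice _ _ (fun xi v => v T = u xi /\
    forall t, 0 < t <= T -> has_deriv_on setT v t (A t xi *m v t + F t xi))) => xi.
  by have [v vT dv] := @linear_ode_exists R n 1 (A ^~ xi) (F ^~ xi) (u xi) T T0 (cA xi) (cF xi); exists v.
have solV : is_solution T A F (fun t xi => V xi t).
  by apply: is_solution_of_fibers => // xi t; exact: (hV xi).2.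
exists (fun t xi => V xi t); split => // [xi|U' hU' U'T t xi t0T]; first exact: (hV xi).1.
have [cD dD] := solution_difference hU' solV xi.
have TT : 0 < T <= T by rewrite T0 lexx.
apply/eqP; rewrite -subr_eq0; apply/eqP.
apply: (@linear_ode_unique R n 1 (A ^~ xi) _ T (cA xi) cD dD T t TT t0T).
by rewrite U'T (hV xi).1 subrr.
Qed.

End Solutions.

Lemma asymp_gauge (R : realType) (d n : nat) plus (ell : 'I_d -> R) rho BP NP mP MP G BH NH mH MH
    (U : R -> 'rV[R]_d -> 'cV[R[i]]_n) t xi :
  asymp plus ell rho BP NP mP MP G BH NH mH MH U t xi =
  piecewise_gauge (abracket ell xi) rho (gaugeP ell MP BP NP mP ^~ xi)
    (gaugeH ell MH BH G NH mH plus rho ^~ xi) t *m U t xi.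
Proof.
rewrite /asymp /piecewise_gauge /zvar; case: ifP => // _; case: ifP => // _.
by rewrite mul1mx.
Qed.

Theorem theorem2p36 (R : realType) (d n : nat) (d_gt0 : (0 < d)%N)
    (n_gt0 : (0 < n)%N) :
  exists (mPmin : R -> ('rV[R]_d -> 'M[R[i]]_n) -> nat)
         (mHmin : R -> set (R * 'rV[R]_d) ->
                  (R -> 'rV[R]_d -> 'M[R[i]]_n) -> nat),
  forall (T : R) (ell : 'I_d -> R) (alpha : R)
    (lam0 : 'M[R]_d) (lams : R -> 'M[R]_d) (c0 : R)
    (A : R -> 'rV[R]_d -> 'M[R[i]]_n) (rhos : R)
    (MP : R -> 'rV[R]_d -> 'M[R[i]]_n) (BP : 'rV[R]_d -> 'M[R[i]]_n)
    (RP : R -> 'rV[R]_d -> 'M[R[i]]_n) (aP : R)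
    (MH DH BH RH : R -> 'rV[R]_d -> 'M[R[i]]_n) (aH : R)
    (G : {set {set 'I_n}})
    (DPm NPm RPm DHm NHm RHm : nat -> R -> 'rV[R]_d -> 'M[R[i]]_n),
  let lam := fun t => lam0 + lams t in
  0 < T -> (forall i, -1 < ell i) -> 0 < alpha -> 0 < c0 ->
  speed_assumption T ell alpha lam0 lams c0 ->
  0 < rhos < 1 ->
  assumption_I T ell rhos A ->
  assumption_P T ell rhos A MP BP RP aP ->
  assumption_H T ell lam rhos A MH DH BH RH aH ->
  partition_of_speeds T ell rhos DH G ->
  renormalization_P T ell rhos BP RP aP DPm NPm RPm ->
  renormalization_H T ell lam rhos DH BH RH G DHm NHm RHm ->
  forall mP mH : nat,
  (mPmin aP BP <= mP)%N ->
  (1 <= mH)%N ->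
  (mHmin (ell_star ell) (zoneH T ell rhos) BH <= mH)%N ->
  exists rho1 : R, 0 < rho1 <= rhos /\
  forall rho0 : R, 0 < rho0 <= rho1 ->
  let asympt plus := asymp plus ell rho0 BP NPm mP MP G BH NHm mH MH in
  exists C : R, 0 < C /\
  forall F : R -> 'rV[R]_d -> 'cV[R[i]]_n, continuous_on (@strip R d T) F ->
  (* Asymptotics *)
  (forall u : 'rV[R]_d -> 'cV[R[i]]_n,
     exists U : R -> 'rV[R]_d -> 'cV[R[i]]_n,
       [/\ is_solution T A F U,
           forall xi, U T xi = u xi,
           forall U', is_solution T A F U' -> (forall xi, U' T xi = u xi) ->
             agree_on_strip T U' U
         & (forall xi, (norm_integral (asympt false F) T xi < +oo)%E) ->
           exists uA : 'rV[R]_d -> 'cV[R[i]]_n,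
             initial_limit (asympt false U) uA /\
             forall xi (t0 : R), 0 < t0 <= T ->
               ((mxnorm (uA xi))%:E <=
                 C%:E * ((mxnorm (asympt false U t0 xi))%:E
                         + norm_integral (asympt false F) t0 xi))%E]) /\
  (* Scattering *)
  ((forall xi, (norm_integral (asympt true F) T xi < +oo)%E) ->
   forall uA : 'rV[R]_d -> 'cV[R[i]]_n,
     exists U : R -> 'rV[R]_d -> 'cV[R[i]]_n,
       [/\ is_solution T A F U,
           initial_limit (asympt true U) uA,
           forall U', is_solution T A F U' ->
             initial_limit (asympt true U') uA -> agree_on_strip T U' U
         & forall xi (t0 : R), 0 < t0 <= T ->
             ((mxnorm (asympt true U t0 xi))%:E <=
               C%:E * ((mxnorm (uA xi))%:E
                       + norm_integral (asympt true F) t0 xi))%E]).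
Proof.
exists (@mP_threshold R d n), (@mH_threshold R d n).
move=> T ell alpha lam0 lams c0 A rhos MP BP RP aP MH DH BH RH aH G DPm NPm RPm DHm NHm RHm lam.
move=> T0 ell_gt alpha0 c00 hspeed rhos01 hI hP hH [partG _] hrenP hrenH mP mH mPl mH1 mHl.
have [rho1 [rho1s hrho]] := adapted_gauges_exist d_gt0 T0 ell_gt hspeed rhos01 hI hP hH partG
  hrenP hrenH mPl mH1 mHl.
exists rho1; split => // rho0 rho0s asympt.
have [CP [eP [CI [CH [eH [kap ag]]]]]] := hrho rho0 rho0s.
pose C := propagation_constant rho0 CP eP CI CH eH kap.
have C1 : 1 <= C := propagation_constant_ge1 (ag true 0).
exists C; split; first exact: lt_le_trans ltr01 C1.
move=> F cF0.
have cF xi : continuous_fiber `]0, T] (F ^~ xi).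
  by rewrite -(fiber_strip T xi); exact: continuous_on_fiber.
have cA xi : continuous_fiber `]0, T] (A ^~ xi) := coef_continuous (ag true xi).
pose W plus xi := piecewise_gauge (abracket ell xi) rho0 (gaugeP ell MP BP NPm mP ^~ xi)
  (gaugeH ell MH BH G NHm mH plus rho0 ^~ xi).
have asyE plus V t xi : asympt plus V t xi = W plus xi t *m V t xi by exact: asymp_gauge.
have asyI plus xi t : norm_integral (asympt plus F) t xi =
    (\int[lebesgue_measure]_(s in `]0%R, t]) (mxnorm (W plus xi s *m F s xi))%:E)%E.
  by apply: eq_integral => s _; rewrite asyE.
have fin plus xi : (norm_integral (asympt plus F) T xi < +oo)%E ->
    lebesgue_measure.-integrable `]0, T] (EFin \o (fun t => mxnorm (W plus xi t *m F t xi))).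
  by rewrite asyI; exact: (forcing_integrable (ag plus xi) (cF xi)).
have limE plus V u : (forall xi, mxcvg 0^'+ (fun t => W plus xi t *m V t xi) (u xi)) <->
    initial_limit (asympt plus V) u.
  split=> h xi.
    by apply: mxcvg_near (h xi); apply: nearW => t; rewrite asyE.
  by apply: mxcvg_near (h xi); apply: nearW => t; rewrite asyE.
have le_lt (t : R) : 0 < t < T -> 0 < t <= T by move=> /andP[-> /ltW].
split.
  move=> u; have [U [solU UT uniqU]] := cauchy_problem T0 cA u cF; exists U; split => // hfin.
  have lim xi : exists v, mxcvg 0^'+ (fun t => W false xi t *m U t xi) v.
    have [cU dU] := fibers_of_is_solution solU xi.
    exact: (gauged_limit (ag false xi) cU (cF xi) dU (fin _ _ (hfin xi))).
  have [uA huA] := boolp.choice lim; exists uA; split; first exact: ((limE false U uA).1 huA).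
  move=> xi t0 t0T; have [_ t0T'] := andP t0T; have [cU dU] := fibers_of_is_solution solU xi.
  rewrite asyI (forcingE (fin _ _ (hfin xi)) t0T') -EFinD -EFinM lee_fin asyE.
  exact: (gauged_limit_bound (ag false xi) cU (cF xi) dU (fin _ _ (hfin xi)) (huA xi) t0T).
move=> hfin uA.
have [V hV] : {V : 'rV[R]_d -> R -> 'cV[R[i]]_n & forall xi,
    (forall t, 0 < t <= T -> has_deriv_on setT (V xi) t (A t xi *m V xi t + F t xi)) /\
    mxcvg 0^'+ (fun t => W true xi t *m V xi t) (uA xi)}.
  apply: (@boolp.choice _ _ (fun xi v =>
    (forall t, 0 < t <= T -> has_deriv_on setT v t (A t xi *m v t + F t xi)) /\
    mxcvg 0^'+ (fun t => W true xi t *m v t) (uA xi))) => xi.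
  by have [v dv lv] := scattering_exists (ag true xi) (uA xi) (cF xi) (fin _ _ (hfin xi)); exists v.
have solV : is_solution T A F (fun t xi => V xi t).
  by apply: is_solution_of_fibers => // xi t; exact: (hV xi).1.
exists (fun t xi => V xi t); split => //.
- by apply: (limE true (fun t xi => V xi t) uA).1 => xi; exact: (hV xi).2.
- move=> U' solU' lim t xi t0T; have limU' := (limE true U' uA).2 lim.
  have [cD dD] := solution_difference solU' solV xi.
  apply/eqP; rewrite -subr_eq0; apply/eqP.
  apply: (zero_limit_unique (ag true xi) cD dD _ t0T).
  rewrite -(subrr (uA xi)) (_ : (fun t => _) = fun t => W true xi t *m U' t xi - W true xi t *m V xi t).
    by apply: mxcvgB; [exact: limU'|exact: (hV xi).2].
  by apply/funext => s; rewrite mulmxBr.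
- move=> xi t0 t0T; have [_ t0T'] := andP t0T; have [cV dV] := fibers_of_is_solution solV xi.
  rewrite asyI (forcingE (fin _ _ (hfin xi)) t0T') -EFinD -EFinM lee_fin asyE.
  exact: (gauged_limit_bound (ag true xi) cV (cF xi) dV (fin _ _ (hfin xi)) (hV xi).2 t0T).
Qed.
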